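(* Let $\varphi=\frac{1+\sqrt5}{2}$. (a) Let $\alpha\in\mathbb{R}\setminus\mathbb{Q}$ with $\rho:=\mu(\alpha)-1>\varphi$. For all $\beta\in(0,1)$, $$\overline{\Gamma}(\alpha,\beta)\ \ge\ \overline{\Gamma}_{\mathcal{L}}(\alpha,\beta)\ \ge\ \frac{\rho^2}{2\rho^2-1}\qquad\text{and}\qquad \underline{\Gamma}(\alpha,\beta)\ \ge\ \underline{\Gamma}_{\mathcal{L}}(\alpha,\beta)\ \ge\ \frac{\rho}{\rho^2+\rho-1},$$ where the right-hand sides are understood to be $1/2$ and $0$ respectively when $\rho=\infty$. (b) These lower bounds are sharp: for every real $\rho>\varphi$ there is an uncountable set of $\alpha\in\mathbb{R}\setminus\mathbb{Q}$ with $\mu(\alpha)=1+\rho$ such that, for each such $\alpha$, there are uncountably many $\beta\in(0,1)$ for which equality holds throughout in (a), that is, $$\overline{\Gamma}(\alpha,\beta)=\overline{\Gamma}_{\mathcal{L}}(\alpha,\beta)=\frac{\rho^2}{2\rho^2-1}\qquad\text{and}\qquad \underline{\Gamma}(\alpha,\beta)=\underline{\Gamma}_{\mathcal{L}}(\alpha,\beta)=\frac{\rho}{\rho^2+\rho-1}.$$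
   Context: Irrationality exponent: $\mu(\alpha)\in[2,\infty]$ is the supremum of $\mu\in\mathbb{R}$ for which $0<|\alpha-p/q|<q^{-\mu}$ has infinitely many solutions $p\in\mathbb{Z}$, $q\in\mathbb{N}$. Edit distance: for finite words $w,\tilde w$ over an alphabet, $\mathrm{d}_E(w,\tilde w)$ is half the minimal number of operations needed to transform $w$ into $\tilde w$, where an operation is the deletion or the insertion of a single letter at an arbitrary position. Coding: $\mathbb{T}=\mathbb{R}/\mathbb{Z}$ is identified with $[0,1)$, and $\mathcal{L}$ is Lebesgue measure on $\mathbb{T}$; $x \bmod 1$ is the unique element of $x+\mathbb{Z}$ in $[0,1)$. For $\alpha\in\mathbb{R}\setminus\mathbb{Q}$, $\beta\in(0,1)$, $x\in\mathbb{T}$, $n\in\mathbb{Z}$, let $\xi_n(x):=\mathbf{1}_{[0,\beta)}(x+n\alpha \bmod 1)$, and $\xi_{[0,N)}(x):=(\xi_n(x))_{n=0}^{N-1}\in\{0,1\}^N$. Put $d_N(x,y):=\mathrm{d}_E(\xi_{[0,N)}(x),\xi_{[0,N)}(y))$, $\mathcal{W}_N:=\{\xi_{[0,N)}(x):x\in\mathbb{T}\}$ and $\mathrm{diam}_E(\mathcal{W}_N):=\max_{x,y\in\mathbb{T}}d_N(x,y)$. Exponents: $\overline{\Gamma}(\alpha,\beta):=\limsup_{N\to\infty}\frac{\log \mathrm{diam}_E(\mathcal{W}_N)}{\log N}$ and $\underline{\Gamma}(\alpha,\beta):=\liminf_{N\to\infty}\frac{\log \mathrm{diam}_E(\mathcal{W}_N)}{\log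 N}$. The functions $(x,y)\mapsto\limsup_{N}\frac{\log d_N(x,y)}{\log N}$ and $(x,y)\mapsto\liminf_{N}\frac{\log d_N(x,y)}{\log N}$ are constant for $\mathcal{L}\times\mathcal{L}$-almost every $(x,y)\in\mathbb{T}^2$ (by ergodicity); these constants are denoted $\overline{\Gamma}_{\mathcal{L}}(\alpha,\beta)$ and $\underline{\Gamma}_{\mathcal{L}}(\alpha,\beta)$ respectively. *)

(* Defs.v *)
From HB Require Import structures.
From mathcomp Require Import all_boot all_order all_algebra.
From mathcomp Require Import all_classical all_reals all_analysis.
Set Implicit Arguments.
Unset Strict Implicit.
Unset Printing Implicit Defensive.
Import Order.TTheory GRing.Theory Num.Theory.
Import numFieldNormedType.Exports.

Local Open Scope classical_set_scope.
Local Open Scope ring_scope.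

Definition golden_ratio {R : realType} : R := (1 + Num.sqrt 5) / 2.

(* Solutions are counted as pairs (p, q); fractions need not be reduced. *)
Definition approximations {R : realType} (alpha mu : R) : set (int * nat) :=
  [set pq | (0 < pq.2)%N /\
     0 < `|alpha - pq.1%:~R / pq.2%:R| < pq.2%:R `^ (- mu)].

Definition irrationality_exponent {R : realType} (alpha : R) : \bar R :=
  ereal_sup [set mu%:E | mu in [set mu : R |
    infinite_set (approximations alpha mu)]].

Section EditDistance.
Context {T : eqType}.
Implicit Types v w : seq T.

Definition deletes_to v w : bool :=
  [exists i : 'I_(size v), w == take i v ++ drop i.+1 v].

(* Inserting a letter into [v] yields [w] iff deleting one from [w] yields
   [v]. *)
Definition edit_op v w : bool := deletes_to v w || deletes_to w v.

Definition edit_seq v w (n : nat) : Prop :=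
  exists s : seq (seq T), [/\ path edit_op v s, last v s = w & size s = n].

Lemma edit_seq_ex v w : exists n, `[< edit_seq v w n >].
Proof.
have del x u : deletes_to (x :: u) u.
  by apply/existsP; exists ord0; rewrite /= drop0.
have step v1 v2 v3 n : edit_op v1 v2 -> edit_seq v2 v3 n ->
    edit_seq v1 v3 n.+1.
  by move=> e [s [ps ls <-]]; exists (v2 :: s); split=> //=; rewrite e ps.
have ins u : exists n, edit_seq [::] u n.
  elim: u => [|x u [n [s [ps ls ss]]]]; first by exists 0%N, [::].
  exists n.+1, (rcons s (x :: u)); split.
  - by rewrite rcons_path ps ls /edit_op del orbT.
  - by rewrite last_rcons.
  - by rewrite size_rcons ss.
suff [n nP] : exists n, edit_seq v w n by exists n; apply/asboolP.
elim: v => [|x v [n nP]]; first exact: ins.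
by exists n.+1; apply: step nP; rewrite /edit_op del.
Qed.

Definition edit_count v w : nat := ex_minn (edit_seq_ex v w).

Definition edit_distance (R : realType) v w : R := (edit_count v w)%:R / 2.

(* A maximum when [W] is finite and nonempty: see [edit_diameter_max]. *)
Definition edit_diameter (R : realType) (W : set (seq T)) : R :=
  sup [set edit_distance R v w | v in W & w in W].

End EditDistance.

Section Coding.
Context {R : realType}.
Implicit Types alpha beta x y : R.

(* The circle R/Z, identified with [0, 1). *)
Definition circle : set R := `[0, 1[.

Definition mod1 x : R := x - (Num.floor x)%:~R.

Definition xi alpha beta (n : int) x : bool :=
  mod1 (x + n%:~R * alpha) \in `[0, beta[.

Definition xi_word alpha beta (N : nat) x : seq bool :=
  [seq xi alpha beta n%:Z x | n <- iota 0 N].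

Definition word_distance alpha beta (N : nat) x y : R :=
  edit_distance R (xi_word alpha beta N x) (xi_word alpha beta N y).

Definition words alpha beta (N : nat) : set (seq bool) :=
  [set xi_word alpha beta N x | x in circle].

Local Open Scope ereal_scope.

(* [lne 0 = -oo]; the terms [N < 2] are junk and do not affect limits. *)
Definition log_ratio (d : nat -> R) (N : nat) : \bar R :=
  lne (d N)%:E / (ln N%:R)%:E.

Definition Gamma_sup alpha beta : \bar R :=
  limn_esup (log_ratio (fun N => edit_diameter R (words alpha beta N))).

Definition Gamma_inf alpha beta : \bar R :=
  limn_einf (log_ratio (fun N => edit_diameter R (words alpha beta N))).

(* [c] is the value of [f] at almost every point of the torus. *)
Definition is_ae_value (f : R -> R -> \bar R) (c : \bar R) : Prop :=
  \forall p \ae (@lebesgue_measure R \x @lebesgue_measure R),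
    circle p.1 -> circle p.2 -> f p.1 p.2 = c.

(* The default is [-oo], so that any real lower bound on [ae_value f] entails
   that [f] is almost everywhere constant. *)
Definition ae_value (f : R -> R -> \bar R) : \bar R :=
  xget -oo [set c | is_ae_value f c].

Definition GammaL_sup alpha beta : \bar R :=
  ae_value (fun x y =>
    limn_esup (log_ratio (fun N => word_distance alpha beta N x y))).

Definition GammaL_inf alpha beta : \bar R :=
  ae_value (fun x y =>
    limn_einf (log_ratio (fun N => word_distance alpha beta N x y))).

Local Close Scope ereal_scope.

(* The value at [-oo] is never used: [rho] exceeds the golden ratio. *)
Definition sup_bound (rho : \bar R) : \bar R :=
  match rho with
  | r%:E => (r ^+ 2 / (2 * r ^+ 2 - 1))%:E
  | _ => (1 / 2)%:E
  end.

Definition inf_bound (rho : \bar R) : \bar R :=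
  match rho with
  | r%:E => (r / (r ^+ 2 + r - 1))%:E
  | _ => 0%:E
  end.

End Coding.

Lemma edit_diameter_max (R : realType) (T : eqType) (W : set (seq T)) :
  finite_set W -> W !=set0 ->
  exists v w, [/\ W v, W w, edit_diameter R W = edit_distance R v w &
    forall v' w', W v' -> W w' -> edit_distance R v' w' <= edit_distance R v w].
Proof.
move=> fW [w0 Ww0].
pose m := [set edit_count v w | v in W & w in W].
have [n [v Wv [w Ww nE]] nmax] : exists2 n, m n & forall k, m k -> (k <= n)%N.
  have [s sE] : exists s : seq nat, m = [set` s].
    exact/finite_seqP/finite_image2.
  have ms k : m k = (k \in s) by rewrite sE.
  have n0 : exists k, k \in s.
    by exists (edit_count w0 w0); rewrite -ms; exists w0 => //; exists w0.
  have ub k : k \in s -> (k <= \max_(i <- s) i)%N.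
    by move=> ks; rewrite (big_rem k ks)/= leq_maxl.
  case: (ex_maxnP n0 ub) => n ns nmax.
  by exists n => [|k]; rewrite ms//; exact: nmax.
have vw v' w' : W v' -> W w' -> edit_distance R v' w' <= edit_distance R v w.
  move=> Wv' Ww'; rewrite ler_pM2r// ler_nat nE.
  by apply: nmax; exists v' => //; exists w'.
exists v, w; split => //; apply/eqP; rewrite eq_le; apply/andP; split.
  apply: ge_sup; first by exists (edit_distance R v w), v => //; exists w.
  by move=> _ [v' Wv' [w' Ww' <-]]; exact: vw.
apply: ub_le_sup; last by exists v => //; exists w.
by exists (edit_distance R v w) => _ [v' Wv' [w' Ww' <-]]; exact: vw.
Qed.

Lemma words_finite (R : realType) (alpha beta : R) N :
  finite_set (words alpha beta N).
Proof.
apply: (@sub_finite_set _ _ [set` [seq val t | t : N.-tuple bool]]); last first.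
  exact: finite_seq.
move=> _ [x _ <-] /=.
have s : size (xi_word alpha beta N x) == N by rewrite size_map size_iota.
by apply/mapP; exists (Tuple s) => //; rewrite mem_enum.
Qed.

Lemma is_ae_value_unique (R : realType) (f : R -> R -> \bar R) c c' :
  is_ae_value f c -> is_ae_value f c' -> c = c'.
Proof.
move=> fc fc'; apply: contrapT => cc'.
have [E [mE E0 sE]] : almost_everywhere
    (@lebesgue_measure R \x @lebesgue_measure R)%E
    [set p | ~ (circle p.1 /\ circle p.2)].
  have F := ae_filter_ringOfSetsType
    (@lebesgue_measure R \x @lebesgue_measure R)%E.
  apply: (@filterS2 _ _ F _ _ _ _ fc fc') => p {}fc {}fc' [p1 p2].
  by apply: cc'; rewrite -(fc p1 p2) (fc' p1 p2).
have : ((@lebesgue_measure R \x @lebesgue_measure R) (circle `*` circle) <=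
        (@lebesgue_measure R \x @lebesgue_measure R) E)%E.
  apply: le_measure; rewrite ?inE//.
    by apply: measurableX; exact: measurable_itv.
  by move=> p pc; apply: (sE p) => /=; exact.
have c1 : lebesgue_measure (@circle R) = 1%E.
  by rewrite /circle lebesgue_measure_itv /= lte_fin ltr01 oppr0 adde0.
rewrite E0 product_measure1E; [|exact: measurable_itv..].
by move: c1 => /= ->; rewrite mul1e lee_fin ler10.
Qed.

Lemma ae_valueP (R : realType) (f : R -> R -> \bar R) c :
  is_ae_value f c -> ae_value f = c.
Proof.
by move=> fc; apply: (is_ae_value_unique _ fc); exact: xgetI fc.
Qed.

(* Main.v *)
(** Let [p / q] be a reduced fraction and [delta = |q * alpha - p|].

    Lower bounds.  An alignment of the codings of [x] and [y] that leaves a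
    block of [q] letters intact matches it at a shift [h] for which
    [y - x + h * alpha] lies within [2 / q] of an integer.  If [j * alpha]
    stays [4 / q] away from the integers for [0 < j < s], changing the shift
    costs about [s].  If the shift is kept, the orbit drifts by [delta] every
    [q] steps, so that within [3 / delta] letters it meets the arc separating
    the two codings in many consecutive blocks, unless [y - x + h * alpha] is
    extremely close to an integer; for almost every [(x, y)] Borel-Cantelli
    excludes this.  Hence each of the [N * delta / 3] windows costs about [s],
    and the scales of [p / q], [s] and [N] are optimised.

    Sharpness.  If [|beta - B / q| <= 4 * delta], then over [1 / (2 * delta)]
    letters the coding differs in few places from the periodic word
    [t |-> (G + t * p) mod q < B].  When [s * p = 1] or [-1] modulo [q],
    changing [G] by one shifts this word by [s], so the diameter is
    [O(q + s * (N * delta + 1))].  The extremal [alpha] have convergents with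
    [q_(k+1)] comparable to [q_k ^ rho], for which [s = q_(k-1)] is possible,
    and [beta] is approximated by fractions [B_k / q_k].  At every step of
    either construction the sign of the increment is free, and a Cantor
    diagonal argument shows that uncountably many values arise. *)

Require Import Defs.
From HB Require Import structures.
From mathcomp Require Import all_boot all_order all_algebra.
From mathcomp Require Import all_classical all_reals all_analysis.
From mathcomp Require Import measurable_realfun.
From mathcomp Require Import zify ring lra.
Import Order.TTheory GRing.Theory Num.Theory.
Import numFieldNormedType.Exports.
Set Implicit Arguments.
Unset Strict Implicit.
Unset Printing Implicit Defensive.

Local Open Scope classical_set_scope.
Local Open Scope ring_scope.

(** * Alignments of words *)

Section EditCount.
Context {T : eqType}.
Implicit Types (u v w : seq T) (n : nat).
Local Open Scope nat_scope.

(** An alignment may shift by any amount; only its own cost limits the shift. Hence the lower bounds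
    are alternatives: either twice the cost exceeds [H], which is already large, or all shifts stay
    within [H] and the windows can be counted. Write [Q = 1 / delta]; its largest order is
    [q ^ rho]. Separation of the multiples of [alpha] gives [s] of order [q ^ (1 / rho)], while [H]
    is nearly [Q]. For the limit superior, [N] is chosen to equate [N * s / Q] with [Q]: if
    [s = Q ^ kappa] with [kappa = 1 / rho ^ 2], then [N = Q ^ (2 - kappa)], and the exponent is
    [1 / (2 - kappa)]. For the limit inferior every [N] has to be served. Dirichlet's theorem at
    scale [X] gives [q <= X <= Q]; [N * s / Q] is least for [q] near [X] and [Q] near [X ^ rho], so
    a cost of order [X] needs [N = X ^ (1 + rho - 1 / rho)]. The golden ratio is the value at which
    [q * s] and [Q] have the same order. In the extremal examples the diameter is at most of order
    [q + N * q ^ (1 / rho - rho)], whose two terms agree at that same [N], now with [q] in place of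
    [X]. *)

Lemma deletesP v w :
  reflect (exists a x b, v = a ++ x :: b /\ w = a ++ b) (deletes_to v w).
Proof.
apply: (iffP existsP) => [[i /eqP ->]|[a [x [b [-> ->]]]]].
  have x0 : T by case: v i => [[]|].
  by exists (take i v), (nth x0 v i), (drop i.+1 v); rewrite -drop_nth// cat_take_drop.
have la : size a < size (a ++ x :: b) by rewrite size_cat /= addnS ltnS leq_addr.
exists (Ordinal la); rewrite /= take_size_cat// -cat_rcons drop_size_cat//.
by rewrite size_rcons.
Qed.

Lemma edit_opC v w : edit_op v w = edit_op w v.
Proof. by rewrite /edit_op orbC. Qed.

Lemma edit_seq_count v w : edit_seq v w (edit_count v w).
Proof. by rewrite /edit_count; case: ex_minnP => n /asboolP. Qed.

Lemma edit_count_le v w n : edit_seq v w n -> edit_count v w <= n.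
Proof. by move=> s; rewrite /edit_count; case: ex_minnP => m _ -> //; apply/asboolP. Qed.

Lemma edit_count_op v w : edit_op v w -> edit_count v w <= 1.
Proof. by move=> e; apply: edit_count_le; exists [:: w]; split; rewrite //= e. Qed.

Lemma edit_count_triangle u v w :
  edit_count u w <= edit_count u v + edit_count v w.
Proof.
have [s [ps ls <-]] := edit_seq_count u v.
have [t [pt lt <-]] := edit_seq_count v w.
apply: edit_count_le; exists (s ++ t); split; last by rewrite size_cat.
  by rewrite cat_path ps ls.
by rewrite last_cat ls.
Qed.

Lemma edit_count_refl v : edit_count v v = 0.
Proof. by apply/eqP; rewrite -leqn0; apply: edit_count_le; exists [::]. Qed.

Lemma edit_count_homo (f : seq T -> seq T) v w :
  {homo f : a b / edit_op a b} -> edit_count (f v) (f w) <= edit_count v w.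
Proof.
move=> fop; have [s [ps ls <-]] := edit_seq_count v w.
apply: edit_count_le; exists (map f s); split; last by rewrite size_map.
  by rewrite path_map; apply: sub_path ps => a b /fop.
by rewrite last_map ls.
Qed.

Lemma edit_op_cat a b v w : edit_op v w -> edit_op (a ++ v ++ b) (a ++ w ++ b).
Proof.
have H c d : deletes_to c d -> deletes_to (a ++ c ++ b) (a ++ d ++ b).
  move=> /deletesP[c1 [x [c2 [-> ->]]]]; apply/deletesP.
  by exists (a ++ c1), x, (c2 ++ b); rewrite -!catA.
by rewrite /edit_op => /orP[/H ->|/H ->]; rewrite ?orbT.
Qed.

Lemma edit_count_cat v1 v2 w1 w2 :
  edit_count (v1 ++ v2) (w1 ++ w2) <= edit_count v1 w1 + edit_count v2 w2.
Proof.
apply: leq_trans (edit_count_triangle _ (w1 ++ v2) _) _; apply: leq_add.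
  by apply: (@edit_count_homo (cat^~ v2)) => a b /(edit_op_cat [::] v2).
by apply: (@edit_count_homo (cat w1)) => a b /(edit_op_cat w1 [::]); rewrite !cats0.
Qed.

Lemma edit_countC v w : edit_count v w = edit_count w v.
Proof.
suff H (a b : seq T) : edit_count b a <= edit_count a b by apply/eqP; rewrite eqn_leq !H.
have [s [ps ls <-]] := edit_seq_count a b.
apply: edit_count_le; exists (rev (belast a s)); split.
- rewrite -ls rev_path; apply: sub_path ps => c d.
  by rewrite edit_opC.
- by rewrite -nth_last size_rev size_belast; case: s ps ls => [|c s] _ <- //=;
    rewrite rev_cons nth_rcons size_rev size_belast ltnn eqxx.
- by rewrite size_rev size_belast.
Qed.

Lemma edit_count_drop u v : edit_count (u ++ v) v <= size u.
Proof.
elim: u => [|x u ih]; first by rewrite edit_count_refl.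
apply: leq_trans (edit_count_triangle _ (u ++ v) _) _.
rewrite /= -add1n leq_add//; apply: edit_count_op.
by rewrite /edit_op; apply/orP; left; apply/deletesP; exists [::], x, (u ++ v).
Qed.

Lemma edit_count_take u v : edit_count (v ++ u) v <= size u.
Proof.
rewrite -{2}(cats0 v); apply: leq_trans (edit_count_cat _ _ _ _) _.
by rewrite edit_count_refl -{1}(cats0 u); exact: edit_count_drop.
Qed.

Lemma edit_count_eq0 v w : edit_count v w = 0 -> v = w.
Proof. by move=> e; have := edit_seq_count v w; rewrite e => -[s [_ <- /size0nil ->]]. Qed.

Lemma edit_count_size v w : size w <= size v + edit_count v w.
Proof.
have [s [ps ls <-]] := edit_seq_count v w.
elim: s v ps ls => [v _ /= ->|u s ih v /= /andP[e ps] ls]; first by rewrite addn0.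
apply: leq_trans (ih _ ps ls) _; rewrite addnS -addSn leq_add2r.
by case/orP: e => /deletesP[a [x [b [-> ->]]]]; rewrite !size_cat /=; lia.
Qed.

Lemma edit_op_split v1 v2 w : edit_op (v1 ++ v2) w -> exists w1 w2, w = w1 ++ w2 /\
  (edit_op v1 w1 /\ v2 = w2 \/ v1 = w1 /\ edit_op v2 w2).
Proof.
(* Levi's lemma: of two factorisations of one word, one cut lies to the left of the other. *)
have cut a b c d : a ++ b = c ++ d :> seq T ->
    (exists e, c = a ++ e /\ b = e ++ d) \/ (exists e, a = c ++ e /\ d = e ++ b).
  elim: a c => [|x a ih] [|y c] /=.
  - by move=> ->; left; exists [::].
  - by move=> ->; left; exists (y :: c).
  - by move=> <-; right; exists (x :: a).
  - move=> [-> /ih[[e [-> ->]]|[e [-> ->]]]].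
      by left; exists e.
    by right; exists e.
have opl v x a b : v = a ++ x :: b -> edit_op v (a ++ b).
  by move=> ->; rewrite /edit_op; apply/orP; left; apply/deletesP; exists a, x, b.
case/orP => /deletesP[a [x [b [e1 e2]]]].
  have [[c [ac cb]]|[c [vc cb]]] := cut _ _ _ _ e1.
    exists v1, (c ++ b); rewrite e2 ac catA; split=> //; right; split=> //.
    by rewrite cb (opl _ x c b).
  case: c vc cb => [|y c] vc /= cb.
    exists v1, b; rewrite vc cats0 -e2; split=> //.
    by right; split=> //; rewrite -cb (opl _ x [::] b).
  case: cb => _ be; exists (a ++ c), v2; rewrite e2 be catA; split=> //; left.
  by split=> //; rewrite (opl _ y a c).
have [[c [ac cb]]|[c [vc cb]]] := cut _ _ _ _ e2.
  exists v1, (c ++ x :: b); rewrite e1 ac catA; split=> //; right; split=> //.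
  by rewrite edit_opC cb (opl _ x c b).
exists (a ++ x :: c), v2; rewrite e1 cb -catA; split=> //; left; split=> //.
by rewrite edit_opC vc (opl _ x a c).
Qed.

(** Operations are followed one at a time, and each is charged to the factor in which it acts. This
    allows an optimal alignment to be cut into local pieces whose costs add up to at most the
    total. *)
Lemma edit_count_split v1 v2 w : exists w1 w2, w = w1 ++ w2 /\
  edit_count v1 w1 + edit_count v2 w2 <= edit_count (v1 ++ v2) w.
Proof.
have [s [ps ls <-]] := edit_seq_count (v1 ++ v2) w.
elim: s v1 v2 ps ls => [|u s ih] v1 v2 /=.
  by move=> _ <-; exists v1, v2; rewrite !edit_count_refl.
move=> /andP[e]; have [u1 [u2 [-> H]]] := edit_op_split e => ps ls.
have [w1 [w2 [-> le]]] := ih _ _ ps ls; exists w1, w2; split=> //.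
case: H => [[op1 e2]|[e1 op2]].
  have := edit_count_triangle v1 u1 w1; have := edit_count_op op1.
  by rewrite e2; lia.
have := edit_count_triangle v2 u2 w2; have := edit_count_op op2.
by rewrite e1; lia.
Qed.

End EditCount.

(** * Cutting an alignment into windows *)

Section Subwords.
Local Open Scope nat_scope.
Context {T : eqType}.
Implicit Types f g : nat -> T.

Definition subword f (i n : nat) : seq T := [seq f k | k <- iota i n].

Lemma size_subword f i n : size (subword f i n) = n.
Proof. by rewrite size_map size_iota. Qed.

Lemma subword_cat f i m n : subword f i (m + n) = subword f i m ++ subword f (i + m) n.
Proof. by rewrite /subword iotaD map_cat. Qed.

Lemma eq_subword f g i j n : (forall t, t < n -> f (i + t) = g (j + t)) ->
  subword f i n = subword g j n.
Proof.
move=> fg; rewrite /subword -(addn0 i) -(addn0 j) !iotaDl -!map_comp.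
by apply/eq_in_map => t; rewrite mem_iota /= => /fg.
Qed.

Lemma subword_inj f g i j n : subword f i n = subword g j n ->
  forall t, t < n -> f (i + t) = g (j + t).
Proof.
move=> e t tn; move/(congr1 (fun s => nth (f 0) s t)): e.
by rewrite !(nth_map 0) ?size_iota// !nth_iota.
Qed.

(** Both words arise from the window of length [h + n] at [i] by deleting [h] letters at one of its
    ends. *)
Lemma edit_count_shift f i n h :
  edit_count (subword f i n) (subword f (i + h) n) <= 2 * h.
Proof.
have := edit_count_drop (subword f i h) (subword f (i + h) n).
rewrite -subword_cat size_subword => h1.
have := edit_count_take (subword f (i + n) h) (subword f i n).
rewrite -subword_cat size_subword addnC edit_countC => h2.
have := edit_count_triangle (subword f i n) (subword f i (h + n)) (subword f (i + h) n).
lia.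
Qed.

Lemma edit_count_hamming f g i n :
  edit_count (subword f i n) (subword g i n) <= 2 * count (fun k => f k != g k) (iota i n).
Proof.
rewrite /subword; elim: (iota i n) => [|k s ih] /=; first by rewrite edit_count_refl.
rewrite -cat1s -[g k :: _]cat1s.
apply: leq_trans (edit_count_cat _ _ _ _) _; rewrite mulnDr leq_add//.
have [->|_] := eqVneq; first by rewrite edit_count_refl.
apply: leq_trans (edit_count_triangle _ [::] _) _.
rewrite (edit_countC [::]).
have := edit_count_drop [:: f k] [::]; have := edit_count_drop [:: g k] [::].
by rewrite !cats0 /=; lia.
Qed.

Lemma edit_count_subword_split f g i n1 n2 j m : exists2 m1, m1 <= m &
  edit_count (subword f i n1) (subword g j m1) +
  edit_count (subword f (i + n1) n2) (subword g (j + m1) (m - m1))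
  <= edit_count (subword f i (n1 + n2)) (subword g j m).
Proof.
rewrite subword_cat.
have [w1 [w2 [e le]]] :=
  edit_count_split (subword f i n1) (subword f (i + n1) n2) (subword g j m).
have sz : size w1 + size w2 = m by rewrite -size_cat -e size_subword.
have m1m : size w1 <= m by rewrite -sz leq_addr.
exists (size w1) => //; move: e; rewrite -{1}(subnKC m1m) subword_cat => /eqP.
by rewrite eqseq_cat ?size_subword// => /andP[/eqP -> /eqP ->].
Qed.

(* The offset [js k - k * l] never strays further than the cost. *)
Lemma edit_count_pieces f g l K i j m :
  let e := edit_count (subword f i (K * l)) (subword g j m) in
  exists js : nat -> nat,
  [/\ js 0 = j, (forall k, k <= K -> js k <= j + k * l + e /\ j + k * l <= js k + e) &
   \sum_(k < K) edit_count (subword f (i + k * l) l) (subword g (js k) (js k.+1 - js k))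
   <= e].
Proof.
elim: K i j m => [|K ih] i j m /=.
  exists (fun=> j); rewrite big_ord0; split=> // k.
  by rewrite leqn0 => /eqP ->; lia.
rewrite mulSn; have [m1 m1m le] := edit_count_subword_split f g i l (K * l) j m.
have [js [js0 drift sum]] := ih (i + l) (j + m1) (m - m1).
have := edit_count_size (subword f i l) (subword g j m1).
have := edit_count_size (subword g j m1) (subword f i l).
rewrite edit_countC !size_subword => m1l lm1.
exists (fun k => if k is k'.+1 then js k' else j); split=> //.
  move=> [|k] kK; first by lia.
  have [d1 d2] := drift k kK; rewrite mulSn; lia.
rewrite big_ord_recl /= mul0n addn0 js0 addKn; apply: leq_trans le.
rewrite leq_add2l; apply: leq_trans sum.
by apply: leq_sum => k _; rewrite /bump /= add1n mulSn addnA.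
Qed.

Definition run f g l i j := forall t, t < l -> f (i + t) = g (j + t).

(** If [e] were below both [s] and [M], any [M] consecutive blocks would contain one of cost zero,
    that is, a run. Take one such run; the second hypothesis names [M] consecutive blocks that admit
    no run at its shift. These contain another run, whose shift differs from the first by at most
    [2 * e < 2 * s]; the first hypothesis makes the two shifts equal, a contradiction. *)
Lemma edit_count_window f g l K M s H i j m :
  (forall i1 j1 i2 j2, run f g l i1 j1 -> run f g l i2 j2 ->
     i1 <= j1 + H -> j1 <= i1 + H -> i2 <= j2 + H -> j2 <= i2 + H ->
     j1 + i2 < j2 + i1 + 2 * s -> j2 + i1 < j1 + i2 + 2 * s -> j1 + i2 = j2 + i1) ->
  (forall i' j', i' <= j' + H -> j' <= i' + H -> forall i, exists2 k0, k0 + M <= K &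
     forall k, k0 <= k < k0 + M ->
     forall j, j + i' = j' + (i + k * l) -> ~ run f g l (i + k * l) j) ->
  let e := edit_count (subword f i (K * l)) (subword g j m) in
  i + e <= j + H -> j + e <= i + H -> minn s M <= e.
Proof.
move=> U V e ijH jiH; rewrite leqNgt; apply/negP; rewrite ltn_min => /andP[es eM].
have [js [js0 drift]] := edit_count_pieces f g l K i j m.
rewrite -/e in drift *.
set c := fun k => edit_count (subword f (i + k * l) l) (subword g (js k) (js k.+1 - js k)).
rewrite (eq_bigr (fun k : 'I_K => c k))// => sum.
have zero k : k < K -> c k = 0 -> run f g l (i + k * l) (js k).
  move=> kK /edit_count_eq0 E; have := congr1 size E; rewrite !size_subword => sz.
  by rewrite -sz in E; exact: subword_inj E.
have find k0 : k0 + M <= K -> exists2 k, k0 <= k < k0 + M & c k = 0.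
  move=> k0M; apply: contrapT => no.
  suff : M <= e by rewrite leqNgt eM.
  apply: leq_trans sum; rewrite -(big_mkord xpredT c).
  rewrite (@big_cat_nat _ _ _ k0)//=; last by lia.
  rewrite (@big_cat_nat _ _ _ (k0 + M) k0)//=; last by lia.
  rewrite addnCA; apply: leq_trans (leq_addr _ _).
  apply: (@leq_trans (\sum_(k0 <= k < k0 + M) 1)).
    by rewrite sum_nat_const_nat addKn muln1.
  rewrite big_nat_cond [leqRHS]big_nat_cond; apply: leq_sum => k /andP[kk _].
  by rewrite lt0n; apply/eqP => ck; apply: no; exists k.
(* Any admissible shift serves here: only [k0' + M <= K] is wanted, which makes room for a first
   block of cost zero. *)
have [k0' k0'M _] := V i i (leq_addr _ _) (leq_addr _ _) 0.
have [k1 /andP[_ k1M] ck1] := find k0' k0'M.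
have k1K : k1 < K by lia.
have r1 := zero _ k1K ck1; have [d1 d1'] := drift k1 (ltnW k1K).
have ijk1 : i + k1 * l <= js k1 + H by lia.
have jik1 : js k1 <= i + k1 * l + H by lia.
have [k0 k0M nr] := V _ _ ijk1 jik1 i.
have [k2 k2M ck2] := find k0 k0M.
have k2K : k2 < K by lia.
have r2 := zero _ k2K ck2; have [d2 d2'] := drift k2 (ltnW k2K).
apply: (nr k2 k2M (js k2) _ r2).
by apply/esym; apply: U r1 r2 _ _ _ _ _ _; lia.
Qed.

(** The total cost [e] bounds both the offset at which a piece starts and the cost of that piece, so
    [2 * e <= H] makes the local bound applicable to each of the [N %/ W] windows. *)
Lemma edit_count_windows f g W c H N :
  (forall i j m, let e := edit_count (subword f i W) (subword g j m) in
    i + e <= j + H -> j + e <= i + H -> c <= e) ->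
  let e := edit_count (subword f 0 N) (subword g 0 N) in
  2 * e <= H -> N %/ W * c <= e.
Proof.
move=> low e eH.
have [m1 _ le] := edit_count_subword_split f g 0 (N %/ W * W) (N %% W) 0 N.
rewrite -divn_eq -/e in le; have {}le := leq_trans (leq_addr _ _) le.
have [js [js0 drift sum]] := edit_count_pieces f g W (N %/ W) 0 0 m1.
apply: leq_trans (le); apply: leq_trans (sum).
rewrite -{1}(card_ord (N %/ W)) -sum_nat_const; apply: leq_sum => k _.
have [d1 d2] := drift k (ltnW (ltn_ord k)).
have : edit_count (subword f (0 + k * W) W) (subword g (js k) (js k.+1 - js k)) <= e.
  by apply: leq_trans le; apply: leq_trans sum; rewrite (bigD1 k)//= leq_addr.
by move=> ke; apply: low; lia.
Qed.

Lemma edit_count_lower f g l K M s H N :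
  (forall i1 j1 i2 j2, run f g l i1 j1 -> run f g l i2 j2 ->
     i1 <= j1 + H -> j1 <= i1 + H -> i2 <= j2 + H -> j2 <= i2 + H ->
     j1 + i2 < j2 + i1 + 2 * s -> j2 + i1 < j1 + i2 + 2 * s -> j1 + i2 = j2 + i1) ->
  (forall i' j', i' <= j' + H -> j' <= i' + H -> forall i, exists2 k0, k0 + M <= K &
     forall k, k0 <= k < k0 + M ->
     forall j, j + i' = j' + (i + k * l) -> ~ run f g l (i + k * l) j) ->
  let e := edit_count (subword f 0 N) (subword g 0 N) in
  2 * e <= H -> N %/ (K * l) * minn s M <= e.
Proof.
move=> U V; apply: edit_count_windows => i j m.
exact: (edit_count_window U V).
Qed.

End Subwords.

(** * Codings of rotations *)

Section Rotation.
Context {R : realType}.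
Implicit Types (alpha beta x y z a zeta eta : R) (p m h : int) (q i j k s M N : nat).

Definition in_arc beta u : bool := mod1 u \in `[0, beta[.

Lemma mod1DZ (u : R) m : mod1 (u + m%:~R) = mod1 u.
Proof. by rewrite /mod1 floorDrz ?intr_int// intrKfloor intrD opprD addrACA subrr addr0. Qed.

Lemma mod1_id (u : R) : 0 <= u < 1 -> mod1 u = u.
Proof. by move=> u01; rewrite /mod1 (@floor_def _ u 0) ?subr0//= add0r. Qed.

Lemma mod1_itv (u : R) : 0 <= mod1 u < 1.
Proof.
rewrite /mod1 subr_ge0 ge_floor ltrBlDr addrC /=.
by rewrite -[X in _ + X]/(1%:~R) -intrD floorD1_gt.
Qed.

Lemma in_arcDZ beta (u : R) m : in_arc beta (u + m%:~R) = in_arc beta u.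
Proof. by rewrite /in_arc mod1DZ. Qed.

(** The disagreement is found at the endpoint 0 of the arc. If the fractional part of [z] is at most
    [beta], points just left of 0 lie outside the arc and their translates inside; otherwise points
    just right of 0 lie inside and their translates outside. *)
Lemma arc_mismatch beta z zeta : 0 < zeta -> zeta <= beta -> zeta <= 1 - beta ->
  (forall m, zeta <= `|z - m%:~R|) ->
  exists a, forall u m, a < u - m%:~R < a + zeta -> in_arc beta u != in_arc beta (u + z).
Proof.
move=> zeta0 zb z1b zm; set z0 := mod1 z; set f := Num.floor z.
have [zE z01] : z = z0 + f%:~R /\ (0 <= z0 < 1) by rewrite mod1_itv /z0 /mod1 subrK.
have z0z : zeta <= z0 <= 1 - zeta.
  move: (zm f) (zm (f + 1)); rewrite [in X in X -> _]zE [in X in _ -> X -> _]zE intrD.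
  have -> : z0 + f%:~R - f%:~R = z0 by lra.
  have -> : z0 + f%:~R - (f%:~R + 1%:~R) = - (1 - z0) by rewrite mulr1z; lra.
  by rewrite normrN !ger0_norm; lra.
have inE (u : R) m (w : R) : u = w + m%:~R -> in_arc beta u = in_arc beta w.
  by move=> ->; rewrite in_arcDZ.
have yes w : 0 <= w < beta -> in_arc beta w.
  by move=> w0b; rewrite /in_arc mod1_id ?in_itv//=; lra.
have no w : beta <= w < 1 -> ~~ in_arc beta w.
  by move=> w0b; rewrite /in_arc mod1_id ?in_itv//=; lra.
have [z0b|bz0] := leP z0 beta.
  exists (- zeta) => u m um.
  rewrite (inE u (m - 1) (u - m%:~R + 1)); last by rewrite intrB; lra.
  rewrite (inE (u + z) (m + f) (u - m%:~R + z0)); last by rewrite intrD zE; lra.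
  by rewrite (negbTE (no _ _)) ?(yes _ _)//; lra.
exists 0 => u m um; rewrite (inE u m (u - m%:~R)); last by lra.
rewrite (inE (u + z) (m + f) (u - m%:~R + z0)); last by rewrite intrD zE; lra.
by rewrite (negbTE (no (_ + z0) _)) ?(yes _ _)//; lra.
Qed.

Lemma residue_hit p q i c : (0 < q)%N -> coprimez p q ->
  exists2 k, (i <= k < i + q)%N & exists m, k%:Z * p = c + m * q%:Z.
Proof.
move=> q0 /coprimezP[[u v] /= uv].
pose r := ((c * u - i%:Z) %% q%:Z)%Z.
have r0 : 0 <= r by rewrite modz_ge0//; lia.
have rq : r < q%:Z by rewrite ltz_pmod//; lia.
exists (i + `|r|)%N; first by lia.
have := divz_eq (c * u - i%:Z) q%:Z; rewrite -/r; set d := (_ %/ _)%Z => rE.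
exists (- c * v - d * p); rewrite PoszD gez0_abs//.
have -> : i%:Z + r = c * u - d * q%:Z by lia.
have -> : (c * u - d * q%:Z) * p = c * (u * p + v * q%:Z) - (c * v + d * p) * q%:Z by ring.
by rewrite uv; ring.
Qed.

(** In [q] steps [k * p] takes every residue modulo [q], while the drift away from the rational
    orbit varies by at most [1 / q]. One cell of the grid plus this drift explains the length
    [2 / q]. *)
Lemma orbit_hit alpha p q x a i : (0 < q)%N -> coprimez p q ->
  q%:R * `|q%:R * alpha - p%:~R| <= 1 ->
  exists2 k, (i <= k < i + q)%N & exists m,
    a < x + k%:R * alpha - m%:~R < a + 2 / q%:R.
Proof.
move=> q0 pq qs; set s := q%:R * alpha - p%:~R in qs.
have q0R : 0 < q%:R :> R by rewrite ltr0n.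
pose A : R := q%:R * (a - x) - i%:R * s.
(* With upward drift the least integer above [A], with downward drift one more than the ceiling of
   [A]: in both cases [c + (k - i) * s] lies strictly between [A] and [A + 2]. *)
pose c : int := 1 + (if 0 <= s then Num.floor A else - Num.floor (- A)).
have [k ikq [m km]] := residue_hit i c q0 pq.
exists k => //; exists m.
have E : q%:R * (x + k%:R * alpha - m%:~R) = q%:R * x + c%:~R + k%:R * s.
  have := congr1 (fun z : int => z%:~R : R) km; rewrite !(intrD, intrM) /= => km'.
  have : k%:R * s = q%:R * (k%:R * alpha) - k%:~R * p%:~R by rewrite /s; ring.
  by rewrite km'; lra.
have [ki1 ki2] : i%:R <= k%:R :> R /\ k%:R + 1 <= i%:R + q%:R :> R.
  by rewrite -natrD natr1 !ler_nat; lia.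
suff /andP[H1 H2] : q%:R * a < q%:R * (x + k%:R * alpha - m%:~R) < q%:R * a + 2.
  apply/andP; split; first by rewrite -(ltr_pM2l q0R).
  by rewrite -(ltr_pM2l q0R) [ltRHS]mulrDr (mulrCA _ 2) divff ?gt_eqF// mulr1.
rewrite E /c; have [s0|s0] := leP 0 s.
  have := floor_itv A; move: (Num.floor _) => F; rewrite /A !intrD !mulr1z => fl.
  by rewrite ger0_norm// in qs; apply/andP; split; nra.
have := floor_itv (- A); move: (Num.floor _) => F; rewrite /A !intrD intrN !mulr1z => fl.
by rewrite ltr0_norm// in qs; apply/andP; split; nra.
Qed.

(* A point drifting by [sigma] every [q] steps spends at least [M] consecutive
   periods in an interval longer than [M * |sigma|]. *)
Lemma orbit_hits_pos alpha p q M K zeta x a i : (0 < q)%N -> coprimez p q ->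
  let sigma := q%:R * alpha - p%:~R in
  0 < sigma -> q%:R * sigma <= 1 -> M%:R * sigma < zeta ->
  2 / (q%:R * sigma) + 1 + M%:R <= K%:R ->
  exists2 k0, (k0 + M <= K)%N & forall k, (k0 <= k < k0 + M)%N ->
    exists2 t, (t < q)%N & exists m,
      a < x + (i + k * q + t)%:R * alpha - m%:~R < a + zeta.
Proof.
move=> q0 pq /=; set s := _ - _ => s0 qs Mz K2.
have q0R : 0 < q%:R :> R by rewrite ltr0n.
(* A first visit just to the left of [a]; every further [q] steps move the point to the right by
   [s], and [n.+1] such moves carry it past [a]. *)
have [|k ikq [m am]] := @orbit_hit alpha p q x (a - 2 / q%:R) i q0 pq.
  by rewrite gtr0_norm.
set v := x + _ - _ in am; have {}am : a - 2 / q%:R < v < a by lra.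
have d0 : 0 <= (a - v) / s by rewrite divr_ge0 ?ltW//; lra.
have := truncn_itv d0; set n := Num.truncn _ => /andP[nle nge].
have {}nle : n%:R * s <= a - v by rewrite -ler_pdivlMr.
have {}nge : a - v < (n%:R + 1) * s by rewrite natr1 -ltr_pdivrMr.
exists n.+1.
  rewrite -(ler_nat R) natrD -natr1; apply: le_trans K2.
  rewrite lerD2r lerD2r ler_pdivlMr; last by rewrite mulr_gt0.
  have : q%:R * (a - v) < q%:R * (2 / q%:R) by rewrite ltr_pM2l//; lra.
  by rewrite (mulrCA _ 2) divff ?gt_eqF// mulr1; nra.
move=> j jM; exists (k - i)%N; first by clear - ikq; lia.
exists (m + j%:Z * p).
have -> : (i + j * q + (k - i) = k + j * q)%N by clear - ikq; lia.
have -> : x + (k + j * q)%:R * alpha - (m + j%:Z * p)%:~R = v + j%:R * s.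
  by rewrite /v /s natrD natrM intrD intrM /=; ring.
have [j1 j2] : n%:R + 1 <= j%:R :> R /\ j%:R <= n%:R + M%:R :> R.
  by rewrite natr1 -natrD !ler_nat; clear - jM; lia.
by apply/andP; split; nra.
Qed.

(** Negative drift becomes positive under the reflection of the circle, which exchanges the two ends
    of the interval. *)
Lemma orbit_hits alpha p q M K zeta x a i : (0 < q)%N -> coprimez p q ->
  let sigma := q%:R * alpha - p%:~R in
  0 < `|sigma| -> q%:R * `|sigma| <= 1 -> M%:R * `|sigma| < zeta ->
  2 / (q%:R * `|sigma|) + 1 + M%:R <= K%:R ->
  exists2 k0, (k0 + M <= K)%N & forall k, (k0 <= k < k0 + M)%N ->
    exists2 t, (t < q)%N & exists m,
      a < x + (i + k * q + t)%:R * alpha - m%:~R < a + zeta.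
Proof.
move=> q0 pq /=; set s := _ - _; have [sp|sn] := ltP 0 s.
  by rewrite gtr0_norm// => _; exact: orbit_hits_pos.
rewrite ler0_norm// => s0 qs Mz K2.
have sE : q%:R * - alpha - (- p)%:~R = - s by rewrite intrN /s; lra.
have := @orbit_hits_pos (- alpha) (- p) q M K zeta (- x) (- (a + zeta)) i q0.
rewrite sE coprimeNz; move=> /(_ pq s0 qs Mz K2)[k0 k0M h].
exists k0 => // k /h[t tq [m am]]; exists t => //; exists (- m).
by rewrite intrN; move: am; lra.
Qed.

Lemma xi_word_subword alpha beta N x :
  xi_word alpha beta N x = subword (fun n => in_arc beta (x + n%:R * alpha)) 0 N.
Proof. by []. Qed.

(** Otherwise [arc_mismatch] yields an interval of length [2 / q] on which the two codings disagree,
    and one of the [q] points of the block falls into it. *)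
Lemma rotation_run alpha beta x y p q i j : (0 < q)%N -> coprimez p q ->
  q%:R * `|q%:R * alpha - p%:~R| <= 1 ->
  2 / q%:R <= beta -> 2 / q%:R <= 1 - beta ->
  run (fun n => in_arc beta (x + n%:R * alpha))
    (fun n => in_arc beta (y + n%:R * alpha)) q i j ->
  exists m, `|y - x + (j%:Z - i%:Z)%:~R * alpha - m%:~R| < 2 / q%:R.
Proof.
move=> q0 pq qs b1 b2 r; apply: contrapT => no.
have [|m|a aP] := @arc_mismatch beta (y - x + (j%:Z - i%:Z)%:~R * alpha) _ _ b1 b2.
- by rewrite divr_gt0// ltr0n.
- by rewrite leNgt; apply/negP => lt; apply: no; exists m.
have [k /andP[ik kq] [m am]] := orbit_hit x a i q0 pq qs.
have {kq} kq : (k - i < q)%N by lia.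
have := r _ kq; rewrite subnKC//.
have -> : y + (j + (k - i))%:R * alpha =
    x + k%:R * alpha + (y - x + (j%:Z - i%:Z)%:~R * alpha).
  by rewrite intrB natrD natrB//=; ring.
by move/eqP; apply/negP/aP/am.
Qed.

(** Both hypotheses of [edit_count_lower] are verified. Subtracting the conclusions of
    [rotation_run] for two runs puts a multiple [j * alpha] within [4 / q] of an integer, which
    forces [j = 0] when [j < 2 * s]. At a fixed shift the codings disagree on an interval of length
    [eta > M * |sigma|], and [orbit_hits] finds [M] consecutive blocks that meet it. *)
Lemma rotation_lower alpha beta x y p q M s K H N eta : (0 < q)%N -> coprimez p q ->
  let sigma := q%:R * alpha - p%:~R in
  0 < `|sigma| -> q%:R * `|sigma| <= 1 ->
  2 / q%:R <= beta -> 2 / q%:R <= 1 - beta ->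
  eta <= 2 / q%:R -> M%:R * `|sigma| < eta ->
  2 / (q%:R * `|sigma|) + 1 + M%:R <= K%:R ->
  (forall j m, (0 < j < 2 * s)%N -> 4 / q%:R <= `|j%:R * alpha - m%:~R|) ->
  (forall h m, `|h| <= H%:Z -> eta <= `|y - x + h%:~R * alpha - m%:~R|) ->
  let e := edit_count (xi_word alpha beta N x) (xi_word alpha beta N y) in
  (2 * e <= H)%N -> (N %/ (K * q) * minn s M <= e)%N.
Proof.
move=> q0 pq /= s0 qs b1 b2 eq Me K2 js hH.
rewrite !xi_word_subword; apply: edit_count_lower.
- move=> i1 j1 i2 j2 /(rotation_run q0 pq qs b1 b2)[m1 r1].
  move=> /(rotation_run q0 pq qs b1 b2)[m2 r2] _ _ _ _ l1 l2.
  have key (h : int) : 0 < h -> h < (2 * s)%N%:Z -> forall m : int,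
      4 / q%:R <= `|h%:~R * alpha - m%:~R|.
    by case: h => // n n0 ns m; apply: js; clear - n0 ns; lia.
  have le4 m : `|((j1%:Z - i1%:Z) - (j2%:Z - i2%:Z))%:~R * alpha - (m1 - m2)%:~R| < 4 / q%:R.
    have -> : 4 / q%:R = 2 / q%:R + 2 / q%:R :> R by lra.
    apply: le_lt_trans (ltrD r1 r2); rewrite -[X in _ <= _ + X]normrN.
    by apply: le_trans (ler_normD _ _); rewrite !intrB le_eqVlt; apply/orP; left;
      apply/eqP; congr (`| _ |); ring.
  have [lt|gt|] := ltgtP (j1 + i2)%N (j2 + i1)%N; last by [].
    have d0 : 0 < (j2%:Z - i2%:Z) - (j1%:Z - i1%:Z) by clear - lt; lia.
    have ds : (j2%:Z - i2%:Z) - (j1%:Z - i1%:Z) < (2 * s)%N%:Z by clear - l2; lia.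
    have := key _ d0 ds (m2 - m1).
    rewrite -(opprB m1) -(opprB (j1%:Z - _)) !intrN mulNr -opprD normrN leNgt.
    by rewrite le4.
  have d0 : 0 < (j1%:Z - i1%:Z) - (j2%:Z - i2%:Z) by clear - gt; lia.
  have ds : (j1%:Z - i1%:Z) - (j2%:Z - i2%:Z) < (2 * s)%N%:Z by clear - l1; lia.
  have := key _ d0 ds (m1 - m2).
  by rewrite leNgt le4.
- move=> i' j' ij ji i.
  have q0R : 0 < q%:R :> R by rewrite ltr0n.
  have [|||m|a aP] := @arc_mismatch beta (y - x + (j'%:Z - i'%:Z)%:~R * alpha) eta.
  + by apply: le_lt_trans Me; rewrite mulr_ge0.
  + exact: le_trans b1.
  + exact: le_trans b2.
  + by apply: hH; clear - ij ji; lia.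
  have [k0 k0M hit] := orbit_hits x a i q0 pq s0 qs Me K2.
  exists k0 => // k /hit[t tq [m am]] j ji' r; have := r _ tq.
  have -> : y + (j + t)%:R * alpha =
    x + (i + k * q + t)%:R * alpha + (y - x + (j'%:Z - i'%:Z)%:~R * alpha).
    have : j%:R + i'%:R = j'%:R + (i + k * q)%:R :> R by rewrite -!natrD ji'.
    rewrite intrB !natrD /= => E.
    have -> : j%:R = j'%:R + (i%:R + (k * q)%:R) - i'%:R :> R by rewrite -E addrK.
    by ring.
  by move/eqP; apply/negP/aP/am.
Qed.

(** If no admissible shift brings the two points within [2 / q] of each other, no block of [q]
    letters is matched at all, so each costs at least one operation. No separation of the multiples
    of [alpha] enters. *)
Lemma rotation_lower_far alpha beta x y p q H N : (0 < q)%N -> coprimez p q ->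
  q%:R * `|q%:R * alpha - p%:~R| <= 1 ->
  2 / q%:R <= beta -> 2 / q%:R <= 1 - beta ->
  (forall h m, `|h| <= H%:Z -> 2 / q%:R <= `|y - x + h%:~R * alpha - m%:~R|) ->
  let e := edit_count (xi_word alpha beta N x) (xi_word alpha beta N y) in
  (2 * e <= H)%N -> (N %/ q <= e)%N.
Proof.
move=> q0 pq qs b1 b2 hH; rewrite !xi_word_subword.
have no i j : (i <= j + H)%N -> (j <= i + H)%N ->
    ~ run (fun n => in_arc beta (x + n%:R * alpha))
      (fun n => in_arc beta (y + n%:R * alpha)) q i j.
  move=> ij ji /(rotation_run q0 pq qs b1 b2)[m]; apply/negP; rewrite -leNgt.
  by apply: hH; clear - ij ji; lia.
move=> e eH; have -> : (N %/ q = N %/ (1 * q) * minn 1 1)%N by rewrite mul1n minnn muln1.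
apply: (@edit_count_lower _ _ _ q 1 1 1 H N) => //.
  by move=> i1 j1 i2 j2 r1 _ a1 a2; have := no _ _ a1 a2 r1.
by move=> i' j' ij ji i; exists 0%N => // k _ j jE; apply: no; lia.
Qed.

End Rotation.

(** * Dirichlet approximation and density of orbits *)

Section Diophantine.
Context {R : realType}.
Implicit Types (alpha : R) (p m n : int) (q X : nat).

Lemma irrational_neq alpha p q : irrational alpha -> (0 < q)%N ->
  q%:R * alpha - p%:~R != 0.
Proof.
move=> ia q0; apply/eqP => /subr0_eq E; apply: ia.
exists (p%:~R / q%:R); rewrite // rmorphM /= fmorphV /= ratr_int ratr_nat -E.
by rewrite mulrAC divff ?mul1r// pnatr_eq0 -lt0n.
Qed.

Lemma coprime_reduction p q : (0 < q)%N -> exists p' q' g,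
  [/\ (0 < g)%N, coprimez p' q'%:Z, p = p' * g%:Z & q = (q' * g)%N].
Proof.
move=> q0; pose g := gcdn `|p| q.
have g0 : (0 < g)%N by rewrite gcdn_gt0 q0 orbT.
have /dvdzP[p' pE] : (g%:Z %| p)%Z by rewrite dvdzE /= dvdn_gcdl.
have /dvdnP[q' qE] : (g %| q)%N by rewrite dvdn_gcdr.
exists p', q', g; split=> //; rewrite /coprimez /gcdz /=; apply/eqP; congr Posz.
have : (gcdn `|p'| q' * g = g)%N by rewrite muln_gcdl -qE -[g in (_ * g)%N]/(`|g%:Z|%N) -abszM -pE.
by move/eqP; rewrite -[X in _ == X]mul1n eqn_pmul2r// => /eqP.
Qed.

Lemma dirichlet alpha X : (0 < X)%N -> exists p q,
  [/\ (0 < q <= X)%N, coprimez p q & `|q%:R * alpha - p%:~R| < X%:R^-1].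
Proof.
move=> X0; have X0R : 0 < X%:R :> R by rewrite ltr0n.
have box (i : nat) : (Num.truncn (X%:R * mod1 (i%:R * alpha)) < X)%N.
  have /andP[m0 m1] := mod1_itv (i%:R * alpha).
  rewrite -(ltr_nat R); apply: le_lt_trans (_ : _ <= X%:R * mod1 (i%:R * alpha)) _.
    by rewrite truncn_le mulr_ge0 ?ler0n.
  by rewrite -ltr_pdivlMl// mulVf ?gt_eqF.
pose f (i : 'I_X.+1) := Ordinal (box i).
have /injectivePn[i [j ij fij]] : ~~ injectiveb f.
  by apply/negP => /fintype.injectiveP/leq_card; rewrite !card_ord ltnn.
wlog lt : i j ij fij / (j < i)%N.
  move=> H; case: (ltngtP j i) => [|lt|e]; first exact: H.
    by apply: (H j i); rewrite // eq_sym.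
  by move: ij; rewrite (val_inj e) eqxx.
have [p [q [q0 le]]] : exists p q, (0 < q <= X)%N /\
    `|q%:R * alpha - p%:~R| < X%:R^-1.
  exists (Num.floor (i%:R * alpha) - Num.floor (j%:R * alpha)), (i - j)%N.
  split; first by have := ltn_ord i; lia.
  have := congr1 val fij; rewrite /= => {}fij.
  have /andP[i0 i1] := mod1_itv (i%:R * alpha).
  have /andP[j0 j1] := mod1_itv (j%:R * alpha).
  have := truncn_itv (mulr_ge0 (ltW X0R) i0); rewrite fij.
  have := truncn_itv (mulr_ge0 (ltW X0R) j0).
  have -> : (i - j)%:R * alpha - (Num.floor (i%:R * alpha) - Num.floor (j%:R * alpha))%:~R
     = mod1 (i%:R * alpha) - mod1 (j%:R * alpha).
    by rewrite natrB 1?ltnW// intrB /mod1; ring.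
  rewrite -natr1 => /andP[a1 a2] /andP[a3 a4].
  rewrite -(ltr_pM2l X0R) divff ?gt_eqF// -[X in X * `| _ |]gtr0_norm// -normrM mulrBr.
  by rewrite ltr_norml; apply/andP; split; lra.
have [p' [q' [g [g0 cop pE qE]]]] := coprime_reduction p (proj1 (andP q0)).
have q'0 : (0 < q')%N by move: qE; case: (q') => //; lia.
have g1 : 1 <= g%:R :> R by rewrite ler1n.
exists p', q'; split=> //.
- by rewrite q'0 /=; apply: leq_trans (_ : q <= X)%N; [rewrite qE leq_pmulr|lia].
- apply: le_lt_trans le; rewrite qE pE natrM intrM /=.
  have -> : q'%:R * g%:R * alpha - p'%:~R * g%:~R = (q'%:R * alpha - p'%:~R) * g%:R.
    by ring.
  by rewrite normrM (ger0_norm (ler0n _ _)) ler_peMr.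
Qed.

Lemma rotation_dense alpha d (e : R) : irrational alpha -> 0 < e ->
  exists m n, `|d - (m%:~R * alpha + n%:~R)| < e.
Proof.
move=> ia e0; have e10 : 0 <= e^-1 by rewrite invr_ge0 ltW.
have [p [q [/andP[q0 _] _ lt]]] := @dirichlet alpha (Num.truncn e^-1).+1 isT.
have s0 := irrational_neq p ia q0; set s := _ - _ in s0 lt.
have {}lt : `|s| < e.
  apply: lt_trans lt _; rewrite invf_plt ?posrE ?ltr0n//.
  by have /andP[_] := truncn_itv e10.
exists (Num.floor (d / s) * q%:Z), (- (Num.floor (d / s) * p)).
have -> : d - ((Num.floor (d / s) * q%:Z)%:~R * alpha + (- (Num.floor (d / s) * p))%:~R) =
   mod1 (d / s) * s.
  by rewrite /mod1 mulrBl divfK// /s intrN !intrM /=; ring.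
have /andP[i0 i1] := mod1_itv (d / s).
rewrite normrM (ger0_norm i0); apply: le_lt_trans lt.
by rewrite ler_piMl// ltW.
Qed.

Lemma rotation_invariant alpha (P : R -> Prop) :
  (forall z, P (z + 1) <-> P z) -> (forall z, P (z + alpha) <-> P z) ->
  forall m n z, P (z + (m%:~R * alpha + n%:~R)) <-> P z.
Proof.
move=> P1 Pa.
have shift (c : R) : (forall z, P (z + c) <-> P z) -> forall m z, P (z + m%:~R * c) <-> P z.
  move=> Pc; have H (k : nat) z : P (z + k%:R * c) <-> P z.
    elim: k z => [|k ih] z; first by rewrite mul0r addr0.
    by rewrite -natr1 mulrDl mul1r addrA; rewrite Pc.
  case=> k z; first exact: H.
  rewrite -(H k.+1) NegzE intrN mulNr subrK//.
by move=> m n z; rewrite addrA -[n%:~R]mulr1 (shift 1)// shift.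
Qed.

End Diophantine.

(** * Ergodicity and exponents *)

Section Ergodicity.
Context {R : realType}.
Local Notation mu := (@lebesgue_measure R).
Implicit Types (A E : set R) (alpha : R).

Lemma lebesgue_measureD (t : R) A : measurable A ->
  mu ((fun z => z + t) @^-1` A) = mu A.
Proof.
move=> mA.
pose phi := (fun z : R => z + t) : measurableTypeR R -> measurableTypeR R.
have mphi : measurable_fun setT phi by apply: measurable_funD => //; exact: measurable_cst.
apply/esym.
have := @lebesgue_measure_unique R (pushforward mu phi) _ A mA.
apply => _ [[a b]] _ <-.
rewrite /pushforward.
rewrite [X in mu X = mu _](_ : _ = [set` `]a, b]])// [X in _ = mu X](_ : _ = [set` `]a - t, b - t]]); last first.
  by apply/seteqP; split=> z /=; rewrite !in_itv/= ltrBlDr lerBrDr.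
rewrite !lebesgue_measure_itv/= !lte_fin ltrD2r.
by case: ifP => // _; rewrite -!EFinB; congr _%:E; ring.
Qed.

(** Otherwise [E] has a density point [x], and its complement a density point [y]. A translation
    from [D] close to [y - x] carries the part of [E] in the ball of radius [r] at [x] into the ball
    of radius [2 * r] at [y]. The former has measure above [5 * r / 3], while [E] has measure below
    [2 * r / 3] in the latter. *)
Lemma zero_one_dense E (D : set R) : measurable E ->
  (forall d e : R, 0 < e -> exists2 t, D t & `|d - t| < e) ->
  (forall t, D t -> forall z, E (z + t) <-> E z) ->
  {ae mu, forall z, E z} \/ {ae mu, forall z, ~ E z}.
Proof.
move=> mE dense inv; apply: contrapT => /not_orP[nE ncE].
have F := ae_filter_ringOfSetsType mu.
have dens := lebesgue_density mE.
have {ncE} [x Ex dx] : exists2 x, E x &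
    (mu (E `&` ball x r) * (mu (ball x r))^-1 @[r --> 0^'+] --> (\1_E x)%:E)%E.
  apply: contrapT => no; apply: ncE; apply: filterS dens => x dx Ex.
  by apply: no; exists x.
have {nE} [y Ey dy] : exists2 y, ~ E y &
    (mu (E `&` ball y r) * (mu (ball y r))^-1 @[r --> 0^'+] --> (\1_E y)%:E)%E.
  apply: contrapT => no; apply: nE; apply: filterS dens => y dy.
  by apply: contrapT => Ey; apply: no; exists y.
rewrite indicE mem_set//= in dx; rewrite indicE memNset//= in dy.
have mEb (u s : R) : measurable (E `&` ball u s).
  by apply: measurableI => //; exact: measurable_ball.
have fin (u s : R) : 0 < s -> mu (E `&` ball u s) \is a fin_num.
  move=> s0; rewrite ge0_fin_numE//; apply: (@le_lt_trans _ _ (mu (ball u s))).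
    apply: le_measure; rewrite ?inE; [exact: mEb|exact: measurable_ball|exact: subIsetr].
  by rewrite lebesgue_measure_ball ?ltW// ltry.
have near_ball (u l : R) : (mu (E `&` ball u r) * (mu (ball u r))^-1 @[r --> 0^'+] --> l%:E)%E ->
    exists2 d : R, 0 < d & forall r, 0 < r < d ->
      `|l * (r *+ 2) - fine (mu (E `&` ball u r))| < r / 3.
  move=> /fine_cvgP[_] /cvgrPdist_lt/(_ (1 / 6)) []; first by lra.
  move=> d /= d0 dP; exists d => // r /andP[r0 rd].
  have := dP r; rewrite /= sub0r normrN gtr0_norm// => /(_ rd r0).
  rewrite lebesgue_measure_ball ?ltW// inver mulrn_eq0/= gt_eqF//.
  have r2 : 0 < r *+ 2 by rewrite mulrn_wgt0.
  rewrite -{1}(fineK (fin u r r0)) -EFinM /= -(ltr_pM2r r2).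
  rewrite -{2}(gtr0_norm r2) -normrM mulrBl divfK ?gt_eqF//.
  by move/lt_le_trans; apply; rewrite mulr2n; lra.
have [d1 d10 P1] := near_ball _ _ dx; have [d2 d20 P2] := near_ball _ _ dy.
pose r := Num.min d1 d2 / 3.
have r0 : 0 < r by rewrite divr_gt0// lt_min d10.
have [m1 m2] : Num.min d1 d2 <= d1 /\ Num.min d1 d2 <= d2.
  by rewrite !ge_min !lexx orbT.
have rd1 : r < d1 by rewrite /r; lra.
have rd2 : 2 * r < d2 by rewrite /r; lra.
have {}P1 : `|1 * (r *+ 2) - fine (mu (E `&` ball x r))| < r / 3 by apply: P1; lra.
have {}P2 : `|0 * (2 * r *+ 2) - fine (mu (E `&` ball y (2 * r)))| < 2 * r / 3.
  by apply: P2; lra.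
have [t Dt yxt] := dense (y - x) r r0.
have eqm : mu (E `&` ball x r) = mu (E `&` ball (x + t) r).
  rewrite -[RHS](lebesgue_measureD t (mEb _ _)); congr (mu _).
  apply/seteqP; split=> z /=; rewrite /ball/= (_ : x + t - (z + t) = x - z)//; try by ring.
    by case=> Ez; split=> //; exact/(inv t Dt).
  by case=> /(inv t Dt).
have : (mu (E `&` ball x r) <= mu (E `&` ball y (2 * r)))%E.
  rewrite eqm; apply: le_measure; rewrite ?inE; [exact: mEb|exact: mEb|].
  move=> z [Ez]; rewrite /ball/= => zr; split=> //=.
  have -> : y - z = (y - x - t) + (x + t - z) by ring.
  by apply: le_lt_trans (ler_normD _ _) _; lra.
rewrite -(fineK (fin x r r0)) -(fineK (fin y (2 * r) _)); last by lra.
rewrite lee_fin; move: P1 P2; rewrite mul1r mul0r sub0r normrN !mulr2n.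
rewrite !ltr_norml => /andP[a1 a2] /andP[a3 a4]; lra.
Qed.

Lemma rotation_zero_one alpha E : irrational alpha -> measurable E ->
  (forall z, E (z + 1) <-> E z) -> (forall z, E (z + alpha) <-> E z) ->
  {ae mu, forall z, E z} \/ {ae mu, forall z, ~ E z}.
Proof.
move=> ia mE E1 Ea.
apply: (@zero_one_dense E [set t | exists m n, t = m%:~R * alpha + n%:~R]) => //.
- move=> d e e0; have [m [n mn]] := rotation_dense d ia e0.
  by exists (m%:~R * alpha + n%:~R) => //; exists m, n.
- by move=> _ [m [n ->]] z; exact: (rotation_invariant E1 Ea).
Qed.

Local Notation mu2 := (mu \x mu)%E.

Lemma ae_product (P : R * R -> Prop) : measurable [set p | P p] ->
  {ae mu, forall x, {ae mu, forall y, P (x, y)}} -> {ae mu2, forall p, P p}.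
Proof.
have F := ae_filter_ringOfSetsType mu.
move=> mP aeP; exists (~` [set p | P p]); split=> //; first exact: measurableC.
have mf := measurable_fun_xsection mu (measurableC mP).
rewrite /= /product_measure1 -(_ : (\int[mu]_x `|(mu \o xsection (~` [set p | P p])) x|)%E =
    (\int[mu]_x ((mu \o xsection (~` [set p | P p])) x))%E); last first.
  by apply: eq_integral => x _; rewrite gee0_abs.
apply: (ae_eq_integral_abs mu measurableT mf).2.
apply: filterS aeP => x aePx _ /=.
apply/negligibleP; first exact: measurable_xsection (measurableC mP).
by apply: negligibleS aePx => y; rewrite /xsection /= inE.
Qed.

(** Invariance in each coordinate separately is essential: the diagonal rotation preserves [y - x]
    and is not ergodic. The one-dimensional law is applied first to the set [G] of those [x] whose
    section has full measure and then, if [G] is null, to the sections themselves. *)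
Lemma torus_zero_one alpha (E : set (R * R)) : irrational alpha -> measurable E ->
  (forall t, t = 1 \/ t = alpha -> forall x y, E (x + t, y) <-> E (x, y)) ->
  (forall t, t = 1 \/ t = alpha -> forall x y, E (x, y + t) <-> E (x, y)) ->
  {ae mu2, forall p, E p} \/ {ae mu2, forall p, ~ E p}.
Proof.
have F := ae_filter_ringOfSetsType mu.
move=> ia mE Ex Ey.
have mf := measurable_fun_xsection mu (measurableC mE).
pose G := (mu \o xsection (~` E)) @^-1` [set 0%E].
have GP x : G x <-> {ae mu, forall y, E (x, y)}.
  rewrite /G /=; have mX := measurable_xsection x (measurableC mE).
  split=> [/(negligibleP mu mX)|aeE]; last apply/(negligibleP mu mX).
    by apply: negligibleS => y /=; rewrite /xsection /= inE.
  by apply: negligibleS aeE => y; rewrite /xsection /= inE.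
have mG : measurable G by rewrite -[G]setTI; exact: mf.
have Ginv t : t = 1 \/ t = alpha -> forall x, G (x + t) <-> G x.
  by move=> tP x; rewrite !GP; split; apply: filterS => y /(Ex t tP).
have [aeG|aeG] := rotation_zero_one ia mG (Ginv 1 (or_introl erefl)) (Ginv alpha (or_intror erefl)).
  by left; apply: ae_product => //; apply: filterS aeG => x /GP.
right; apply: ae_product; first exact: measurableC.
apply: filterS aeG => x nG.
have mEx : measurable [set y | E (x, y)].
  have := measurable_xsection x mE; congr measurable.
  by apply/seteqP; split=> y; rewrite /xsection /= inE.
have [aeE|//] := rotation_zero_one ia mEx
  (Ey 1 (or_introl erefl) x) (Ey alpha (or_intror erefl) x).
by case: nG; apply/GP.
Qed.

(** The constant is the cut in the rationals given by the zero-one law for the sublevel sets; only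
    countably many thresholds are used, so the exceptional set remains null. *)
Lemma ae_constant alpha (g : R -> R -> \bar R) : irrational alpha ->
  measurable_fun setT (fun p : R * R => g p.1 p.2) ->
  (forall t, t = 1 \/ t = alpha -> forall x y, g (x + t) y = g x y) ->
  (forall t, t = 1 \/ t = alpha -> forall x y, g x (y + t) = g x y) ->
  exists c, {ae mu2, forall p, g p.1 p.2 = c}.
Proof.
move=> ia mg gx gy.
have zo (r : R) : {ae mu2, forall p, (g p.1 p.2 <= r%:E)%E} \/
    {ae mu2, forall p, ~ (g p.1 p.2 <= r%:E)%E}.
  apply: (@torus_zero_one _ [set p | (g p.1 p.2 <= r%:E)%E] ia).
  - by rewrite -[X in measurable X]setTI; exact: emeasurable_fun_infty_c.
  - by move=> t tP x y /=; rewrite gx.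
  - by move=> t tP x y /=; rewrite gy.
pose c := ereal_inf [set (ratr q : R)%:E | q in [set q : rat |
  {ae mu2, forall p, (g p.1 p.2 <= (ratr q : R)%:E)%E}]].
exists c.
have F := ae_filter_ringOfSetsType mu2.
have A (q : rat) : {ae mu2, forall p, (g p.1 p.2 < (ratr q : R)%:E)%E -> (c <= (ratr q : R)%:E)%E}.
  have [aeq|aeq] := zo (ratr q).
    apply: aeW => p _; apply: ereal_inf_lbound; by exists q.
  by apply: filterS aeq => p np /ltW.
have B (q : rat) : {ae mu2, forall p, (c < (ratr q : R)%:E)%E -> (g p.1 p.2 <= (ratr q : R)%:E)%E}.
  have [cq|cq] := ltP c (ratr q : R)%:E; last by apply: aeW.
  have [_ [q' aeq' <-] qq'] := ereal_inf_lt cq.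
  by apply: filterS aeq' => p gq' _; apply: le_trans gq' (ltW qq').
have AB : {ae mu2, forall p, forall q : rat,
   ((g p.1 p.2 < (ratr q : R)%:E)%E -> (c <= (ratr q : R)%:E)%E) /\
   ((c < (ratr q : R)%:E)%E -> (g p.1 p.2 <= (ratr q : R)%:E)%E)}.
  have H : {ae mu2, forall p, forall n : nat,
     if unpickle n is Some q then
     ((g p.1 p.2 < (ratr q : R)%:E)%E -> (c <= (ratr q : R)%:E)%E) /\
     ((c < (ratr q : R)%:E)%E -> (g p.1 p.2 <= (ratr q : R)%:E)%E) else True}.
    apply: ae_foralln => n; case: (unpickle n) => [q|]; last exact: aeW.
    exact: filterS2 (A q) (B q).
  by apply: filterS H => p H q; have := H (pickle q); rewrite pickleK.
apply: filterS AB => p ABp.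
have between (a b : \bar R) : (a < b)%E -> exists2 q : rat, (a < (ratr q : R)%:E)%E & ((ratr q : R)%:E < b)%E.
  have rb (u v : R) : u < v -> exists2 q : rat, u < ratr q & ratr q < v.
    by move=> /rat_in_itvoo[q]; rewrite in_itv/= => /andP[]; exists q.
  move: a b => [a| |] [b| |]//.
  - by rewrite lte_fin => /rb[q]; exists q; rewrite lte_fin.
  - by have [q aq _] := rb a (a + 1) ltac:(lra); exists q; rewrite ?lte_fin// ltry.
  - by have [q _ qb] := rb (b - 1) b ltac:(lra); exists q; rewrite ?lte_fin// ltNyr.
  - by exists 0; rewrite ?ltNyr ?ltry.
apply/eqP; rewrite eq_le; apply/andP; split; rewrite leNgt; apply/negP.
  move=> /between[q cq]; rewrite ltNge => /negP; apply.
  by have [_] := ABp q; apply.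
move=> /between[q gq]; rewrite ltNge => /negP; apply.
by have [+ _] := ABp q; apply.
Qed.

End Ergodicity.

(** * Limits of logarithmic ratios *)

Section LimitSuperior.
Context {R : realType}.
Implicit Types (u : nat -> \bar R) (l : \bar R).
Local Open Scope ereal_scope.

Lemma limn_esupE u : limn_esup u = ereal_inf (range (esups u)).
Proof. by rewrite limn_esup_lim; apply/cvg_lim => //; exact: cvg_esups_inf. Qed.

Lemma limn_esup_ge_often u l :
  (forall N, exists2 n, (N <= n)%N & l <= u n) -> l <= limn_esup u.
Proof.
move=> lu; rewrite limn_esupE; apply: le_ereal_inf_tmp => _ [N _ <-].
have [n Nn ln] := lu N; apply: le_trans ln _.
by apply: ereal_sup_ubound; exists n.
Qed.

Lemma limn_esup_le_near u l :
  (exists N, forall n, (N <= n)%N -> u n <= l) -> limn_esup u <= l.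
Proof.
move=> [N ul]; rewrite limn_esupE; apply: (@le_trans _ _ (esups u N)).
  by apply: ereal_inf_lbound; exists N.
by apply: ge_ereal_sup => _ [n Nn <-]; exact: ul.
Qed.

Lemma limn_einf_ge_near u l :
  (exists N, forall n, (N <= n)%N -> l <= u n) -> l <= limn_einf u.
Proof.
move=> [N lu]; rewrite /limn_einf leeNr; apply: limn_esup_le_near.
by exists N => n Nn; rewrite leeN2 lu.
Qed.

Lemma limn_einf_le_often u l :
  (forall N, exists2 n, (N <= n)%N & u n <= l) -> limn_einf u <= l.
Proof.
move=> ul; rewrite /limn_einf leeNl; apply: limn_esup_ge_often => N.
by have [n Nn un] := ul N; exists n; rewrite // leeN2.
Qed.

Lemma limn_esup_le u v :
  (forall e : R, (0 < e)%R -> exists N, forall n, (N <= n)%N -> u n <= v n + e%:E) ->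
  limn_esup u <= limn_esup v.
Proof.
move=> uv; apply/lee_addgt0Pr => e e0; have [N uve] := uv e e0.
rewrite -leeBlDr// [leRHS]limn_esupE; apply: le_ereal_inf_tmp => _ [n _ <-].
rewrite leeBlDr//; apply: limn_esup_le_near; exists (maxn n N) => k.
rewrite geq_max => /andP[nk Nk]; apply: le_trans (uve k Nk) _.
by rewrite leeD2r//; apply: ereal_sup_ubound; exists k.
Qed.

Lemma limn_einf_le u v :
  (forall e : R, (0 < e)%R -> exists N, forall n, (N <= n)%N -> u n <= v n + e%:E) ->
  limn_einf u <= limn_einf v.
Proof.
move=> uv; rewrite leeN2; apply: limn_esup_le => e /uv[N uve]; exists N => n /uve.
by move=> h; rewrite -leeBlDr// -fin_num_oppeD// leeN2.
Qed.

Lemma limn_close u v :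
  (forall e : R, (0 < e)%R -> exists N, forall n, (N <= n)%N ->
     u n <= v n + e%:E /\ v n <= u n + e%:E) ->
  limn_esup u = limn_esup v /\ limn_einf u = limn_einf v.
Proof.
move=> uv; split; apply/eqP; rewrite eq_le; apply/andP; split;
  [apply: limn_esup_le|apply: limn_esup_le|apply: limn_einf_le|apply: limn_einf_le];
  by move=> e /uv[N uve]; exists N => n /uve[].
Qed.

End LimitSuperior.

Section LogRatio.
Context {R : realType}.
Implicit Types (d : nat -> R).

Lemma ln_nat_large (c e : R) : 0 < e -> exists2 N, (1 < N)%N &
  forall n, (N <= n)%N -> c / ln n%:R <= e.
Proof.
move=> e0; pose N := maxn 2 (Num.truncn (expR (c / e))).+1.
exists N => [|n Nn]; first by rewrite leq_max.
have n1 : 1 < n%:R :> R by rewrite ltr1n; apply: leq_trans Nn; rewrite leq_max.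
have ln0 : 0 < ln n%:R :> R by rewrite ln_gt0.
rewrite ler_pdivrMr// -ler_pdivrMl// mulrC -[leLHS]expRK ler_ln ?posrE ?expR_gt0//; last first.
  by rewrite (lt_trans _ n1).
apply: ltW; apply: lt_le_trans (truncnS_gt _) _; rewrite ler_nat.
by apply: leq_trans Nn; rewrite leq_max leqnn orbT.
Qed.

(** A real-valued substitute for [log_ratio]: at distance 0 it is finite, and changing the distance
    by 1 changes the numerator by at most [ln 2]. Its limits are therefore measurable and rotation
    invariant, and they agree with those of [log_ratio] once the distance is at least [1 / 2]. *)
Definition log1_ratio d (N : nat) : R := ln (1 + d N) / ln N%:R.

Lemma log1_ratio_close d d' : (forall N, 0 <= d N) -> (forall N, 0 <= d' N) ->
  (forall N, `|d N - d' N| <= 1) ->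
  limn_esup (EFin \o log1_ratio d) = limn_esup (EFin \o log1_ratio d') /\
  limn_einf (EFin \o log1_ratio d) = limn_einf (EFin \o log1_ratio d').
Proof.
move=> d0 d'0 dd'; apply: limn_close => e e0.
have [N N1 Ne] := ln_nat_large (ln 2) e0; exists N => n Nn.
have ln0 : 0 < ln n%:R :> R by rewrite ln_gt0// ltr1n; apply: leq_trans Nn.
have H (a b : R) : 0 <= a -> 0 <= b -> `|a - b| <= 1 ->
    (ln (1 + a) / ln n%:R <= ln (1 + b) / ln n%:R + e).
  move=> a0 b0; rewrite ler_norml => /andP[_ ab].
  apply: (@le_trans _ _ (ln (1 + b) / ln n%:R + ln 2 / ln n%:R)); last by rewrite lerD2l Ne.
  by rewrite -mulrDl ler_pM2r ?invr_gt0// -lnM ?posrE ?ler_ln ?posrE; lra.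
by rewrite /= -!EFinD !lee_fin; split; apply: H => //; rewrite distrC.
Qed.

Lemma log_ratioE d N : (1 < N)%N -> 0 < d N ->
  log_ratio d N = (ln (d N) / ln N%:R)%:E.
Proof.
move=> N1 d0; rewrite /log_ratio lne_EFin// inver gt_eqF//.
by rewrite ln_gt0 ?ltr1n.
Qed.

Lemma log_ratio_shift d : (exists N, forall n, (N <= n)%N -> 1 / 2 <= d n) ->
  limn_esup (log_ratio d) = limn_esup (EFin \o log1_ratio d) /\
  limn_einf (log_ratio d) = limn_einf (EFin \o log1_ratio d).
Proof.
move=> [N0 d12]; apply: limn_close => e e0.
have [N N1 Ne] := ln_nat_large (ln 3) e0; exists (maxn N0 N) => n.
rewrite geq_max => /andP[/d12 dn Nn]; have n1 := leq_trans N1 Nn.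
have ln0 : 0 < ln n%:R :> R by rewrite ln_gt0// ltr1n.
rewrite log_ratioE//=; last by lra.
rewrite -!EFinD !lee_fin /log1_ratio; split.
  apply: (@le_trans _ _ (ln (1 + d n) / ln n%:R)); last by rewrite lerDl ltW.
  by rewrite ler_pM2r ?invr_gt0// ler_ln ?posrE; lra.
apply: (@le_trans _ _ (ln (d n) / ln n%:R + ln 3 / ln n%:R)); last by rewrite lerD2l Ne.
by rewrite -mulrDl ler_pM2r ?invr_gt0// -lnM ?posrE ?ler_ln ?posrE; lra.
Qed.

Lemma log_ratio_ge d N (g : R) : (1 < N)%N -> N%:R `^ g <= d N ->
  (g%:E <= log_ratio d N)%E.
Proof.
move=> N1 dN; have N0 : 0 < N%:R :> R by rewrite ltr0n (ltn_trans _ N1).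
have p0 : 0 < N%:R `^ g by rewrite powR_gt0.
have ln0 : 0 < ln N%:R :> R by rewrite ln_gt0// ltr1n.
rewrite log_ratioE ?(lt_le_trans p0)// lee_fin ler_pdivlMr// -ln_powR.
by rewrite ler_ln ?posrE// (lt_le_trans p0).
Qed.

Lemma log_ratio_le d N (g : R) : (1 < N)%N -> d N <= N%:R `^ g ->
  (log_ratio d N <= g%:E)%E.
Proof.
move=> N1 dN; have N0 : 0 < N%:R :> R by rewrite ltr0n (ltn_trans _ N1).
have ln0 : 0 < ln N%:R :> R by rewrite ln_gt0// ltr1n.
have [d0|d0] := ltP 0 (d N).
  rewrite log_ratioE// lee_fin ler_pdivrMr// -ln_powR.
  by rewrite ler_ln ?posrE// powR_gt0.
rewrite /log_ratio /lne d0 inver gt_eqF//.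
by rewrite gt0_mulNye ?leNye// lte_fin invr_gt0.
Qed.

End LogRatio.

(** * Measurability and almost sure constancy of the exponents *)

Section Measurability.
Context {R : realType}.
Local Notation mu := (@lebesgue_measure R).
Local Notation mu2 := (mu \x mu)%E.
Implicit Types (alpha beta x y : R).

Lemma measurable_in_arc alpha beta n :
  measurable [set x : R | in_arc beta (x + n%:R * alpha)].
Proof.
(* Fractional parts stay below 1, so for arbitrary [beta] the arc ends at the minimum of [beta] and
   1. *)
have -> : [set x : R | in_arc beta (x + n%:R * alpha)] =
    \bigcup_(m : int) [set` `[m%:~R - n%:R * alpha,
      Num.min beta 1 + m%:~R - n%:R * alpha[ ].
  apply/seteqP; split=> x /=.
    rewrite /in_arc in_itv/= /mod1 => /andP[_ xb].
    exists (Num.floor (x + n%:R * alpha)) => //=; rewrite in_itv/=.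
    have := floor_itv (x + n%:R * alpha); rewrite intrD mulr1z.
    by case: (leP beta 1); lra.
  move=> [m _] /=; rewrite in_itv/= => xm.
  have [mb m1] : Num.min beta 1 <= beta /\ Num.min beta 1 <= 1 by rewrite !ge_min !lexx orbT.
  have -> : x + n%:R * alpha = (x + n%:R * alpha - m%:~R) + m%:~R by ring.
  by rewrite in_arcDZ /in_arc mod1_id ?in_itv/=; lra.
by apply: countable_bigcupT_measurable => // m; exact: measurable_itv.
Qed.

Lemma measurable_xi_word alpha beta N (s : seq bool) :
  measurable [set x : R | xi_word alpha beta N x = s].
Proof.
rewrite /xi_word; elim: (iota 0 N) s => [|n l ih] [|b s] /=.
- by rewrite (_ : [set _ | _] = setT)//; apply/seteqP; split.
- by rewrite (_ : [set _ | _] = set0)//; apply/seteqP; split.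
- by rewrite (_ : [set _ | _] = set0)//; apply/seteqP; split.
have mA := measurable_in_arc alpha beta n.
rewrite (_ : [set _ | _] = (if b then [set x : R | in_arc beta (x + n%:R * alpha)]
    else ~` [set x : R | in_arc beta (x + n%:R * alpha)]) `&`
    [set x : R | [seq xi alpha beta i%:Z x | i : nat <- l] = s]).
  by apply: measurableI => //; case: b => //; exact: measurableC.
apply/seteqP; split=> x /=.
  by move=> [<- <-]; split=> //; case: ifPn => // /negP.
by case: b => /= -[+ <-] => [|/negP/negbTE] h; congr (_ :: _).
Qed.

Lemma measurable_word_distance alpha beta N :
  measurable_fun setT (fun p : R * R => word_distance alpha beta N p.1 p.2).
Proof.
move=> _ B _; rewrite setTI.
rewrite (_ : _ @^-1` B = \bigcup_(st : seq bool * seq bool)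
  (if asbool (B (edit_distance R st.1 st.2)) then
    [set x | xi_word alpha beta N x = st.1] `*` [set y | xi_word alpha beta N y = st.2]
   else set0)).
  apply: countable_bigcupT_measurable => // -[s t] /=.
  by case: ifP => // _; apply: measurableX; exact: measurable_xi_word.
apply/seteqP; split=> [p Bp|p [st _]] /=.
  by exists (xi_word alpha beta N p.1, xi_word alpha beta N p.2) => //=; rewrite asboolT.
by case: asboolP => // Bst [/= E1 E2]; rewrite /word_distance E1 E2.
Qed.

Lemma word_distance_ge0 alpha beta N x y : 0 <= word_distance alpha beta N x y.
Proof. by rewrite /word_distance /edit_distance divr_ge0. Qed.

Lemma word_distanceC alpha beta N x y :
  word_distance alpha beta N x y = word_distance alpha beta N y x.
Proof. by rewrite /word_distance /edit_distance edit_countC. Qed.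

(** Adding 1 leaves the word unchanged, and adding [alpha] moves it by one letter: one deletion and
    one insertion, that is, distance 1. One point is moved while the other stays, as
    [torus_zero_one] requires. *)
Lemma word_distance_shift alpha beta N x y t : t = 1 \/ t = alpha ->
  `|word_distance alpha beta N (x + t) y - word_distance alpha beta N x y| <= 1.
Proof.
have H (u v w : seq bool) : (edit_count u v <= 2)%N ->
    edit_distance R u w <= edit_distance R v w + 1.
  move=> uv; rewrite /edit_distance -(ler_pM2r (_ : 0 < 2 :> R))// mulrDl !divfK// mul1r.
  rewrite -natrD ler_nat; have := edit_count_triangle u v w; lia.
suff d2 : t = 1 \/ t = alpha ->
    (edit_count (xi_word alpha beta N (x + t)) (xi_word alpha beta N x) <= 2)%N.
  move=> /d2 {}d2; have := H _ _ (xi_word alpha beta N y) d2.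
  rewrite edit_countC in d2; have := H _ _ (xi_word alpha beta N y) d2.
  by rewrite /word_distance ler_norml; lra.
case=> ->; rewrite !xi_word_subword.
  rewrite (@eq_subword _ _ (fun n => in_arc beta (x + n%:R * alpha)) 0 0 N) ?edit_count_refl//.
  by move=> n _ /=; rewrite -(in_arcDZ _ (x + _) 1) addrAC.
rewrite (@eq_subword _ _ (fun n => in_arc beta (x + n%:R * alpha)) 0 1 N).
  by rewrite edit_countC edit_count_shift.
by move=> n _; rewrite add0n natrD; congr in_arc; rewrite mulrDl mul1r addrA.
Qed.

Lemma log1_ratio_ae_constant alpha beta : irrational alpha -> exists cs ci : \bar R,
  {ae mu2, forall p,
    limn_esup (EFin \o log1_ratio (fun N => word_distance alpha beta N p.1 p.2)) = cs /\
    limn_einf (EFin \o log1_ratio (fun N => word_distance alpha beta N p.1 p.2)) = ci}.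
Proof.
move=> ia; have F := ae_filter_ringOfSetsType mu2.
have ml N : measurable_fun setT (fun p : R * R =>
    (log1_ratio (fun N => word_distance alpha beta N p.1 p.2) N)%:E).
  apply/measurable_EFinP; apply: measurable_funM => //.
  apply: measurableT_comp; first exact: measurable_ln.
  by apply: measurable_funD => //; exact: measurable_word_distance.
have inv t x y : t = 1 \/ t = alpha ->
    (limn_esup (EFin \o log1_ratio (fun N => word_distance alpha beta N (x + t) y)) =
    limn_esup (EFin \o log1_ratio (fun N => word_distance alpha beta N x y)) /\
    limn_einf (EFin \o log1_ratio (fun N => word_distance alpha beta N (x + t) y)) =
    limn_einf (EFin \o log1_ratio (fun N => word_distance alpha beta N x y))).
  move=> tP; apply: log1_ratio_close => N; rewrite ?word_distance_ge0//.
  exact: word_distance_shift.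
have sym x y : (fun N => word_distance alpha beta N x y) =
    (fun N => word_distance alpha beta N y x).
  by apply/funext => N; rewrite word_distanceC.
pose gs x y := limn_esup (EFin \o log1_ratio (fun N => word_distance alpha beta N x y)).
pose gi x y := limn_einf (EFin \o log1_ratio (fun N => word_distance alpha beta N x y)).
have ms : measurable_fun setT (fun p : R * R => gs p.1 p.2).
  exact: (measurable_fun_limn_esup ml).
have mi : measurable_fun setT (fun p : R * R => gi p.1 p.2).
  have mlN N := measurableT_comp (@oppe_measurable R setT) (ml N).
  exact: (measurableT_comp (@oppe_measurable R setT) (measurable_fun_limn_esup mlN)).
have [cs csP] : exists c, {ae mu2, forall p, gs p.1 p.2 = c}.
  apply: (ae_constant ia ms) => t tP x y; first by have [? _] := inv t x y tP.
  by rewrite /gs sym [in RHS]sym; have [? _] := inv t y x tP.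
have [ci ciP] : exists c, {ae mu2, forall p, gi p.1 p.2 = c}.
  apply: (ae_constant ia mi) => t tP x y; first by have [_ ?] := inv t x y tP.
  by rewrite /gi sym [in RHS]sym; have [_ ?] := inv t y x tP.
exists cs, ci; exact: filterS2 csP ciP.
Qed.

End Measurability.

(** * Avoiding small balls almost surely *)

Section BorelCantelli.
Context {R : realType}.
Local Notation mu := (@lebesgue_measure R).
Local Notation mu2 := (mu \x mu)%E.

Lemma ae_avoid_balls (c : nat -> seq R) (w : nat -> R) (C : R) :
  (forall j, 0 <= w j) -> 0 <= C ->
  (forall j, (size (c j))%:R * w j <= C / (2 ^ j.+1)%:R) ->
  {ae mu, forall z, exists J, forall j, (J <= j)%N ->
    forall a, a \in c j -> w j <= `|z - a|}.
Proof.
move=> w0 C0 sw.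
pose F j := \big[setU/set0]_(a <- c j) (ball a (w j) : set R).
have mF j : measurable (F j).
  by apply: bigsetU_measurable => a _; exact: measurable_ball.
have muF j : (mu (F j) <= (2 * C / (2 ^ j.+1)%:R)%:E)%E.
  apply: (@le_trans _ _ (((size (c j))%:R * (2 * w j))%:E)); last first.
    by rewrite lee_fin mulrCA -mulrA ler_pM2l.
  rewrite /F; elim: (c j) => [|a l ih]; first by rewrite big_nil measure0 mul0r.
  rewrite big_cons; apply: le_trans (measureU2 mu _ _) _.
  - exact: measurable_ball.
  - by apply: bigsetU_measurable => b _; exact: measurable_ball.
  rewrite /= -natr1 mulrDl mul1r addrC EFinD leeD//.
  by rewrite lebesgue_measure_ball// mulr2n lee_fin; lra.
have := @lim_sup_set_cvg0 _ _ _ mu F mF _.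
have -> : (\sum_(0 <= n <oo) mu (F n) < +oo)%E.
  apply: (@le_lt_trans _ _ (2 * C)%:E); last by rewrite ltry.
  apply: le_trans (epsilon_trick0 xpredT (_ : 0 <= 2 * C)); last by lra.
  by apply: lee_nneseries => n *; [exact: measure_ge0|exact: muF].
move=> /(_ isT) F0; exists (lim_sup_set F); split=> //.
  by apply: bigcap_measurable => // j _; apply: bigcup_measurable => k _; exact: mF.
move=> z /= nz; apply: contrapT => nF; apply: nz.
have [J nJ] : exists J, ~ (\bigcup_(j in [set j | (J <= j)%N]) F j) z.
  by apply: contrapT => H; apply: nF => J _; apply: contrapT => nH; apply: H; exists J.
exists J => j Jj a aj; rewrite leNgt; apply/negP => lt; apply: nJ.
exists j => //; rewrite /F -bigcup_seq; exists a => //.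
by rewrite /ball/= distrC.
Qed.

(** For each fixed [x] the exceptional [y] form a translate of a null set, and Tonelli's theorem
    applies. *)
Lemma ae_difference (P : R -> Prop) :
  {ae mu, forall z, P z} -> {ae mu2, forall p, P (p.2 - p.1)}.
Proof.
move=> [N [mN N0 PN]].
suff : {ae mu2, forall p : R * R, ~ N (p.2 - p.1)}.
  have F := ae_filter_ringOfSetsType mu2.
  by apply: filterS => p nN; apply: contrapT => nP; apply: nN; exact: PN.
apply: ae_product.
  rewrite (_ : [set p | _] = ~` ((fun p : R * R => p.2 - p.1) @^-1` N))//.
  apply: measurableC; rewrite -[X in measurable X]setTI.
  have : measurable_fun setT (fun p : R * R => p.2 - p.1) by apply: measurable_funB.
  by apply.
apply: aeW => x; exists ((fun y => y + - x) @^-1` N); split=> /=.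
- rewrite -[X in measurable X]setTI.
  have : measurable_fun setT (fun y : R => y + - x) by apply: measurable_funD.
  by apply.
- by rewrite lebesgue_measureD.
- by move=> y /= /contrapT.
Qed.

End BorelCantelli.

(** * Lower bounds for typical points *)

Section IrrationalityExponent.
Context {R : realType}.
Implicit Types (alpha mu c : R) (p m : int) (q j K : nat).

Lemma irrational_away alpha K : irrational alpha ->
  exists2 c, 0 < c & forall j m, (0 < j < K)%N -> c <= `|j%:R * alpha - m%:~R|.
Proof.
move=> ia; elim: K => [|K [c c0 cP]]; first by exists 1 => // j m; lia.
have [K0|K0] := posnP K; first by exists c => // j m; lia.
pose f := Num.floor (K%:R * alpha).
exists (Num.min c (Num.min (mod1 (K%:R * alpha)) (1 - mod1 (K%:R * alpha)))).
  have /andP[m0 m1] := mod1_itv (K%:R * alpha).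
  rewrite !lt_min c0 /=; apply/andP; split; last by lra.
  by rewrite lt_neqAle m0 andbT eq_sym; exact: irrational_neq.
move=> j m /andP[j0]; rewrite ltnS leq_eqVlt => /orP[/eqP ->|jK]; last first.
  by rewrite ge_min cP// j0.
rewrite !ge_min; apply/orP; right.
have [mf|fm] := leP m f.
  apply/orP; left; rewrite ger0_norm; last first.
    by rewrite subr_ge0; apply: le_trans (ge_floor _); rewrite ler_int.
  by rewrite /mod1 lerB// ler_int.
have fm1 : f%:~R + 1 <= m%:~R :> R by rewrite -[X in _ + X]/(1%:~R) -intrD ler_int; lia.
have := floor_itv (K%:R * alpha); rewrite -/f intrD mulr1z => /andP[_ f1].
apply/orP; right; rewrite distrC ger0_norm; last by rewrite subr_ge0; lra.
by rewrite /mod1 -/f; lra.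
Qed.

Lemma approximations_bounded alpha mu K :
  (forall p q, approximations alpha mu (p, q) -> (q < K)%N) ->
  finite_set (approximations alpha mu).
Proof.
move=> qK; pose P q := (Num.truncn (q%:R * (`|alpha| + q%:R `^ (- mu)))).+1.
pose s := [seq (n%:Z - (P q)%:Z, q) | q <- iota 0 K, n <- iota 0 (P q + P q)].
apply: (@sub_finite_set _ _ [set` s]); last exact: finite_seq.
move=> [p q] pqA; have := qK _ _ pqA; case: pqA => /= q0 /andP[_ lt] {}qK.
have q0R : 0 < q%:R :> R by rewrite ltr0n.
have pP : `|p| < (P q)%:Z.
  rewrite -(ltr_int R) intr_norm; apply: lt_trans (truncnS_gt _).
  have {1}-> : p%:~R = q%:R * (p%:~R / q%:R) :> R by rewrite mulrCA divff ?mulr1// gt_eqF.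
  rewrite normrM (gtr0_norm q0R) ltr_pM2l//.
  have -> : p%:~R / q%:R = alpha - (alpha - p%:~R / q%:R) by ring.
  by apply: le_lt_trans (ler_normB _ _) _; rewrite ltrD2l.
suff : (p, q) \in s by [].
apply/allpairsPdep; exists q; exists (absz (p + (P q)%:Z)); split.
- by rewrite mem_iota.
- by rewrite mem_iota; lia.
- by congr pair; lia.
Qed.

Lemma rational_approx_dist alpha p q (e : R) : (0 < q)%N ->
  (`|alpha - p%:~R / q%:R| < e) = (`|q%:R * alpha - p%:~R| < q%:R * e).
Proof.
move=> q0; have q0R : 0 < q%:R :> R by rewrite ltr0n.
rewrite -(ltr_pM2l q0R) -{1}(gtr0_norm q0R) -normrM mulrBr.
by rewrite (mulrCA _ p%:~R) divff ?mulr1// gt_eqF.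
Qed.

(** The solutions counted by the exponent need not be reduced, and reduction may shrink the
    denominator. A denominator below [K] keeps a distance [c] from the integers, which is impossible
    once the unreduced denominator exceeds [K / c]. *)
Lemma exponent_gt_approx alpha nu K : irrational alpha -> 0 <= nu ->
  ((1 + nu)%:E < irrationality_exponent alpha)%E ->
  exists p q, [/\ (K <= q)%N, (0 < q)%N, coprimez p q%:Z &
    `|q%:R * alpha - p%:~R| < q%:R `^ (- nu)].
Proof.
move=> ia nu0 /ereal_sup_gt[_ [mu /= inf <-]]; rewrite lte_fin => numu.
have [c c0 cP] := irrational_away K ia.
pose L := (Num.truncn (K%:R / c)).+1.
have [p [q [qL q0 lt]]] : exists p q, [/\ (maxn K L <= q)%N, (0 < q)%N &
    `|alpha - p%:~R / q%:R| < q%:R `^ (- mu)].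
  apply: contrapT => no; apply: inf; apply: (@approximations_bounded _ _ (maxn K L)).
  move=> p q [/= q0 /andP[_ lt]]; rewrite ltnNge; apply/negP => Kq.
  by apply: no; exists p, q.
have q1 : 1 <= q%:R :> R by rewrite ler1n.
have [p' [q' [g [g0 cop pE qE]]]] := coprime_reduction p q0.
have q'0 : (0 < q')%N by move: q0; rewrite qE; case: (q').
have q'1 : 1 <= q'%:R :> R by rewrite ler1n.
have q'q : q'%:R <= q%:R :> R by rewrite ler_nat qE leq_pmulr.
have E : p%:~R / q%:R = p'%:~R / q'%:R :> R.
  rewrite pE qE natrM intrM /= -mulf_div divff ?mulr1// pnatr_eq0; lia.
rewrite E in lt.
have lt' : `|q'%:R * alpha - p'%:~R| < q'%:R * q%:R `^ (- (1 + nu)).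
  rewrite -rational_approx_dist//; apply: lt_le_trans lt _.
  by apply: ler_powR => //; lra.
exists p', q'; split=> //.
  rewrite leqNgt; apply/negP => q'K.
  have := cP q' p' ltac:(lia); rewrite leNgt => /negP; apply.
  apply: lt_le_trans lt' _; apply: (@le_trans _ _ (K%:R / q%:R)).
    rewrite ler_pM ?powR_ge0// ?ler_nat; first by lia.
    by rewrite -powR_inv1 ?ler0n// ler_powR//; lra.
  rewrite ler_pdivrMr ?(lt_le_trans ltr01)// mulrC -ler_pdivrMr//.
  apply: ltW; apply: lt_le_trans (truncnS_gt _) _.
  by rewrite ler_nat; apply: leq_trans qL; rewrite leq_max leqnn orbT.
apply: lt_le_trans lt' _.
apply: (@le_trans _ _ (q'%:R * q'%:R `^ (- (1 + nu)))).
  rewrite ler_pM2l ?ltr0n// !powRN lef_pV2 ?posrE ?powR_gt0 ?(lt_le_trans ltr01)//.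
  by apply: ge0_ler_powR; rewrite ?nnegrE//; lra.
have {1}-> : q'%:R = q'%:R `^ 1 :> R by rewrite powRr1.
by rewrite -powRD ?lt0r_neq0 ?ltr0n ?implybT// ler_powR//; lra.
Qed.

Lemma exponent_lt_away alpha nu : irrational alpha -> 0 <= nu ->
  (irrationality_exponent alpha < (1 + nu)%:E)%E ->
  exists2 c, 0 < c & forall q p, (0 < q)%N ->
    c * q%:R `^ (- nu) <= `|q%:R * alpha - p%:~R|.
Proof.
move=> ia nu0 lt.
have fin : finite_set (approximations alpha (1 + nu)).
  apply: contrapT => inf; move: lt; rewrite ltNge => /negP; apply.
  by apply: ereal_sup_ubound; exists (1 + nu).
have /finite_seqP[s sE] := finite_image snd fin.
pose K := (\max_(i <- s) i).+1.
have qK p q : approximations alpha (1 + nu) (p, q) -> (q < K)%N.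
  move=> pq; rewrite ltnS; have qs : q \in s.
    have : [set` s] q by rewrite -sE; exists (p, q).
    by [].
  by rewrite (big_rem q qs) /= leq_maxl.
have [c c0 cP] := irrational_away K ia.
exists (Num.min c 1) => [|q p q0]; first by rewrite lt_min c0 ltr01.
have q1 : 1 <= q%:R :> R by rewrite ler1n.
have [lqK|Kq] := ltnP q K.
  apply: le_trans (cP q p _); last by rewrite q0.
  apply: (@le_trans _ _ (c * 1)); last by rewrite mulr1.
  rewrite ler_pM ?powR_ge0 ?le_min ?ler01 ?(ltW c0)// ?ge_min ?lexx//.
  by rewrite -[leRHS](powRr0 q%:R) ler_powR//; lra.
apply: (@le_trans _ _ (q%:R `^ (- nu))).
  by rewrite ler_piMl ?powR_ge0// ge_min lexx orbT.
have -> : q%:R `^ (- nu) = q%:R * q%:R `^ (- (1 + nu)) :> R.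
  rewrite -{2}(powRr1 (ler0n R q)) -powRD ?lt0r_neq0 ?ltr0n ?implybT//.
  by congr powR; lra.
rewrite leNgt -rational_approx_dist//; apply/negP => lt'.
suff /qK : approximations alpha (1 + nu) (p, q) by lia.
split=> //=; rewrite lt' andbT normr_gt0; apply/eqP => E.
have := irrational_neq p ia q0; rewrite -normr_gt0 => /lt_le_trans.
have -> : q%:R * alpha - p%:~R = q%:R * (alpha - p%:~R / q%:R).
  by rewrite mulrBr (mulrCA _ p%:~R) divff ?mulr1// pnatr_eq0; lia.
by rewrite E mulr0 normr0 => /(_ 0 (lexx _)); rewrite ltxx.
Qed.

End IrrationalityExponent.

(** * Lower bounds with real parameters *)

Section LowerBounds.
Context {R : realType}.
Implicit Types (alpha beta x y u T Q : R) (p m h : int) (q j N : nat).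

Lemma truncn_bounds (a : R) : 0 <= a ->
  (Num.truncn a)%:R <= a /\ a < (Num.truncn a)%:R + 1.
Proof. by move=> a0; have /andP[] := truncn_itv a0; rewrite natr1. Qed.

(** For [|h| <= H] the number [h * alpha] lies within [eta] of [h * p / q]. Avoiding the multiples
    of [1 / q] with margin [2 * eta] thus handles all [2 * H + 1] shifts at once, which keeps the
    excluded measure small even when [H] is much larger than [q]. *)
Lemma grid_far alpha p q (z eta : R) h m H : (0 < q)%N -> `|h| <= H%:Z ->
  H%:R * `|q%:R * alpha - p%:~R| <= q%:R * eta ->
  (forall m', 2 * eta <= `|z - m'%:~R / q%:R|) ->
  eta <= `|z + h%:~R * alpha - m%:~R|.
Proof.
move=> q0 hH Hs far; have q0R : 0 < q%:R :> R by rewrite ltr0n.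
have := far (m * q%:Z - h * p); set s := _ - _ in Hs.
have -> : z - (m * q%:Z - h * p)%:~R / q%:R =
    (z + h%:~R * alpha - m%:~R) - h%:~R * s / q%:R.
  by rewrite /s intrB !intrM /=; field; rewrite gt_eqF.
have hs : `|h%:~R * s / q%:R| <= eta.
  rewrite normrM normfV (gtr0_norm q0R) ler_pdivrMr// normrM mulrC [leRHS]mulrC.
  apply: le_trans Hs; rewrite mulrC ler_wpM2r// -intr_norm.
  by rewrite -[leRHS]/((H%:Z)%:~R) ler_int.
by move=> /le_trans/(_ (ler_normB _ _)); lra.
Qed.

Lemma grid_far_near q (z eta : R) : (0 < q)%N -> `|z| <= 1 -> eta <= 1 ->
  (forall m, `|m| <= 2 * q%:Z -> eta <= `|z - m%:~R / q%:R|) ->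
  forall m, eta <= `|z - m%:~R / q%:R|.
Proof.
move=> q0 z1 e1 near m; have [/near//|mq] := leP `|m| (2 * q%:Z).
have q0R : 0 < q%:R :> R by rewrite ltr0n.
have : 2 <= `|m%:~R / q%:R| :> R.
  rewrite normrM normfV (gtr0_norm q0R) ler_pdivlMr// -intr_norm.
  have -> : 2 * q%:R = (2 * q%:Z)%:~R :> R by rewrite intrM.
  by rewrite ler_int ltW.
move=> m2; rewrite distrC; apply: le_trans (lerB_dist _ _); lra.
Qed.

(** [u] is the margin granted to the Borel-Cantelli argument, and [T] is the range of separation.
    With [eta = 1 / (u * q)], the grid controls the shifts up to [H = Q / u], and [M = Q * eta / 2]
    keeps [M * |sigma|] below [eta]. The condition [4 * u * q * T <= Q] makes [M] exceed
    [2 * T - 1], so each window, of length at most [5 / 2 * Q], costs at least [T / 2]. The first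
    alternative is the case [2 * e > H]. *)
Lemma rotation_lower_real alpha beta x y p q N u T :
  (0 < q)%N -> coprimez p q -> let Q := `|q%:R * alpha - p%:~R|^-1 in
  0 < Q -> 2 / q%:R <= beta -> 2 / q%:R <= 1 - beta ->
  1 <= T -> 2 <= u -> 4 * u * q%:R * T <= Q ->
  (forall j m, (0 < j)%N -> j%:R < 2 * T -> 4 / q%:R <= `|j%:R * alpha - m%:~R|) ->
  (forall m, 2 / (u * q%:R) <= `|y - x - m%:~R / q%:R|) ->
  12 * Q <= N%:R ->
  let e := (edit_count (xi_word alpha beta N x) (xi_word alpha beta N y))%:R in
  Q / (2 * u) <= e \/ N%:R * T / (24 * Q) <= e.
Proof.
move=> q0 pq Q Q0 b1 b2 T1 u2 uT js far NQ e.
have q0R : 1 <= q%:R :> R by rewrite ler1n.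
have s0 : 0 < `|q%:R * alpha - p%:~R| by rewrite -invr_gt0.
have sE : `|q%:R * alpha - p%:~R| = Q^-1 by rewrite /Q invrK.
clearbody Q; clear s0.
pose eta := (u * q%:R)^-1.
have eta0 : 0 < eta by rewrite invr_gt0 mulr_gt0//; clear - u2 q0R; lra.
have [H1 H2] := @truncn_bounds (Q / u) ltac:(by rewrite divr_ge0; clear - Q0 u2; lra).
set H := Num.truncn (Q / u) in H1 H2.
have [s1 s2] := @truncn_bounds T (le_trans ler01 T1).
set s := Num.truncn T in s1 s2.
have Qe0 : 0 <= Q * eta / 2 by rewrite divr_ge0// mulr_ge0// ltW.
have [M1 M2] := truncn_bounds Qe0; set M := Num.truncn (Q * eta / 2) in M1 M2.
have QeT : 4 * T <= Q * eta.
  have uq0 : 0 < u * q%:R by clear - u2 q0R; nra.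
  by rewrite /eta ler_pdivlMr//; clear - uT; lra.
have K0 : 0 <= 2 * Q / q%:R + 1 + M%:R by rewrite !addr_ge0// divr_ge0// mulr_ge0// ltW.
have [K1 _] := truncn_bounds K0; have := truncnS_gt (2 * Q / q%:R + 1 + M%:R).
set K := Num.truncn _ in K1 *; rewrite -natr1 => K2.
have He : H%:R * Q^-1 <= q%:R * eta.
  have -> : q%:R * eta = u^-1 by rewrite /eta; field; clear - q0R u2; lra.
  by rewrite ler_pdivrMr// mulrC.
have uT2 : 2 <= u * T by clear - u2 T1; nra.
have qQ : 8 * q%:R <= Q by apply: le_trans uT; clear - uT2 q0R; nra.
have MQ : M%:R * Q^-1 < eta.
  by rewrite ltr_pdivrMr// mulrC; clear - M1 Q0 eta0; nra.
have eq : eta <= 2 / q%:R.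
  rewrite /eta invfM ler_pM2r ?invr_gt0; last by clear - q0R; lra.
  by rewrite (@le_trans _ _ 1)// ?invf_le1; clear - u2; lra.
have KQ : 2 / (q%:R * Q^-1) + 1 + M%:R <= K.+1%:R.
  have -> : 2 / (q%:R * Q^-1) = 2 * Q / q%:R by field; clear - q0R Q0; lra.
  by rewrite -natr1 ltW.
have := @rotation_lower R alpha beta x y p q M s K.+1 H N eta q0 pq.
rewrite /= sE invr_gt0 => /(_ Q0 _ b1 b2 eq MQ KQ) L.
have {}L : (2 * edit_count (xi_word alpha beta N x) (xi_word alpha beta N y) <= H)%N ->
    (N %/ (K.+1 * q) * minn s M <=
     edit_count (xi_word alpha beta N x) (xi_word alpha beta N y))%N.
  apply: L.
  - by rewrite ler_pdivrMr ?mul1r//; clear - qQ Q0; lra.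
  - move=> j m /andP[j0 js2]; apply: js => //.
    have : j%:R < 2 * s%:R :> R by rewrite -natrM ltr_nat.
    by move/lt_le_trans; apply; clear - s1; lra.
  - move=> h m hH; by apply: (@grid_far _ p q _ _ _ _ H) => //; rewrite sE.
have [/L {}L|Hlt] := leqP (2 * edit_count (xi_word alpha beta N x) (xi_word alpha beta N y)) H; last first.
  left; have : H%:R + 1 <= 2 * e by rewrite /e natr1 -natrM ler_nat.
  have -> : Q / (2 * u) = (Q / u) / 2 by field; clear - u2; lra.
  by clear - H2; lra.
right; set W := (K.+1 * q)%N in L; set d := (N %/ W)%N in L.
have W0 : (0 < W)%N by rewrite /W muln_gt0.
have Wle : W%:R <= 5 / 2 * Q.
  rewrite /W natrM -natr1.
  have : (K%:R + 1) * q%:R <= (2 * Q / q%:R + 1 + M%:R + 1) * q%:R by rewrite ler_pM2r; clear - K1 q0R; lra.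
  have -> : (2 * Q / q%:R + 1 + M%:R + 1) * q%:R = 2 * Q + 2 * q%:R + M%:R * q%:R by field; clear - q0R; lra.
  have : M%:R * q%:R <= Q * eta / 2 * q%:R by rewrite ler_pM2r; clear - M1 q0R; lra.
  have -> : Q * eta / 2 * q%:R = Q / u / 2 by rewrite /eta; field; clear - q0R u2; lra.
  have : Q / u <= Q / 2 by rewrite ler_pM2l// lef_pV2 ?posrE; clear - u2; lra.
  by clear - qQ; lra.
pose X := N%:R / Q; have NE : N%:R = X * Q by rewrite /X divfK// gt_eqF.
have X12 : 12 <= X by rewrite /X ler_pdivlMr.
have dX : X / 12 <= d%:R.
  have : N%:R < (d%:R + 1) * W%:R :> R by rewrite natr1 -natrM ltr_nat ltn_ceil.
  have d0 : 0 <= d%:R + 1 :> R by rewrite addr_ge0.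
  move=> /lt_le_trans/(_ (ler_wpM2l d0 Wle)); rewrite NE mulrA ltr_pM2r//; clear - X12; lra.
have mT : T / 2 <= (minn s M)%:R.
  have s1' : (1 <= s)%N by rewrite -(ltr_nat R); clear - s2 T1; lra.
  have : 1 <= s%:R :> R by rewrite ler1n.
  by rewrite /minn; case: ifP => _; clear - s2 M2 QeT T1; lra.
have -> : N%:R * T / (24 * Q) = X / 12 * (T / 2) by rewrite NE; field; exact: lt0r_neq0.
apply: (@le_trans _ _ (d%:R * (minn s M)%:R)).
  by apply: ler_pM => //; clear - X12 T1; lra.
by rewrite -natrM ler_nat.
Qed.

Lemma rotation_lower_far_real alpha beta x y p q N (Y : R) :
  (0 < q)%N -> coprimez p q -> q%:R * `|q%:R * alpha - p%:~R| <= 1 ->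
  2 / q%:R <= beta -> 2 / q%:R <= 1 - beta -> 0 <= Y ->
  (forall h m, `|h|%:~R <= Y -> 2 / q%:R <= `|y - x + h%:~R * alpha - m%:~R|) ->
  let e := (edit_count (xi_word alpha beta N x) (xi_word alpha beta N y))%:R in
  Y / 2 <= e \/ N%:R / q%:R - 1 <= e.
Proof.
move=> q0 pq qs b1 b2 Y0 far e.
have q0R : 0 < q%:R :> R by rewrite ltr0n.
have [H1 H2] := truncn_bounds Y0; set H := Num.truncn Y in H1 H2.
have := @rotation_lower_far R alpha beta x y p q H N q0 pq qs b1 b2.
have [He|He] := leqP (2 * edit_count (xi_word alpha beta N x) (xi_word alpha beta N y)) H; last first.
  move=> _; left; have : H%:R + 1 <= 2 * e by rewrite /e natr1 -natrM ler_nat.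
  by lra.
move=> L; right.
have {}L : (N %/ q <= edit_count (xi_word alpha beta N x) (xi_word alpha beta N y))%N.
  apply: L => // h m hH; apply: far; apply: le_trans H1.
  by rewrite -[leRHS]/((H%:Z)%:~R) ler_int.
rewrite lerBlDr ler_pdivrMr//.
apply: (@le_trans _ _ (((N %/ q)%:R + 1) * q%:R)).
  by rewrite natr1 -natrM ler_nat ltnW// ltn_ceil.
by rewrite ler_pM2r// lerD2r ler_nat.
Qed.

End LowerBounds.

Section PowR.
Context {R : realType}.
Implicit Types a x r s C : R.

Lemma gt0_powRD a r s : 0 < a -> a `^ (r + s) = a `^ r * a `^ s.
Proof. by move=> a0; rewrite powRD// (gt_eqF a0) implybT. Qed.

Lemma powR_large C r : 0 < r -> exists B, forall x, B <= x -> C <= x `^ r.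
Proof.
move=> r0; exists (Num.max C 1 `^ r^-1) => x Bx.
have C1 : 0 < Num.max C 1 by rewrite lt_max ltr01 orbT.
have B0 : 0 < Num.max C 1 `^ r^-1 by rewrite powR_gt0.
apply: (@le_trans _ _ (Num.max C 1)); first by rewrite le_max lexx.
have -> : Num.max C 1 = (Num.max C 1 `^ r^-1) `^ r.
  by rewrite -powRrM mulVf ?gt_eqF// powRr1// ltW.
by apply: ge0_ler_powR; rewrite ?nnegrE// ltW// (lt_le_trans B0).
Qed.

Lemma le_powR a x r : 0 <= r -> 0 <= a -> a <= x -> a `^ r <= x `^ r.
Proof. by move=> r0 a0 ax; apply: ge0_ler_powR; rewrite // nnegrE// (le_trans a0). Qed.

Lemma powR_ge1 a r : 1 <= a -> 0 <= r -> 1 <= a `^ r.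
Proof. by move=> a1 r0; rewrite -[leLHS](powRr0 a) ler_powR. Qed.

Lemma powR_le1 a r : 0 <= a -> a <= 1 -> 0 <= r -> a `^ r <= 1.
Proof. by move=> a0 a1 r0; apply: le_trans (le_powR r0 a0 a1) _; rewrite powR1. Qed.

End PowR.

(** * Large distances at infinitely many lengths *)

Section DistanceOften.
Context {R : realType}.
Local Notation mu := (@lebesgue_measure R).
Local Notation mu2 := (mu \x mu)%E.
Implicit Types (alpha beta x y : R).

(** The multiples of [1 / q] in [[-2, 2]]. Since [y - x] lies in [[-1, 1]], all other multiples are
    at distance at least 1. *)
Definition grid (q : nat) : seq R :=
  [seq (n%:Z - (2 * q)%:Z)%:~R / q%:R | n <- iota 0 (4 * q).+1].

Lemma size_grid q : size (grid q) = (4 * q).+1.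
Proof. by rewrite size_map size_iota. Qed.

Lemma mem_grid q (m : int) : `|m| <= 2 * q%:Z -> m%:~R / q%:R \in grid q.
Proof.
move=> mq; apply/mapP; exists (absz (m + (2 * q)%:Z)); first by rewrite mem_iota; lia.
by congr (_%:~R / _); lia.
Qed.

Lemma circle_dist x y : circle x -> circle y -> `|y - x| <= 1.
Proof. by rewrite /circle /= !in_itv/= ler_norml; lra. Qed.

Lemma edit_half alpha beta N x y (g : R) :
  2 * g <= (edit_count (xi_word alpha beta N x) (xi_word alpha beta N y))%:R ->
  g <= word_distance alpha beta N x y.
Proof. by rewrite /word_distance /edit_distance; lra. Qed.

(** Here [T = Q ^ kappa] and [N] is about [Q ^ tau]. As [tau > 2 - kappa], the number [N * T / Q]
    exceeds [Q], so that both alternatives of [rotation_lower_real] give nearly [Q], against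
    [N ^ g], about [Q ^ (tau * g)]. The factor [q ^ lambda] in the hypothesis is the room for the
    margin [u]. *)
Lemma ae_word_distance_often alpha beta (kappa lambda g : R) :
  0 < beta < 1 -> 0 <= kappa < 1 -> 0 < lambda -> 0 < g -> g * (2 - kappa) < 1 ->
  (forall K, exists p q, let Q := `|q%:R * alpha - p%:~R|^-1 in
    [/\ (K < q)%N, coprimez p q%:Z, 0 < Q, q%:R `^ (1 + lambda) * Q `^ kappa <= Q &
      forall (j : nat) (m : int), (0 < j)%N -> j%:R < 2 * Q `^ kappa ->
        4 / q%:R <= `|j%:R * alpha - m%:~R|]) ->
  {ae mu2, forall p, circle p.1 -> circle p.2 -> forall N0, exists2 N, (N0 <= N)%N &
    N%:R `^ g <= word_distance alpha beta N p.1 p.2}.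
Proof.
move=> b01 k01 l0 g0 gk hyp.
(* The midpoint of [2 - kappa] and [1 / g]; the gap [omega] between 1 and [tau * g] absorbs the
   margin and all constants. *)
pose tau := ((2 - kappa) + g^-1) / 2; pose omega := 1 - tau * g.
have gV : 2 - kappa < g^-1 by rewrite -(ltr_pM2l g0) divff ?gt_eqF.
have tk : 2 - kappa < tau by rewrite /tau; lra.
have omega0 : 0 < omega.
  by rewrite /omega subr_gt0 -ltr_pdivlMr// mul1r /tau; lra.
pose l' := Num.min lambda omega / 2.
have [l'l l'o] : 2 * l' <= lambda /\ 2 * l' <= omega.
  by rewrite /l' mulrCA divff// mulr1 !ge_min !lexx orbT.
have l'0 : 0 < l' by rewrite divr_gt0// lt_min l0.
have [B1 B1P] := powR_large 8 l'0.
have nu0 : 0 < tau - 2 + kappa + omega by lra.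
have [B2 B2P] := powR_large 96 nu0.
have t10 : 0 < tau - 1 by lra.
have [B3 B3P] := powR_large 12 t10.
(* The [4 * q + 1] excluded balls have radius [2 / (u * q)] with [u = q ^ l'], hence total radius of
   order [1 / u]; the bound [2 ^ j.+1 <= u] makes these totals summable. *)
have choose j : exists pq : int * nat, let Q := `|pq.2%:R * alpha - pq.1%:~R|^-1 in
    [/\ [/\ (j < pq.2)%N, B1 <= pq.2%:R, B2 <= pq.2%:R & B3 <= pq.2%:R],
        [/\ (2 ^ j.+1)%:R <= pq.2%:R `^ l', 2 / beta <= pq.2%:R & 2 / (1 - beta) <= pq.2%:R],
     coprimez pq.1 pq.2%:Z, 0 < Q & pq.2%:R `^ (1 + lambda) * Q `^ kappa <= Q /\
      forall (j : nat) (m : int), (0 < j)%N -> j%:R < 2 * Q `^ kappa ->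
        4 / pq.2%:R <= `|j%:R * alpha - m%:~R|].
  have [B4 B4P] := powR_large (2 ^ j.+1)%:R l'0.
  pose B := Num.max (Num.max (Num.max B1 B2) (Num.max B3 B4))
    (Num.max (2 / beta) (2 / (1 - beta))).
  have [p [q [Kq pq Q0 qQ jP]]] := hyp (maxn j (Num.truncn B).+1).
  move: Kq; rewrite gtn_max => /andP[jq Bq].
  have {}Bq : B <= q%:R.
    by apply: ltW; apply: lt_trans (truncnS_gt _) _; rewrite ltr_nat.
  move: Bq; rewrite /B !ge_max => /andP[/andP[/andP[? ?] /andP[? ?]] /andP[? ?]].
  by exists (p, q); split=> //=; split=> //; exact: B4P.
have /choice[f fP] := choose.
pose u j : R := (f j).2%:R `^ l'.
pose w j : R := 2 / (u j * (f j).2%:R).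
have q0 j : (0 < (f j).2)%N by have [[h _ _ _] _ _ _ _] := fP j; exact: leq_ltn_trans h.
have q1 j : 1 <= (f j).2%:R :> R by rewrite ler1n.
have u8 j : 8 <= u j by have [[_ h _ _] _ _ _ _] := fP j; exact: B1P.
have w0 j : 0 <= w j by rewrite divr_ge0 ?mulr_ge0//; have := u8 j; lra.
have sw j : (size (grid (f j).2))%:R * w j <= 10 / (2 ^ j.+1)%:R.
  have [_ [uj _ _] _ _ _] := fP j.
  rewrite size_grid -natr1 natrM /w; have := q1 j; have := u8 j.
  move: uj; rewrite -/(u j); set v := u j; set q := (f j).2%:R => uj v8 q1'.
  have p0 : 0 < (2 ^ j.+1)%:R :> R by rewrite ltr0n expn_gt0.
  rewrite mulrA ler_pdivrMr ?mulr_gt0//; try lra.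
  rewrite mulrAC ler_pdivlMr//.
  have : q * (2 ^ j.+1)%:R <= q * v by rewrite ler_pM2l//; lra.
  nra.
have c10 : 0 <= 10 :> R by [].
have F := ae_filter_ringOfSetsType mu2.
apply: filterS (ae_difference (ae_avoid_balls w0 c10 sw)) => p [J avoid] c1 c2 N0.
have z1 := circle_dist c1 c2.
pose j := maxn J N0.
have [[jq _ qB2 qB3] [uj qb qb'] pq Q0 [qQ js]] := fP j.
have {avoid} far := avoid j (leq_maxl _ _).
have {uj} := u8 j; have := q1 j; have := q0 j; move: Q0 qQ js far jq qB2 qB3 qb qb' pq.
rewrite /w /u; move: (f j) => [a q] /=; set Q := _^-1.
move=> Q0 qQ js far jq qB2 qB3 qb qb' pq qn0 qR1; set v := q%:R `^ l' => v8.
clear hyp choose sw w0 u8 q1 q0 fP u w F f c10 c1 c2.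
have QV0 : 0 < q%:R :> R by rewrite ltr0n.
have l8 : 8 <= q%:R `^ (1 + lambda).
  by apply: le_trans v8 _; apply: ler_powR => //; clear - l'0 l'l; lra.
have ql : q%:R <= q%:R `^ (1 + lambda) by rewrite -[leLHS]powRr1 ?ler_powR//; clear - l0; lra.
have Q1 : 1 <= Q.
  rewrite leNgt; apply/negP => Q1.
  have QE : Q = Q `^ kappa * Q `^ (1 - kappa).
    by rewrite -gt0_powRD// addrC subrK powRr1// ltW.
  have := powR_gt0 kappa Q0.
  have : Q `^ (1 - kappa) <= 1 by apply: powR_le1; clear - k01 Q0 Q1; lra.
  have := powR_gt0 (1 - kappa) Q0; move: qQ; rewrite {2}QE; clear - l8; nra.
have T1 : 1 <= Q `^ kappa by apply: powR_ge1 => //; clear - k01; lra.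
have qQ1 : q%:R <= Q by apply: le_trans qQ; clear - T1 ql QV0; nra.
pose N := (Num.truncn (Q `^ tau)).+1.
have tau1 : 1 <= tau by clear - t10; lra.
have Qt1 : 1 <= Q `^ tau by apply: powR_ge1 => //; clear - t10; lra.
have N1 : Q `^ tau <= N%:R by rewrite ltW// truncnS_gt.
have N2 : N%:R <= 2 * Q `^ tau.
  by rewrite /N -natr1; have [] := truncn_bounds (powR_ge0 Q tau); clear - Qt1; lra.
have QN : Q <= N%:R by apply: le_trans N1; rewrite -[leLHS](powRr1 (ltW Q0)) ler_powR.
exists N.
  have qN : (q <= N)%N by rewrite -(ler_nat R) (le_trans qQ1 QN).
  by apply: leq_trans (leq_trans (ltnW jq) qN); rewrite leq_maxr.
apply: edit_half.
have g1 : g <= 1 by clear - gk g0 k01; nra.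
have fin : 2 * N%:R `^ g <= 4 * Q `^ (1 - omega).
  have -> : 1 - omega = tau * g by rewrite /omega subKr.
  have -> : 4 * Q `^ (tau * g) = 2 * (2 * Q `^ (tau * g)) by ring.
  rewrite ler_pM2l// powRrM; apply: (@le_trans _ _ ((2 * Q `^ tau) `^ g)).
    by apply: le_powR => //; exact: ltW.
  rewrite powRM ?powR_ge0// ler_pM2r ?powR_gt0//.
  by rewrite -[leRHS]powRr1// ler_powR// ler1n.
apply: le_trans fin _.
have ll : q%:R `^ l' * q%:R `^ (2 * l' - l') <= q%:R `^ lambda.
  by rewrite -gt0_powRD//; apply: ler_powR => //; clear - l'l; lra.
have vl : 4 * v <= q%:R `^ lambda.
  by apply: le_trans ll; rewrite (_ : 2 * l' - l' = l') -/v; [clear - v8; nra|clear; lra].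
have oo : 8 * v <= Q `^ omega.
  apply: (@le_trans _ _ (q%:R `^ omega)); last by apply: le_powR => //; exact: ltW.
  apply: (@le_trans _ _ (q%:R `^ l' * q%:R `^ l')); first by rewrite -/v; clear - v8; nra.
  by rewrite -gt0_powRD//; apply: ler_powR => //; clear - l'o; lra.
have cond : 4 * v * q%:R * Q `^ kappa <= Q.
  apply: le_trans qQ; rewrite ler_pM2r ?powR_gt0// gt0_powRD// powRr1; last exact: ltW.
  by rewrite mulrC ler_pM2l.
have N12 : 12 * Q <= N%:R.
  apply: le_trans N1; have -> : tau = (tau - 1) + 1 by rewrite subrK.
  rewrite gt0_powRD// powRr1 ?(ltW Q0)// ler_pM2r//; apply: B3P; exact: le_trans qQ1.
have qb2 : 2 / q%:R <= beta by rewrite ler_pdivrMr// mulrC -ler_pdivrMr//; clear - b01; lra.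
have qb2' : 2 / q%:R <= 1 - beta by rewrite ler_pdivrMr// mulrC -ler_pdivrMr//; clear - b01; lra.
have v2 : 2 <= v by clear - v8; lra.
have far' : forall m : int, 2 / (v * q%:R) <= `|p.2 - p.1 - m%:~R / q%:R|.
  apply: grid_far_near => //.
    by rewrite ler_pdivrMr ?mul1r ?mulr_gt0//; clear - v8 qR1; nra.
  by move=> m mq; apply: far; exact: mem_grid.
have QE : Q = Q `^ (1 - omega) * Q `^ omega.
  by rewrite -gt0_powRD// subrK powRr1// ltW.
have := @rotation_lower_real R alpha beta p.1 p.2 a q N v (Q `^ kappa) qn0 pq Q0 qb2 qb2' T1
  v2 cond js far' N12.
rewrite /= -/Q => -[e|e]; apply: le_trans e.
  have v0 : 0 < v by clear - v8; lra.
  rewrite ler_pdivlMr ?mulr_gt0//.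
  have -> : 4 * Q `^ (1 - omega) * (2 * v) = Q `^ (1 - omega) * (8 * v) by ring.
  by rewrite [leRHS]QE ler_pM2l ?powR_gt0.
rewrite ler_pdivlMr ?mulr_gt0//.
apply: (@le_trans _ _ (Q `^ tau * Q `^ kappa)); last by rewrite ler_pM2r ?powR_gt0.
have -> : 4 * Q `^ (1 - omega) * (24 * Q) = 96 * (Q `^ (1 - omega) * Q `^ 1).
  by rewrite (powRr1 (ltW Q0)); ring.
rewrite -!gt0_powRD//.
have -> : tau + kappa = (tau - 2 + kappa + omega) + (1 - omega + 1) by clear; lra.
by rewrite (@gt0_powRD _ Q (tau - _ + _ + _)) // ler_pM2r ?powR_gt0//; apply: B2P; exact: le_trans qQ1.
Qed.

End DistanceOften.

(** * Large distances at all large lengths *)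

Section DistanceEventually.
Context {R : realType}.
Local Notation mu := (@lebesgue_measure R).
Local Notation mu2 := (mu \x mu)%E.
Implicit Types (alpha beta x y : R).

(* The points [m - h * alpha] that can lie close to [[-1, 1]]. *)
Definition orbit_grid alpha (n : nat) : seq R :=
  [seq (Num.floor ((h%:Z - n%:Z)%:~R * alpha) + (m%:Z - 3%:Z))%:~R - (h%:Z - n%:Z)%:~R * alpha
    | h <- iota 0 (2 * n).+1%N, m <- iota 0 7].

Lemma size_orbit_grid alpha n : size (orbit_grid alpha n) = ((2 * n).+1 * 7)%N.
Proof. by rewrite size_allpairs !size_iota. Qed.

Lemma orbit_grid_far alpha n (z eta : R) (h m : int) : `|z| <= 1 -> eta <= 1 -> `|h| <= n%:Z ->
  (forall a, a \in orbit_grid alpha n -> eta <= `|z - a|) ->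
  eta <= `|z + h%:~R * alpha - m%:~R|.
Proof.
move=> z1 e1 hn far; pose f := Num.floor (h%:~R * alpha).
have hE : h = (absz (h + n%:Z))%:Z - n%:Z by lia.
have := floor_itv (h%:~R * alpha); rewrite -/f intrD mulr1z => fl.
have near : - 3%:Z <= m - f -> m - f <= 3%:Z -> eta <= `|z + h%:~R * alpha - m%:~R|.
  move=> m1 m2; have -> : z + h%:~R * alpha - m%:~R = z - (m%:~R - h%:~R * alpha) by ring.
  apply: far; apply/allpairsP; exists (absz (h + n%:Z), absz (m - f + 3%:Z)).
  split; [by rewrite mem_iota /=; lia|by rewrite mem_iota /=; lia|].
  rewrite /= -hE -/f; congr (_%:~R - _); lia.
have [m1|m1] := leP (- 3%:Z) (m - f); last first.
  have : (m - f)%:~R <= (- 3%:Z)%:~R :> R by rewrite ler_int; lia.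
  rewrite intrB intrN ler_norml in z1 * => mf.
  by apply: le_trans (ler_norm _); lra.
have [m2|m2] := leP (m - f) 3%:Z; first exact: near.
have : 3%:Z%:~R <= (m - f)%:~R :> R by rewrite ler_int; lia.
rewrite intrB ler_norml in z1 * => mf.
by rewrite distrC; apply: le_trans (ler_norm _); lra.
Qed.

(** Dirichlet's theorem does not say where [q] lies below [X]. If [q] is nearly [X], there is no
    room for the margin [u], but so few shifts matter that all of them can be kept [2 / q] away, and
    [rotation_lower_far_real] applies. Otherwise [4 * u * q <= X], and the grid of [1 / q] is
    avoided with margin [u]. There [N * T / Q] is large for either value of [T]: one uses
    [Q <= q ^ r / c] and [tau > 1 + r - 1 / r], the other [tau >= 2]. *)
Lemma word_distance_scale alpha beta (c r tau omega D : R) :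
  0 < beta < 1 -> 0 < c -> 1 <= r ->
  (forall q p, (0 < q)%N -> c * q%:R `^ (- r) <= `|q%:R * alpha - p%:~R|) ->
  2 <= tau -> 1 + r - r^-1 < tau -> 0 < omega -> omega < 1 -> 0 < D ->
  exists A, forall X (p : int) (q : nat) x y N, 1 <= X -> A <= X ->
    (0 < q)%N -> coprimez p q -> q%:R <= X -> `|q%:R * alpha - p%:~R| < X^-1 ->
    `|y - x| <= 1 -> X `^ tau <= N%:R ->
    (if X `^ (1 - omega / 4) <= q%:R
     then forall a, a \in orbit_grid alpha (Num.truncn (X `^ (1 - omega / 2))) ->
       2 / q%:R <= `|y - x - a|
     else forall a, a \in grid q -> 2 / (X `^ (omega / 8) * q%:R) <= `|y - x - a|) ->
    D * X `^ (1 - omega) <=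
    (edit_count (xi_word alpha beta N x) (xi_word alpha beta N y))%:R.
Proof.
move=> b01 c0 r1 hyp t2 tr omega0 omega1 D0.
pose l := omega / 4; pose l' := omega / 8.
have l'0 : 0 < l' by rewrite /l'; lra.
(* With this constant [(2 * c' * q ^ (1 / r)) ^ r = c * q / 4], so that [c * j ^ (- r) >= 4 / q] for
   [j] up to [2 * c' * q ^ (1 / r)]. *)
pose c' := (c / 4) `^ r^-1 / 2.
have r0 : 0 < r by lra.
have c4 : 0 < c / 4 by lra.
have c'0 : 0 < c' by rewrite divr_gt0// powR_gt0.
have [A1 A1P] := @powR_large R (2 * D) (omega / 2) ltac:(lra).
have [A2 A2P] := @powR_large R (Num.max (96 * D) (24 * D / (c * c'))) omega omega0.
have [A3 A3P] := @powR_large R (12 / c) (tau - r) ltac:(have : r^-1 <= 1 by [rewrite invf_le1]; lra).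
have [A4 A4P] := @powR_large R 4 l' l'0.
pose Kq := Num.max (Num.max (2 / beta) (2 / (1 - beta))) (c'^-1 `^ r).
have Kq0 : 0 <= Kq by rewrite le_max powR_ge0 orbT.
pose A := Num.max (Num.max (Num.max A1 A2) (Num.max A3 A4)) (Kq `^ r / c + 1).
exists A => X p q x y N X1'.
rewrite /A !ge_max => /andP[/andP[/andP[/A1P L1 /A2P L2] /andP[/A3P L3 /A4P L4]] L5].
move=> q0 pq qX dX z1 XN avoid.
have q1' : 1 <= q%:R :> R by rewrite ler1n.
have X0 : 0 < X := lt_le_trans ltr01 X1'.
have Xp' s : 0 < X `^ s by rewrite powR_gt0.
have q0R : 0 < q%:R :> R by rewrite ltr0n.
have qr : c * X < q%:R `^ r.
  have := le_lt_trans (hyp q p q0) dX; rewrite powRN -ltr_pdivlMr ?invr_gt0 ?powR_gt0//.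
  by rewrite invrK mulrC -ltr_pdivlMr// mulrC ltr_pdivrMr// mulrC => h; rewrite mulrC.
have qK : Kq < q%:R.
  rewrite ltNge; apply/negP => /(le_powR (ltW r0) (ltW q0R)) h.
  have : c * (Kq `^ r / c + 1) <= c * X by rewrite ler_pM2l.
  have -> : c * (Kq `^ r / c + 1) = Kq `^ r + c by field; exact: lt0r_neq0.
  by clear - qr h c0; lra.
move: qK; rewrite /Kq !gt_max => /andP[/andP[qb qb'] qc'].
have qb2 : 2 / q%:R <= beta by rewrite ler_pdivrMr// mulrC -ler_pdivrMr//; clear - b01 qb; lra.
have qb2' : 2 / q%:R <= 1 - beta by rewrite ler_pdivrMr// mulrC -ler_pdivrMr//; clear - b01 qb'; lra.
have q2 : 2 / q%:R <= 1 :> R by apply: le_trans qb2 _; have /andP[_ /ltW] := b01.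
have pD s t : X `^ (s + t) = X `^ s * X `^ t by rewrite gt0_powRD.
have p1 : X `^ 1 = X by rewrite powRr1// ltW.
have DX : 2 * (D * X `^ (1 - omega)) <= X `^ (1 - omega / 2).
  have -> : 1 - omega / 2 = (1 - omega) + omega / 2 by clear; lra.
  have -> : 2 * (D * X `^ (1 - omega)) = X `^ (1 - omega) * (2 * D) by ring.
  by rewrite (pD (1 - omega) (omega / 2)) ler_pM2l.
have qd : q%:R * `|q%:R * alpha - p%:~R| <= 1.
  have h : q%:R * `|q%:R * alpha - p%:~R| <= X * X^-1 by rewrite ler_pM// ltW.
  by move: h; rewrite divff// gt_eqF.
move: avoid; case: ifPn => cl avoid.
  have Y0 : 0 <= X `^ (1 - omega / 2) by exact: ltW.
  have [h m hY|e|e] := @rotation_lower_far_real R alpha beta x y p q N (X `^ (1 - omega / 2))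
    q0 pq qd qb2 qb2' Y0.
  - apply: orbit_grid_far z1 q2 _ avoid.
    by rewrite -abszE lez_nat truncn_ge_nat// natr_absz.
  - by apply: le_trans e; rewrite ler_pdivlMr// mulrC.
  - apply: le_trans e.
    have X2 : 2 <= X by apply: le_trans qX; move: q2; rewrite ler_pdivrMr// mul1r.
    have NX : X * q%:R <= N%:R.
      apply: le_trans XN; apply: (@le_trans _ _ (X `^ 2)); last by rewrite ler_powR.
      have -> : 2 = 1 + 1 :> R by []; rewrite pD p1.
      by rewrite ler_pM2l.
    have : X <= N%:R / q%:R by rewrite ler_pdivlMr.
    have : X `^ (1 - omega / 2) <= X by rewrite -[leRHS]p1 ler_powR//; clear - omega0; lra.
    clear - DX X2; lra.
have {}cl : q%:R < X `^ (1 - l) by rewrite ltNge.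
pose Q := `|q%:R * alpha - p%:~R|^-1.
have d0 : 0 < `|q%:R * alpha - p%:~R|.
  by apply: lt_le_trans (hyp q p q0); rewrite mulr_gt0 ?powR_gt0.
have Q0 : 0 < Q by rewrite invr_gt0.
have QX : X < Q by rewrite -(invrK X) ltf_pV2 ?posrE ?invr_gt0.
have Qr : Q * c <= q%:R `^ r.
  have : c * q%:R `^ (- r) <= Q^-1 by rewrite invrK hyp.
  rewrite powRN -(ler_pM2r Q0) mulVf ?gt_eqF// mulrAC ler_pdivrMr ?powR_gt0// mul1r.
  by rewrite mulrC.
pose u := X `^ l'.
have u4 : 4 <= u by exact: L4.
have ll : u * u = X `^ l by rewrite -pD; congr powR; rewrite /l /l'; clear; lra.
have uq : 4 * u * q%:R <= X.
  have -> : X = X `^ l * X `^ (1 - l) by rewrite -pD addrC subrK p1.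
  by rewrite -ll; apply: ler_pM => //; clear - u4 cl; [lra|nra|exact: ltW].
have uq0 : 0 < 4 * u * q%:R by rewrite !mulr_gt0//; clear - u4; lra.
(* The first term provides the separation of the multiples of [alpha], the second is the requirement
   [4 * u * q * T <= Q]. *)
pose T := Num.min (c' * q%:R `^ r^-1) (Q / (4 * u * q%:R)).
have T1 : 1 <= T.
  rewrite le_min; apply/andP; split; last by rewrite ler_pdivlMr// mul1r; clear - uq QX; lra.
  rewrite mulrC -ler_pdivrMr// div1r.
  have {1}-> : c'^-1 = (c'^-1 `^ r) `^ r^-1.
    by rewrite -powRrM divff ?gt_eqF// powRr1// invr_ge0 ltW.
  by apply: le_powR; rewrite ?invr_ge0 ?powR_ge0 ?(ltW r0) ?(ltW qc').
have [Tc TQ] : T <= c' * q%:R `^ r^-1 /\ T <= Q / (4 * u * q%:R).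
  by rewrite /T !ge_min !lexx orbT.
have uT : 4 * u * q%:R * T <= Q by rewrite mulrC -ler_pdivlMr.
have js (i : nat) (m : int) : (0 < i)%N -> i%:R < 2 * T -> 4 / q%:R <= `|i%:R * alpha - m%:~R|.
  move=> i0 iT; apply: le_trans (hyp i m i0).
  have i0R : 0 < i%:R :> R by rewrite ltr0n.
  rewrite powRN ler_pdivlMr ?powR_gt0// mulrAC ler_pdivrMr//.
  have : i%:R `^ r <= (2 * (c' * q%:R `^ r^-1)) `^ r.
    by apply: le_powR (ltW r0) (ltW i0R) _; clear - iT Tc; lra.
  have -> : 2 * (c' * q%:R `^ r^-1) = (c / 4) `^ r^-1 * q%:R `^ r^-1 by rewrite /c'; field.
  rewrite -(powRM _ (ltW c4) (ltW q0R)) -powRrM mulVf ?gt_eqF// powRr1; last by rewrite mulr_ge0// ltW.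
  by clear; lra.
have far m : 2 / (u * q%:R) <= `|y - x - m%:~R / q%:R|.
  apply: (@grid_far_near _ q) => //.
    by rewrite ler_pdivrMr ?mul1r ?mulr_gt0//; clear - u4 q1'; nra.
  by move=> m' mq; apply: avoid; exact: mem_grid.
have rV1 : r^-1 <= 1 by rewrite invf_le1.
have N12 : 12 * Q <= N%:R.
  apply: le_trans XN; have -> : tau = (tau - r) + r by rewrite subrK.
  rewrite pD; apply: (@le_trans _ _ (12 / c * X `^ r)); last by rewrite ler_pM2r.
  rewrite -mulrA ler_pM2l// mulrC ler_pdivlMr//; apply: le_trans Qr _.
  by apply: le_powR => //; exact: ltW.
have XE : X = X `^ (1 - omega) * X `^ omega by rewrite -pD subrK p1.
move: L2; rewrite ge_max => /andP[L2 L2'].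
have [e|e] := @rotation_lower_real R alpha beta x y p q N u T q0 pq Q0 qb2 qb2' T1
   (ltac:(clear - u4; lra) : 2 <= u) uT js far N12; apply: le_trans e; rewrite -/Q.
  rewrite ler_pdivlMr; last by clear - u4; lra.
  have h1 : X `^ (1 - omega / 2) * u <= X.
    by rewrite -pD -[leRHS]p1 ler_powR// /l'; clear - omega0; lra.
  have h2 : 2 * (D * X `^ (1 - omega)) * u <= X `^ (1 - omega / 2) * u.
    by rewrite ler_pM2r//; clear - u4; lra.
  by clear - h1 h2 QX; lra.
rewrite ler_pdivlMr; last by clear - Q0; lra.
have [TE|TE] := leP (c' * q%:R `^ r^-1) (Q / (4 * u * q%:R)).
  have -> : T = c' * q%:R `^ r^-1 by rewrite /T; apply/min_idPl.
  have h1 : 24 * D * X `^ (1 - omega) <= X * (c * c').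
    have L3' : 24 * D <= X `^ omega * (c * c') by rewrite -ler_pdivrMr// mulr_gt0.
    have -> : X * (c * c') = X `^ (1 - omega) * (X `^ omega * (c * c')) by rewrite mulrA -XE.
    by rewrite mulrC ler_pM2l.
  have h2 : X * q%:R `^ (r - r^-1) <= N%:R.
    apply: le_trans XN; apply: (@le_trans _ _ (X * X `^ (r - r^-1))).
      by rewrite ler_pM2l//; apply: le_powR => //; clear - r1 rV1; lra.
    by rewrite -{1}p1 -pD ler_powR//; clear - tr; lra.
  have h3 : q%:R `^ r = q%:R `^ (r - r^-1) * q%:R `^ r^-1 by rewrite -gt0_powRD// subrK.
  have qi0 : 0 < q%:R `^ r^-1 by rewrite powR_gt0.
  rewrite -(ler_pM2r c0); apply: (@le_trans _ _ (24 * D * X `^ (1 - omega) * q%:R `^ r)).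
    have -> : D * X `^ (1 - omega) * (24 * Q) * c = 24 * D * X `^ (1 - omega) * (Q * c) by ring.
    by rewrite ler_pM2l// !mulr_gt0.
  apply: (@le_trans _ _ (X * (c * c') * q%:R `^ r)); first by rewrite ler_pM2r ?powR_gt0.
  have -> : X * (c * c') * q%:R `^ r = X * q%:R `^ (r - r^-1) * (c' * q%:R `^ r^-1) * c.
    by rewrite h3; ring.
  by rewrite ler_pM2r// ler_pM2r// mulr_gt0.
have -> : T = Q / (4 * u * q%:R) by rewrite /T; apply/min_idPr/ltW.
rewrite (mulrC 24) mulrA [leLHS]mulrAC [leRHS]mulrA [leRHS]mulrAC ler_pM2r// ler_pdivlMr//.
have h1 : 96 * D * X `^ (1 - omega) <= X.
  by rewrite [leRHS]XE mulrC ler_pM2l.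
have h2 : u * q%:R <= X by clear - uq u4 q1'; nra.
have h3 : X * X <= N%:R.
  apply: le_trans XN; have {1 2}-> : X = X `^ 1 by [].
  by rewrite -pD ler_powR//; clear - t2; lra.
apply: le_trans h3.
have -> : D * X `^ (1 - omega) * 24 * (4 * u * q%:R) = 96 * D * X `^ (1 - omega) * (u * q%:R) by ring.
have uq1 : 0 <= u * q%:R by rewrite mulr_ge0// ltW// (lt_le_trans _ u4).
apply: ler_pM => //.
by rewrite !mulr_ge0// ltW.
Qed.

(** The scales are [X j = B ^ j], and [N] is treated at the [j] with
    [X j ^ tau <= N < X j.+1 ^ tau]. Geometric scales lose only a constant factor between
    neighbours, while the excluded measure decays geometrically in both cases of
    [word_distance_scale]. *)
Lemma ae_word_distance_eventually alpha beta (c r g : R) :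
  0 < beta < 1 -> 0 < c -> 1 <= r ->
  (forall q p, (0 < q)%N -> c * q%:R `^ (- r) <= `|q%:R * alpha - p%:~R|) ->
  0 < g -> 2 * g < 1 -> g * (1 + r - r^-1) < 1 ->
  {ae mu2, forall p, circle p.1 -> circle p.2 -> exists N0, forall N, (N0 <= N)%N ->
    N%:R `^ g <= word_distance alpha beta N p.1 p.2}.
Proof.
move=> b01 c0 r1 hyp g0 g2 gr.
have gV0 : 0 < g^-1 by rewrite invr_gt0.
have gV2 : 2 < g^-1 by rewrite -(ltr_pM2l g0) divff ?gt_eqF// mulrC.
have gVr : 1 + r - r^-1 < g^-1 by rewrite -(ltr_pM2l g0) divff ?gt_eqF.
pose tau := (Num.max 2 (1 + r - r^-1) + g^-1) / 2; pose omega := 1 - tau * g.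
have [m2 mr] : 2 <= Num.max 2 (1 + r - r^-1) /\ 1 + r - r^-1 <= Num.max 2 (1 + r - r^-1).
  by rewrite !le_max !lexx orbT.
have mg : Num.max 2 (1 + r - r^-1) < g^-1 by rewrite gt_max gV2.
have t2 : 2 <= tau by rewrite /tau; lra.
have tr : 1 + r - r^-1 < tau by rewrite /tau; lra.
have omega0 : 0 < omega by rewrite /omega subr_gt0 -ltr_pdivlMr// mul1r /tau; lra.
have omega1 : omega < 1 by rewrite /omega; nra.
pose l := omega / 4; pose l' := omega / 8.
have l'0 : 0 < l' by rewrite /l'; lra.
(* The exponent exceeds [1 / l'], so even the small power [X j ^ l'] is at least [2 ^ j]. *)
pose B := (2 ^ (Num.truncn l'^-1).+1)%N.
have B1 : (1 < B)%N by rewrite /B -{1}(expn0 2) ltn_exp2l.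
pose X j : R := (B ^ j)%:R.
have B0 := ltnW B1.
have X1 j : 1 <= X j by rewrite ler1n expn_gt0 B0.
have XS j : X j.+1 = B%:R * X j by rewrite /X expnS natrM.
have Xl j : (2 ^ j)%:R <= X j `^ l'.
  rewrite /X /B -expnM !natrX -!powR_mulrn// -powRrM; apply: ler_powR; first by lra.
  rewrite natrM mulrAC -[leLHS]mul1r ler_wpM2r// -ler_pdivrMr// div1r.
  by rewrite ltW// truncnS_gt.
have /choice[f fP] : forall j, exists pq : int * nat,
    [/\ (0 < pq.2)%N, pq.2%:R <= X j, coprimez pq.1 pq.2%:Z &
     `|pq.2%:R * alpha - pq.1%:~R| < (X j)^-1].
  move=> j; have Bj : (0 < B ^ j)%N by rewrite expn_gt0 B0.
  have [p [q [/andP[q0 qX] pq lt]]] := dirichlet alpha Bj.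
  by exists (p, q); split; rewrite //= ler_nat.
pose q j : R := (f j).2%:R.
pose close j := X j `^ (1 - l) <= q j.
pose n j := Num.truncn (X j `^ (1 - 2 * l)).
pose w j : R := if close j then 2 / q j else 2 / (X j `^ l' * q j).
pose cs j := if close j then orbit_grid alpha (n j) else grid (f j).2.
have q1 j : 1 <= q j by have [? _ _ _] := fP j; rewrite ler1n.
have Xp j s : 0 < X j `^ s by rewrite powR_gt0//; have := X1 j; lra.
have w0 j : 0 <= w j.
  by rewrite /w; case: ifP => _; rewrite divr_ge0 ?mulr_ge0 ?powR_ge0//; have := q1 j; lra.
have sw j : (size (cs j))%:R * w j <= 84 / (2 ^ j.+1)%:R.
  have p0 : 0 < (2 ^ j)%:R :> R by rewrite ltr0n expn_gt0.
  have -> : 84 / (2 ^ j.+1)%:R = 42 / (2 ^ j)%:R :> R.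
    by rewrite expnS natrM; field; rewrite gt_eqF.
  rewrite ler_pdivlMr// /w /cs; have := Xl j; have := q1 j; case: ifPn => cl q1j Xlj.
    rewrite size_orbit_grid natrM -natr1 natrM mulrA mulrAC ler_pdivrMr; last by lra.
    have [n1 _] := truncn_bounds (ltW (Xp j (1 - 2 * l))).
    have Y1 : 1 <= X j `^ (1 - 2 * l) by apply: powR_ge1 => //; rewrite /l; lra.
    have : X j `^ (1 - 2 * l) * X j `^ l <= q j.
      by apply: le_trans cl; rewrite -gt0_powRD ?ler_powR//; have := X1 j; lra.
    have : (2 ^ j)%:R <= X j `^ l by apply: le_trans Xlj _; apply: ler_powR => //; rewrite /l' /l; lra.
    move: n1; rewrite -/(n j); move: (X j `^ (1 - 2 * l)) Y1 (X j `^ l) => Y Y1 Z n1 jZ YZ.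
    have : Y * (2 ^ j)%:R <= q j by apply: le_trans YZ; rewrite ler_pM2l//; lra.
    have : (n j)%:R * (2 ^ j)%:R <= Y * (2 ^ j)%:R by rewrite ler_pM2r.
    have : 1 * (2 ^ j)%:R <= Y * (2 ^ j)%:R by rewrite ler_pM2r.
    lra.
  rewrite size_grid -natr1 natrM mulrA mulrAC ler_pdivrMr ?mulr_gt0//; last by lra.
  have : (2 ^ j)%:R * q j <= X j `^ l' * q j by rewrite ler_pM2r//; lra.
  rewrite -/(q j); nra.
(* The 2 comes from the halving in the edit distance, the power of [B] from replacing [X j.+1] by
   [X j]. *)
pose D := 2 * B%:R `^ (tau * g).
have D0 : 0 < D by rewrite mulr_gt0// powR_gt0// ltr0n.
have [A AP] := word_distance_scale b01 c0 r1 hyp t2 tr omega0 omega1 D0.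
pose J0 := (Num.truncn A).+1.
have large j : (J0 <= j)%N -> A <= X j.
  move=> Jj; apply: ltW; apply: lt_le_trans (truncnS_gt _) _.
  by rewrite ler_nat; apply: leq_trans Jj _; exact: ltnW (ltn_expl j B1).
have c84 : 0 <= 84 :> R by [].
have F := ae_filter_ringOfSetsType mu2.
apply: filterS (ae_difference (ae_avoid_balls w0 c84 sw)) => p [J avoid] k1 k2.
have z1 := circle_dist k1 k2.
pose J1 := maxn J0 J; exists (Num.truncn (X J1 `^ tau)).+1 => N NJ1.
have {}NJ1 : X J1 `^ tau <= N%:R.
  by rewrite ltW//; apply: lt_le_trans (truncnS_gt _) _; rewrite ler_nat.
have [j jP jmin] : exists2 j, N%:R < X j `^ tau & forall j', N%:R < X j' `^ tau -> (j <= j')%N.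
  have ex : exists j, N%:R < X j `^ tau.
    exists N; apply: (@lt_le_trans _ _ (X N)); first by rewrite ltr_nat ltn_expl.
    by have := X1 N => XN; rewrite -[leLHS]powRr1 ?ler_powR//; lra.
  by case: (ex_minnP ex) => j ? ?; exists j.
have J1j : (J1 < j)%N.
  rewrite ltnNge; apply/negP => jJ1; move: jP; rewrite ltNge => /negP; apply.
  apply: le_trans NJ1; apply: le_powR => //; first by have := X1 j; lra.
  by rewrite ler_nat leq_exp2l.
case: j jP jmin J1j => // j jP jmin; rewrite ltnS geq_max => /andP[J0j Jj].
have jN : X j `^ tau <= N%:R.
  by rewrite leNgt; apply/negP => /jmin; rewrite ltnn.
apply: edit_half; have [q0 qX pq fd] := fP j.
apply: (@le_trans _ _ (D * X j `^ (1 - omega))); last first.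
  apply: (AP _ _ _ _ _ _ (X1 j) (large j J0j) q0 pq qX fd z1 jN).
  have := avoid j Jj; rewrite /cs /w /close /n /q /l /l' (_ : 2 * (omega / 4) = omega / 2); last by lra.
  by case: ifP.
rewrite /D -mulrA ler_pM2l//.
have B1R : 1 <= B%:R :> R by rewrite ler1n.
have -> : B%:R `^ (tau * g) * X j `^ (1 - omega) = (X j.+1 `^ tau) `^ g.
  rewrite -powRrM XS powRM ?(le_trans ler01)//.
  by congr (_ * powR _ _); rewrite /omega; lra.
by apply: le_powR; rewrite // ltW.
Qed.

End DistanceEventually.

(** * The exponents of typical points *)

Section TypicalExponents.
Context {R : realType}.
Local Notation mu := (@lebesgue_measure R).
Local Notation mu2 := (mu \x mu)%E.
Implicit Types (alpha beta x y g r : R).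

Lemma ae_circle_ex (P : R * R -> Prop) :
  {ae mu2, forall p, circle p.1 -> circle p.2 -> P p} ->
  exists p, [/\ circle p.1, circle p.2 & P p].
Proof.
move=> aeP; apply: contrapT => no; have F := ae_filter_ringOfSetsType mu2.
(* If no point had the property, the torus would be null, and the zero function would have every [c]
   as its almost sure value. *)
have v (c : \bar R) : is_ae_value (fun _ _ : R => 0%E) c.
  apply: filterS aeP => p Pp c1 c2; exfalso; apply: no.
  by exists p; split=> //; exact: Pp.
have /eqP := is_ae_value_unique (v 0%E) (v 1%E).
by rewrite eqe eq_sym oner_eq0.
Qed.

Lemma word_distance_pos alpha beta N M x y : (N <= M)%N ->
  0 < word_distance alpha beta N x y -> 1 / 2 <= word_distance alpha beta M x y.
Proof.
move=> NM; rewrite /word_distance /edit_distance.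
have [E|e0] := posnP (edit_count (xi_word alpha beta M x) (xi_word alpha beta M y)).
  have := congr1 (take N) (edit_count_eq0 E).
  rewrite /xi_word -!map_take take_iota (minn_idPl NM) => ->.
  by rewrite edit_count_refl mul0r ltxx.
by move=> _; rewrite ler_pM2r// ler1n.
Qed.

(** Once two words differ, all longer ones do, so the distance is eventually at least [1 / 2] and
    [log1_ratio] has the right limits. The third conclusion is the whole lower bound for the limit
    inferior when [rho] is infinite. *)
Lemma GammaL_values alpha beta : irrational alpha ->
  {ae mu2, forall p, circle p.1 -> circle p.2 ->
     exists N, 0 < word_distance alpha beta N p.1 p.2} ->
  {ae mu2, forall p, circle p.1 -> circle p.2 ->
    [/\ GammaL_sup alpha beta =
          limn_esup (log_ratio (fun N => word_distance alpha beta N p.1 p.2)),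
        GammaL_inf alpha beta =
          limn_einf (log_ratio (fun N => word_distance alpha beta N p.1 p.2)) &
        0%E <= GammaL_inf alpha beta]%E}.
Proof.
move=> ia pos; have F := ae_filter_ringOfSetsType mu2.
have [cs [ci cP]] := log1_ratio_ae_constant beta ia.
have E : {ae mu2, forall p, circle p.1 -> circle p.2 ->
   [/\ limn_esup (log_ratio (fun N => word_distance alpha beta N p.1 p.2)) = cs,
       limn_einf (log_ratio (fun N => word_distance alpha beta N p.1 p.2)) = ci &
       0%E <= ci]%E}.
  apply: filterS2 pos cP => p posp [<- <-] c1 c2; have [N N0] := posp c1 c2.
  have [|-> ->] := @log_ratio_shift R (fun N => word_distance alpha beta N p.1 p.2).
    by exists N => n Nn; exact: word_distance_pos N0.
  split=> //; apply: limn_einf_ge_near; exists 1%N => n n1 /=.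
  rewrite lee_fin divr_ge0// ln_ge0 ?ler1n// lerDl.
  exact: word_distance_ge0.
have -> : GammaL_sup alpha beta = cs.
  by apply: ae_valueP; apply: filterS E => p Ep c1 c2; have [] := Ep c1 c2.
have -> : GammaL_inf alpha beta = ci.
  by apply: ae_valueP; apply: filterS E => p Ep c1 c2; have [] := Ep c1 c2.
by apply: filterS E => p Ep c1 c2; have [] := Ep c1 c2.
Qed.

Lemma log_ratio_mono (d d' : nat -> R) N : (1 < N)%N -> d N <= d' N ->
  (log_ratio d N <= log_ratio d' N)%E.
Proof.
move=> N1 dd'; have ln0 : 0 < ln N%:R :> R by rewrite ln_gt0// ltr1n.
have [d0|d0] := leP (d N) 0.
  by rewrite /log_ratio {1}/lne d0 inver gt_eqF// gt0_mulNye ?leNye// lte_fin invr_gt0.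
have d'0 := lt_le_trans d0 dd'.
by rewrite !log_ratioE// lee_fin ler_pM2r ?invr_gt0// ler_ln.
Qed.

Lemma word_distance_le_diameter alpha beta N x y : circle x -> circle y ->
  word_distance alpha beta N x y <= edit_diameter R (words alpha beta N).
Proof.
move=> cx cy; have [|v [w [_ _ -> max]]] := edit_diameter_max R (words_finite alpha beta N).
  by exists (xi_word alpha beta N x), x.
by apply: max; [exists x|exists y].
Qed.

Lemma GammaL_le_Gamma alpha beta : irrational alpha ->
  {ae mu2, forall p, circle p.1 -> circle p.2 ->
     exists N, 0 < word_distance alpha beta N p.1 p.2} ->
  (GammaL_sup alpha beta <= Gamma_sup alpha beta)%E /\
  (GammaL_inf alpha beta <= Gamma_inf alpha beta)%E.
Proof.
move=> ia pos; have [p [c1 c2 [-> -> _]]] := ae_circle_ex (GammaL_values ia pos).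
have le (e : R) : 0 < e -> exists N, forall n, (N <= n)%N ->
    (log_ratio (fun N => word_distance alpha beta N p.1 p.2) n <=
     log_ratio (fun N => edit_diameter R (words alpha beta N)) n + e%:E)%E.
  move=> e0; exists 2%N => n n2.
  apply: (@le_trans _ _ (log_ratio (fun N => edit_diameter R (words alpha beta N)) n)).
    by apply: log_ratio_mono => //; exact: word_distance_le_diameter.
  by rewrite leeDl// lee_fin ltW.
by split; [exact: limn_esup_le|exact: limn_einf_le].
Qed.

Lemma ereal_ge_approx (b : R) (c : \bar R) : 0 < b ->
  (forall g, 0 < g -> g < b -> (g%:E <= c)%E) -> (b%:E <= c)%E.
Proof.
move=> b0 gc; apply/lee_addgt0Pr => e e0; rewrite -leeBlDr// -EFinB.
apply: (@le_trans _ _ (Num.max (b - e) (b / 2))%:E); first by rewrite lee_fin le_max lexx.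
by apply: gc; rewrite ?lt_max ?gt_max; apply/orP || apply/andP; [right|split]; lra.
Qed.

(** The golden ratio enters as [r + 1 < r ^+ 2], or [r - 1 / r > 1]. This leaves room for
    [q * Q ^ kappa] below [Q] in the limit superior, and makes [1 + r - 1 / r] exceed 2 in the limit
    inferior. *)
Lemma golden_ratio_lt r : golden_ratio < r -> 3 / 2 < r /\ r + 1 < r ^+ 2.
Proof.
rewrite /golden_ratio => rg.
have s5 : Num.sqrt 5 ^+ 2 = 5 :> R by rewrite sqr_sqrtr.
have s50 : 0 <= Num.sqrt 5 :> R by exact: sqrtr_ge0.
have s52 : 2 < Num.sqrt 5 :> R by nra.
by split; nra.
Qed.

(** The exponent lies strictly between [1 + r1] and [1 + r2], so some large [q] satisfy
    [q ^ r1 <= Q <= q ^ r2 / c]. For [j < 2 * Q ^ kappa] the power [j ^ r2] is then of order at most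
    [q ^ (kappa * r2 ^ 2)], which is [o(q)], and the distance [c * j ^ (- r2)] exceeds [4 / q]. *)
Lemma exponent_sup_hypothesis alpha (kappa r1 r2 : R) : irrational alpha ->
  0 < kappa < 1 -> 0 < r1 -> 1 < r1 * (1 - kappa) -> 0 < r2 -> kappa * r2 ^+ 2 < 1 ->
  ((1 + r1)%:E < irrationality_exponent alpha)%E ->
  (irrationality_exponent alpha < (1 + r2)%:E)%E ->
  forall K, exists p q, let Q := `|q%:R * alpha - p%:~R|^-1 in
    [/\ (K < q)%N, coprimez p q%:Z, 0 < Q, q%:R `^ (r1 * (1 - kappa)) * Q `^ kappa <= Q &
      forall (j : nat) (m : int), (0 < j)%N -> j%:R < 2 * Q `^ kappa ->
        4 / q%:R <= `|j%:R * alpha - m%:~R|].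
Proof.
move=> ia /andP[k0 k1] r10 r1k r20 kr2 gt lt K.
have [c c0 cP] := exponent_lt_away ia (ltW r20) lt.
have e0 : 0 < 1 - kappa * r2 ^+ 2 by lra.
pose C := 4 / c * (2 `^ r2 * c^-1 `^ (kappa * r2)).
have [B BP] := powR_large C e0.
have [p [q [Kq q0 pq qd]]] := exponent_gt_approx (maxn K.+1 (Num.truncn B).+1) ia (ltW r10) gt.
move: Kq; rewrite geq_max => /andP[Kq Bq]; exists p, q => Q.
have q1 : 1 <= q%:R :> R by rewrite ler1n.
have q0R : 0 < q%:R :> R by lra.
have {}Bq : B <= q%:R by apply: ltW; apply: lt_le_trans (truncnS_gt _) _; rewrite ler_nat.
have d0 : 0 < `|q%:R * alpha - p%:~R| by rewrite normr_gt0 irrational_neq.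
have Q0 : 0 < Q by rewrite invr_gt0.
have Qr1 : q%:R `^ r1 <= Q.
  by rewrite -(invrK (_ `^ r1)) lef_pV2 ?posrE ?invr_gt0 ?powR_gt0// -powRN ltW.
have Qr2 : Q <= c^-1 * q%:R `^ r2.
  rewrite -(invrK (c^-1 * _)) lef_pV2 ?posrE ?invr_gt0 ?mulr_gt0 ?invr_gt0 ?powR_gt0//.
  by rewrite invfM invrK -powRN; exact: cP.
split=> //.
  have {2}-> : Q = Q `^ (1 - kappa) * Q `^ kappa by rewrite -gt0_powRD// subrK powRr1// ltW.
  rewrite ler_pM2r ?powR_gt0// powRrM; apply: le_powR => //; lra.
move=> j m j0 jQ; apply: le_trans (cP j m j0).
have j0R : 0 < j%:R :> R by rewrite ltr0n.
rewrite powRN ler_pdivlMr ?powR_gt0// mulrAC ler_pdivrMr//.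
have jr : j%:R `^ r2 <= 2 `^ r2 * (c^-1 `^ (kappa * r2) * q%:R `^ (kappa * r2 ^+ 2)).
  apply: (@le_trans _ _ ((2 * Q `^ kappa) `^ r2)).
    by apply: le_powR; rewrite ?ltW.
  rewrite powRM ?powR_ge0// ler_pM2l ?powR_gt0// -powRrM.
  apply: (@le_trans _ _ ((c^-1 * q%:R `^ r2) `^ (kappa * r2))).
    by apply: le_powR => //; rewrite ?ltW ?mulr_gt0.
  rewrite powRM ?powR_ge0 ?invr_ge0 ?(ltW c0)// -powRrM.
  by rewrite (_ : r2 * (kappa * r2) = kappa * r2 ^+ 2)//; ring.
have qE : q%:R = q%:R `^ (1 - kappa * r2 ^+ 2) * q%:R `^ (kappa * r2 ^+ 2) :> R.
  by rewrite -gt0_powRD// subrK powRr1// ltW.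
apply: (@le_trans _ _ (c * (C * q%:R `^ (kappa * r2 ^+ 2)))).
  have -> : c * (C * q%:R `^ (kappa * r2 ^+ 2)) =
      4 * (2 `^ r2 * (c^-1 `^ (kappa * r2) * q%:R `^ (kappa * r2 ^+ 2))).
    by rewrite /C; field; rewrite gt_eqF.
  by rewrite ler_pM2l.
by rewrite ler_pM2l// {2}qE ler_pM2r ?powR_gt0// BP.
Qed.

Lemma ae_often_finite alpha beta r g : irrational alpha -> 0 < beta < 1 ->
  golden_ratio < r -> irrationality_exponent alpha = (1 + r)%:E ->
  0 < g -> g < r ^+ 2 / (2 * r ^+ 2 - 1) ->
  {ae mu2, forall p, circle p.1 -> circle p.2 -> forall N0, exists2 N, (N0 <= N)%N &
    N%:R `^ g <= word_distance alpha beta N p.1 p.2}.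
Proof.
move=> ia b01 /golden_ratio_lt[r32 r2] irr g0 gr.
have r0 : 0 < r by lra.
have rr0 : 0 < r ^+ 2 by rewrite exprn_gt0.
have gV : 2 - (r ^+ 2)^-1 < g^-1.
  have -> : 2 - (r ^+ 2)^-1 = (r ^+ 2 / (2 * r ^+ 2 - 1))^-1 by field; lra.
  rewrite ltf_pV2 ?posrE// divr_gt0//; lra.
(* [kappa] must exceed [2 - 1 / g] to give [g * (2 - kappa) < 1], and stay below [1 / r ^ 2] for the
   separation of multiples. *)
pose k0 := Num.max 0 (2 - g^-1).
have k0r : k0 < (r ^+ 2)^-1 by rewrite gt_max invr_gt0 rr0; lra.
have [k00 k0g] : 0 <= k0 /\ 2 - g^-1 <= k0 by rewrite !le_max !lexx orbT.
pose kappa := (k0 + (r ^+ 2)^-1) / 2.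
have rV1 : (r ^+ 2)^-1 < 1 by rewrite invf_lt1//; nra.
have kp : 0 < kappa < 1 by rewrite /kappa; lra.
have kr : kappa * r ^+ 2 < 1.
  by rewrite -ltr_pdivlMr// div1r /kappa; lra.
have gk : g * (2 - kappa) < 1.
  by rewrite mulrC -ltr_pdivlMr// div1r /kappa; lra.
(* As [kappa] and [e] are below 1, [kappa * (r + e) ^ 2] is less than
   [kappa * r ^ 2 + e * (2 * r + 2) = 1]. *)
pose e := (1 - kappa * r ^+ 2) / (2 * r + 2); pose r' := r + e.
have e0 : 0 < e by rewrite divr_gt0; lra.
have e1 : e < 1 by rewrite ltr_pdivrMr; [nra|lra].
have eE : e * (2 * r + 2) = 1 - kappa * r ^+ 2 by rewrite /e divfK//; lra.
have kr' : kappa * r' ^+ 2 < 1 by rewrite /r' !expr2 in eE *; nra.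
have rk : 1 < r * (1 - kappa).
  have : kappa < (r ^+ 2)^-1 by rewrite /kappa; lra.
  have : r * (r ^+ 2)^-1 = r^-1 by field; lra.
  have : r * r^-1 = 1 by rewrite divff//; lra.
  rewrite expr2 in r2 *; nra.
pose r1 := (r + (1 - kappa)^-1) / 2.
have k1 : 0 < 1 - kappa by lra.
have k1V : (1 - kappa)^-1 < r by rewrite -div1r ltr_pdivrMr.
have k1V0 : 0 < (1 - kappa)^-1 by rewrite invr_gt0.
have r1r : r1 < r by rewrite /r1; lra.
have r1k : 1 < r1 * (1 - kappa).
  by rewrite -ltr_pdivrMr// div1r /r1; lra.
have := @exponent_sup_hypothesis alpha kappa r1 r' ia kp.
rewrite irr !lte_fin => hyp.
have {}hyp := hyp ltac:(rewrite /r1; lra) r1k ltac:(rewrite /r'; lra) kr' ltac:(lra) ltac:(rewrite /r'; lra).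
apply: (@ae_word_distance_often R alpha beta kappa (r1 * (1 - kappa) - 1) g) => //.
- by lra.
- by lra.
- move=> K; have [p [q h]] := hyp K; exists p, q; move: h => /=.
  by rewrite (_ : 1 + (r1 * (1 - kappa) - 1) = r1 * (1 - kappa))//; lra.
Qed.

(** With [kappa = 0] only [j = 1] has to be separated, and the condition on [g] becomes
    [2 * g < 1]. *)
Lemma ae_often_infinite alpha beta g : irrational alpha -> 0 < beta < 1 ->
  irrationality_exponent alpha = +oo%E -> 0 < g -> g < 1 / 2 ->
  {ae mu2, forall p, circle p.1 -> circle p.2 -> forall N0, exists2 N, (N0 <= N)%N &
    N%:R `^ g <= word_distance alpha beta N p.1 p.2}.
Proof.
move=> ia b01 irr g0 g12.
apply: (@ae_word_distance_often R alpha beta 0 1 g) => //.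
- by rewrite lexx ltr01.
- by lra.
- move=> K; have [c c0 cP] := irrational_away 2 ia.
  have [||p [q [Kq q0 pq qd]]] := @exponent_gt_approx R alpha 2 (maxn K.+1 (Num.truncn (4 / c)).+1) ia.
  + by [].
  + by rewrite irr ltry.
  move: Kq; rewrite geq_max => /andP[Kq cq]; exists p, q => Q.
  have q0R : 0 < q%:R :> R by rewrite ltr0n.
  have d0 : 0 < `|q%:R * alpha - p%:~R| by rewrite normr_gt0 irrational_neq.
  have Q0 : 0 < Q by rewrite invr_gt0.
  split=> //.
    rewrite powRr0 mulr1 -(invrK (_ `^ _)) lef_pV2 ?posrE ?invr_gt0 ?powR_gt0// -powRN.
    by apply: le_trans (ltW qd) _; rewrite (_ : - (1 + 1) = - 2).
  move=> j m j0; rewrite powRr0 mulr1 => j2.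
  have {}j2 : (j < 2)%N by rewrite -(ltr_nat R).
  apply: le_trans (cP j m _); last by rewrite j0.
  rewrite ler_pdivrMr// mulrC -ler_pdivrMr// ltW//.
  by apply: lt_le_trans (truncnS_gt _) _; rewrite ler_nat.
Qed.

Lemma ae_often_pos alpha beta g : 0 < g ->
  {ae mu2, forall p, circle p.1 -> circle p.2 -> forall N0, exists2 N, (N0 <= N)%N &
    N%:R `^ g <= word_distance alpha beta N p.1 p.2} ->
  {ae mu2, forall p, circle p.1 -> circle p.2 ->
     exists N, 0 < word_distance alpha beta N p.1 p.2}.
Proof.
move=> g0; have F := ae_filter_ringOfSetsType mu2.
apply: filterS => p H c1 c2; have [N N1 le] := H c1 c2 1%N; exists N.
by apply: lt_le_trans le; rewrite powR_gt0// ltr0n.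
Qed.

Lemma GammaL_sup_ge alpha beta g : irrational alpha -> 0 < g ->
  {ae mu2, forall p, circle p.1 -> circle p.2 -> forall N0, exists2 N, (N0 <= N)%N &
    N%:R `^ g <= word_distance alpha beta N p.1 p.2} ->
  (g%:E <= GammaL_sup alpha beta)%E.
Proof.
move=> ia g0 often; have F := ae_filter_ringOfSetsType mu2.
have val := GammaL_values ia (ae_often_pos g0 often).
have [|p [c1 c2 [H ->]]] := @ae_circle_ex (fun p =>
  (forall N0, exists2 N, (N0 <= N)%N &
    N%:R `^ g <= word_distance alpha beta N p.1 p.2) /\
  GammaL_sup alpha beta = limn_esup (log_ratio (fun N => word_distance alpha beta N p.1 p.2))).
  apply: filterS2 often val => p o v c1 c2; split; first exact: o.
  by have [] := v c1 c2.
apply: limn_esup_ge_often => N0; have [N N0N le] := H (maxn N0 2).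
move: N0N; rewrite geq_max => /andP[N0N N2].
by exists N => //; exact: log_ratio_ge.
Qed.

Lemma GammaL_inf_ge alpha beta g : irrational alpha ->
  {ae mu2, forall p, circle p.1 -> circle p.2 ->
     exists N, 0 < word_distance alpha beta N p.1 p.2} ->
  {ae mu2, forall p, circle p.1 -> circle p.2 -> exists N0, forall N, (N0 <= N)%N ->
    N%:R `^ g <= word_distance alpha beta N p.1 p.2} ->
  (g%:E <= GammaL_inf alpha beta)%E.
Proof.
move=> ia pos ev; have F := ae_filter_ringOfSetsType mu2.
have val := GammaL_values ia pos.
have [|p [c1 c2 [[N0 H] ->]]] := @ae_circle_ex (fun p =>
  (exists N0, forall N, (N0 <= N)%N ->
    N%:R `^ g <= word_distance alpha beta N p.1 p.2) /\
  GammaL_inf alpha beta = limn_einf (log_ratio (fun N => word_distance alpha beta N p.1 p.2))).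
  apply: filterS2 ev val => p o v c1 c2; split; first exact: o.
  by have [] := v c1 c2.
apply: limn_einf_ge_near; exists (maxn N0 2) => N; rewrite geq_max => /andP[N0N N2].
exact: log_ratio_ge (H _ N0N).
Qed.

Lemma ae_eventually_finite alpha beta r g : irrational alpha -> 0 < beta < 1 ->
  golden_ratio < r -> irrationality_exponent alpha = (1 + r)%:E ->
  0 < g -> g < r / (r ^+ 2 + r - 1) ->
  {ae mu2, forall p, circle p.1 -> circle p.2 -> exists N0, forall N, (N0 <= N)%N ->
    N%:R `^ g <= word_distance alpha beta N p.1 p.2}.
Proof.
move=> ia b01 /golden_ratio_lt[r32 r2] irr g0 gr.
have r0 : 0 < r by lra.
have gV : 1 + r - r^-1 < g^-1.
  have -> : 1 + r - r^-1 = (r / (r ^+ 2 + r - 1))^-1 by field; lra.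
  by rewrite ltf_pV2 ?posrE// divr_gt0//; lra.
have g2 : 2 * g < 1.
  have h : g * (r ^+ 2 + r - 1) < r by rewrite -ltr_pdivlMr//; lra.
  have : g * (2 * r) <= g * (r ^+ 2 + r - 1) by rewrite ler_pM2l//; lra.
  nra.
(* Replacing [r] by [r + e] raises [1 + r - 1 / r] by at most [2 * e], which is less than the gap
   [3 * e]. *)
pose e := (g^-1 - (1 + r - r^-1)) / 3; pose r' := r + e.
have e0 : 0 < e by rewrite divr_gt0; lra.
have [c c0 cP] := @exponent_lt_away R alpha r' ia ltac:(rewrite /r'; lra)
  ltac:(by rewrite irr lte_fin /r'; lra).
apply: (@ae_word_distance_eventually R alpha beta c r' g) => //.
- by rewrite /r'; lra.
- rewrite mulrC -ltr_pdivlMr// div1r.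
  have r'V : r^-1 - e <= r'^-1.
    have r'0 : 0 < r' by rewrite /r'; lra.
    have -> : r'^-1 = r^-1 - e / (r * r') by rewrite /r'; field; rewrite /r' in r'0; lra.
    rewrite lerB// ler_pdivrMr ?mulr_gt0//.
    by rewrite /r'; nra.
  have gE : g^-1 = 3 * e + (1 + r - r^-1) by rewrite /e; lra.
  have r'E : r' = r + e by [].
  by lra.
Qed.

Theorem typical_exponents_ge alpha : irrational alpha ->
  let rho := (irrationality_exponent alpha - 1)%E in
  (golden_ratio%:E < rho)%E ->
  forall beta, 0 < beta < 1 ->
    [/\ (GammaL_sup alpha beta <= Gamma_sup alpha beta)%E,
        (sup_bound rho <= GammaL_sup alpha beta)%E,
        (GammaL_inf alpha beta <= Gamma_inf alpha beta)%E
      & (inf_bound rho <= GammaL_inf alpha beta)%E].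
Proof.
move=> ia rho; rewrite /rho.
case irr : (irrationality_exponent alpha) => [m| |] //= rg beta b01.
  rewrite lte_fin in rg; set r := m - 1 in rg *.
  have {}irr : irrationality_exponent alpha = (1 + r)%:E by rewrite irr /r addrC subrK.
  have [r32 r2] := golden_ratio_lt rg.
  have s0 : 0 < r ^+ 2 / (2 * r ^+ 2 - 1) by rewrite divr_gt0; lra.
  have i0 : 0 < r / (r ^+ 2 + r - 1) by rewrite divr_gt0; lra.
  have often := ae_often_finite ia b01 rg irr.
  have half0 : 0 < r ^+ 2 / (2 * r ^+ 2 - 1) / 2 by lra.
  have half : r ^+ 2 / (2 * r ^+ 2 - 1) / 2 < r ^+ 2 / (2 * r ^+ 2 - 1) by lra.
  have pos := ae_often_pos half0 (often _ half0 half).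
  have [le1 le2] := GammaL_le_Gamma ia pos.
  split=> //.
    by apply: ereal_ge_approx => // g g0 gr; apply: GammaL_sup_ge => //; exact: often.
  apply: ereal_ge_approx => // g g0 gr; apply: GammaL_inf_ge => //.
  exact: ae_eventually_finite rg irr g0 gr.
have often := ae_often_infinite ia b01 irr.
have q0 : 0 < 1 / 4 :> R by lra.
have q2 : 1 / 4 < 1 / 2 :> R by lra.
have pos := ae_often_pos q0 (often _ q0 q2).
have [le1 le2] := GammaL_le_Gamma ia pos.
split=> //.
  by apply: ereal_ge_approx => [|g g0 gr]; [lra|apply: GammaL_sup_ge => //; exact: often].
by have [p [c1 c2 [_ _]]] := ae_circle_ex (GammaL_values ia pos).
Qed.

End TypicalExponents.

(** * Upper bounds near rational rotations *)

Section UpperBound.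
Context {R : realType}.
Implicit Types (alpha beta x y u : R) (p m G : int) (q s B N n t : nat).

Lemma edit_count_concat (T : eqType) (f g : nat -> T) n c N : (0 < n)%N ->
  (forall i m : nat, (m <= n)%N -> edit_count (subword f i m) (subword g i m) <= c)%N ->
  (edit_count (subword f 0 N) (subword g 0 N) <= (N %/ n).+1 * c)%N.
Proof.
move=> n0 H; have W k : (edit_count (subword f 0 (k * n)) (subword g 0 (k * n)) <= k * c)%N.
  elim: k => [|k ih]; first by rewrite !mul0n edit_count_refl.
  rewrite !mulSnr !subword_cat; apply: leq_trans (edit_count_cat _ _ _ _) _.
  by rewrite leq_add// H.
rewrite {1 2}(divn_eq N n) !subword_cat mulSnr.
apply: leq_trans (edit_count_cat _ _ _ _) _; rewrite leq_add ?W// H//.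
by rewrite ltnW// ltn_pmod.
Qed.

Definition rational_code p q B G t : bool := ((G + t%:Z * p) %% q%:Z)%Z < B%:Z.

Lemma rational_code_shift p q B G s t (e : int) : (s%:Z * p = e %[mod q%:Z])%Z ->
  rational_code p q B (G + e) t = rational_code p q B G (t + s).
Proof.
move=> se; rewrite /rational_code; congr (_ < _).
rewrite PoszD mulrDl [in RHS]addrA -[RHS]modzDmr se modzDmr.
by congr (_ %% _)%Z; ring.
Qed.

Lemma rational_code_period p q B G m t :
  rational_code p q B (G + m * q%:Z) t = rational_code p q B G t.
Proof.
rewrite /rational_code; congr (_ < _).
have -> : G + m * q%:Z + t%:Z * p = m * q%:Z + (G + t%:Z * p) by ring.
by rewrite modzMDl.
Qed.

Lemma rational_code_edit p q B G s i n (k : nat) :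
  (s%:Z * p = 1 %[mod q%:Z])%Z \/ (s%:Z * p = -1 %[mod q%:Z])%Z ->
  (edit_count (subword (rational_code p q B (G + k%:Z)) i n)
              (subword (rational_code p q B G) i n) <= 2 * s * k)%N.
Proof.
move=> sp; elim: k G => [|k ih] G; first by rewrite addr0 edit_count_refl.
apply: leq_trans (edit_count_triangle _ (subword (rational_code p q B (G + 1)) i n) _) _.
rewrite mulnS addnC leq_add//.
  case: sp => sp.
    rewrite (@eq_subword _ _ (rational_code p q B G) i (i + s) n).
      by rewrite edit_countC edit_count_shift.
    by move=> t _; rewrite (rational_code_shift _ _ _ sp) addnAC.
  rewrite (@eq_subword _ (rational_code p q B G) (rational_code p q B (G + 1)) i (i + s) n).
    exact: edit_count_shift.
  by move=> t _; rewrite -{1}(addrK 1 G) (rational_code_shift _ _ _ sp) addnAC.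
by rewrite -add1n PoszD addrA; exact: ih.
Qed.

(** The identity is exact: writing [q * (u + t * alpha)] as an integer plus a remainder in [[0, 1)],
    comparison with the integer [B] sees only the integer part. All deviation from the rational
    rotation is in the slowly moving floor. *)
Lemma rational_coding alpha p q B u t : (0 < q)%N ->
  in_arc (B%:R / q%:R) (u + t%:R * alpha) =
  rational_code p q B (Num.floor (q%:R * u + t%:R * (q%:R * alpha - p%:~R))) t.
Proof.
move=> q0; have q0R : 0 < q%:R :> R by rewrite ltr0n.
set v := q%:R * u + _; set G := Num.floor v.
have [G1 G2] : G%:~R <= v /\ v < G%:~R + 1.
  by have /andP[] := floor_itv v; rewrite intrD.
rewrite /rational_code; set a := G + _.
have aE := divz_eq a q%:Z; set d := (a %/ q%:Z)%Z in aE; set r := (a %% q%:Z)%Z in aE *.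
have r0 : 0 <= r by rewrite modz_ge0//; lia.
have rq : r < q%:Z by rewrite ltz_pmod//; lia.
pose phi := v - G%:~R; have [ph0 ph1] : 0 <= phi /\ phi < 1 by rewrite /phi; lra.
have E : u + t%:R * alpha = (r%:~R + phi) / q%:R + d%:~R.
  have : a%:~R = d%:~R * q%:R + r%:~R :> R by rewrite aE intrD intrM.
  rewrite /a intrD intrM /= => h.
  have -> : r%:~R = G%:~R + t%:R * p%:~R - d%:~R * q%:R :> R by lra.
  by rewrite /phi /v; field; rewrite gt_eqF.
have r0' : 0 <= r%:~R :> R by rewrite ler0z.
have rq' : r%:~R + 1 <= q%:R :> R.
  by rewrite -[q%:R]/(q%:Z%:~R) -[X in _ + X]/(1%:~R) -intrD ler_int; lia.
rewrite E in_arcDZ /in_arc mod1_id; last first.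
  apply/andP; split; first by rewrite divr_ge0//; lra.
  by rewrite ltr_pdivrMr//; lra.
rewrite in_itv /= divr_ge0 ?ltr_pM2r ?invr_gt0//=; last by lra.
apply/idP/idP => [h|h]; first by rewrite -(ltr_int R); apply: le_lt_trans h; lra.
have : r%:~R + 1 <= B%:R :> R.
  by rewrite -[B%:R]/(B%:Z%:~R) -[X in _ + X]/(1%:~R) -intrD ler_int; lia.
by lra.
Qed.

Lemma floor_drift (v sigma : R) n : n%:R * `|sigma| <= 1 ->
  exists t0 (e : bool), forall t, (t < n)%N ->
    Num.floor (v + t%:R * sigma) =
    if (t < t0)%N then Num.floor v
    else if e then Num.floor v + 1 else Num.floor v - 1.
Proof.
move=> ns; set G := Num.floor v.
have [G1 G2] : G%:~R <= v /\ v < G%:~R + 1.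
  by have /andP[] := floor_itv v; rewrite intrD.
have tn t : (t < n)%N -> 0 <= t%:R * `|sigma| /\ (0 < `|sigma| -> t%:R * `|sigma| < 1).
  move=> tn; rewrite mulr_ge0//; split=> // s0; apply: lt_le_trans ns.
  by rewrite ltr_pM2r// ltr_nat.
have fl (w : R) (k : int) : k%:~R <= w -> w < k%:~R + 1 -> Num.floor w = k.
  by move=> w1 w2; apply: floor_def; rewrite w1 intrD.
(* The disjunct [n <= t] provides a least [t0] even when the floor never changes. *)
pose P t := (n <= t)%N || (Num.floor (v + t%:R * sigma) != G).
have exP : exists t, P t by exists n; rewrite /P leqnn.
case: (ex_minnP exP) => t0 Pt0 mint0.
exists t0, (0 <= sigma) => t ltn.
case: ifPn => [tt0|]; first by apply/eqP; apply: contraLR tt0 => h; rewrite -leqNgt mint0// /P h orbT.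
rewrite -leqNgt => t0t; have {Pt0} : Num.floor (v + t0%:R * sigma) != G.
  by move: Pt0; rewrite /P leqNgt (leq_ltn_trans t0t ltn).
have [m1 m2] := tn t ltn.
have t0R : t0%:R * `|sigma| <= t%:R * `|sigma| by rewrite ler_wpM2r// ler_nat.
have t00 : 0 <= t0%:R * `|sigma| by rewrite mulr_ge0.
have [s0|s0] := leP 0 sigma.
  rewrite ger0_norm// in m1 m2 t0R t00 *.
  have [lt|ge] := ltP (v + t0%:R * sigma) (G%:~R + 1).
    by rewrite (fl _ G) ?eqxx//; lra.
  move=> _; apply: fl; rewrite intrD mulr1z; first by lra.
  have : 0 < sigma by rewrite lt_neqAle s0 andbT; apply/eqP => z; move: ge; rewrite -z mulr0; lra.
  by move=> /m2; lra.
rewrite ltr0_norm// in m1 m2 t0R t00 *; have {}m2 := m2 ltac:(lra).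
have [lt|ge] := ltP (v + t0%:R * sigma) G%:~R; last by rewrite (fl _ G) ?eqxx//; lra.
by move=> _; apply: fl; rewrite intrB mulr1z; lra.
Qed.

Lemma rational_window alpha p q B s u n : (0 < q)%N ->
  n%:R * `|q%:R * alpha - p%:~R| <= 1 ->
  (s%:Z * p = 1 %[mod q%:Z])%Z \/ (s%:Z * p = -1 %[mod q%:Z])%Z ->
  (edit_count (subword (fun t => in_arc (B%:R / q%:R) (u + t%:R * alpha)) 0 n)
     (subword (rational_code p q B (Num.floor (q%:R * u))) 0 n) <= 2 * s)%N.
Proof.
move=> q0 ns sp; have [t0 [e E]] := floor_drift (q%:R * u) ns.
set G := Num.floor (q%:R * u) in E *.
have near i k : (edit_count (subword (rational_code p q B (if e then G + 1 else G - 1)%R) i k)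
    (subword (rational_code p q B G) i k) <= 2 * s)%N.
  case: e {E}; first by have := rational_code_edit B G i k 1 sp; rewrite muln1.
  rewrite edit_countC; have := rational_code_edit B (G - 1) i k 1 sp.
  by rewrite muln1 subrK.
pose k := minn t0 n; have kn : (k <= n)%N by rewrite geq_minr.
rewrite -(subnKC kn) !subword_cat add0n.
apply: leq_trans (edit_count_cat _ _ _ _) _.
rewrite (@eq_subword _ _ (rational_code p q B G) 0 0 k); last first.
  move=> t tk; rewrite add0n (rational_coding _ p)// E; last by apply: leq_trans kn.
  by rewrite (leq_trans tk)// geq_minl.
rewrite edit_count_refl add0n.
rewrite (@eq_subword _ _ (rational_code p q B (if e then G + 1 else G - 1)%R) k k (n - k)); last first.
  move=> t tk; rewrite (rational_coding _ p)// E; last by lia.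
  have -> : (k + t < t0)%N = false by rewrite /k in tk *; lia.
  by case: e {E near}.
exact: near.
Qed.

Lemma in_arc_differ beta beta' u : in_arc beta u != in_arc beta' u ->
  Num.min beta beta' <= mod1 u < Num.max beta beta'.
Proof.
have /andP[m0 _] := mod1_itv u.
rewrite /in_arc !in_itv/= m0 /= ge_min lt_max.
by case: (ltP (mod1 u) beta); case: (ltP (mod1 u) beta') => //= *; rewrite ?orbT ?andbT.
Qed.

(* Two visits to an arc of length [4 * delta] within [1 / (2 * delta)] steps
   happen at times that differ by at most [4 * q]. *)
Lemma arc_differ_count alpha p q beta beta' u n : (0 < q)%N -> coprimez p q ->
  let delta := `|q%:R * alpha - p%:~R| in
  0 < delta -> 2 * n%:R * delta <= 1 -> 8 * q%:R * delta < 1 ->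
  `|beta - beta'| <= 4 * delta ->
  (count (fun t => in_arc beta (u + t%:R * alpha) != in_arc beta' (u + t%:R * alpha))
     (iota 0 n) <= 5)%N.
Proof.
move=> q0 pq /= d0 nd qd bb; set delta := `|_| in d0 nd qd bb.
have q0R : 0 < q%:R :> R by rewrite ltr0n.
set P := fun t => _; rewrite -size_filter; set F := [seq t <- iota 0 n | P t].
case E : F => [//|t0 l]; rewrite -E.
have Fs : sorted ltn F by rewrite sorted_filter ?iota_ltn_sorted//; exact: ltn_trans.
have mF t : t \in F -> P t && (t < n)%N by rewrite mem_filter mem_iota.
apply: (@leq_trans (size [seq t0 + c * q | c <- iota 0 5]))%N; last by rewrite size_map.
apply: uniq_leq_size; first by rewrite filter_uniq ?iota_uniq.
move=> t tF; have /andP[Pt tn] := mF t tF.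
have /andP[Pt0 t0n] : P t0 && (t0 < n)%N by apply: mF; rewrite E mem_head.
have t0t : (t0 <= t)%N.
  move: tF Fs; rewrite E inE => /orP[/eqP ->//|tl] /=.
  rewrite path_sortedE; last exact: ltn_trans.
  by move=> /andP[/allP/(_ t tl)/ltnW].
have m1 := in_arc_differ Pt; have m0 := in_arc_differ Pt0.
pose d := (t - t0)%N; pose a : int := d%:Z * p -
  (Num.floor (u + t%:R * alpha) - Num.floor (u + t0%:R * alpha)) * q%:Z.
have dR : d%:R = t%:R - t0%:R :> R by rewrite /d natrB.
have da : `|a%:~R + d%:R * (q%:R * alpha - p%:~R)| < q%:R * (4 * delta).
  have -> : a%:~R + d%:R * (q%:R * alpha - p%:~R) =
      q%:R * (mod1 (u + t%:R * alpha) - mod1 (u + t0%:R * alpha)).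
    have -> : a%:~R = d%:R * p%:~R - ((Num.floor (u + t%:R * alpha))%:~R -
        (Num.floor (u + t0%:R * alpha))%:~R) * q%:R :> R.
      by rewrite /a intrB !intrM intrB.
    by rewrite dR /mod1; ring.
  rewrite normrM gtr0_norm// ltr_pM2l//; apply: lt_le_trans bb.
  move: m1 m0; set v1 := mod1 _; set v0 := mod1 _.
  case: (leP beta beta') => h /andP[? ?] /andP[? ?]; rewrite ltr_norml.
    by rewrite distrC ger0_norm ?subr_ge0//; apply/andP; split; lra.
  by rewrite ger0_norm ?subr_ge0 ?(ltW h)//; apply/andP; split; lra.
have dn : 2 * (d%:R * delta) <= 1.
  by apply: le_trans nd; rewrite -mulrA ler_pM2l// ler_pM2r// ler_nat (leq_trans (leq_subr _ _) (ltnW tn)).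
have nda : `|d%:R * (q%:R * alpha - p%:~R)| = d%:R * delta by rewrite normrM ger0_norm.
(* Both contributions are small: [q * (4 * delta) < 1 / 2] from the arc and [d * delta <= 1 / 2]
   from the drift, so the integer [a] has absolute value below 1. *)
have a0 : a = 0.
  apply/eqP; apply: contraT => a0.
  have : 1 <= `|a%:~R| :> R by rewrite -intr_norm ler1z -gtz0_ge1 normr_gt0.
  have -> : a%:~R = (a%:~R + d%:R * (q%:R * alpha - p%:~R)) - d%:R * (q%:R * alpha - p%:~R).
    by ring.
  move=> /le_trans/(_ (ler_normB _ _)); rewrite nda => h; exfalso; lra.
have /dvdnP[c cE] : (q %| d)%N.
  have : (q%:Z %| d%:Z * p)%Z.
    apply/dvdzP; exists (Num.floor (u + t%:R * alpha) - Num.floor (u + t0%:R * alpha)).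
    by move: a0; rewrite /a => /eqP; rewrite subr_eq0 => /eqP.
  by rewrite Gauss_dvdzl 1?coprimez_sym.
move: da; rewrite a0 add0r nda cE natrM mulrAC mulrC ltr_pM2l// ltr_pM2r// ltr_nat => c4.
apply/mapP; exists c; first by rewrite mem_iota (ltn_trans c4).
by rewrite -cE /d subnKC.
Qed.

(** The 10 pays for five letters on which [beta] and [B / q] disagree, and [2 * s] for the single
    integer that the floor may cross. *)
Lemma coding_window alpha p q B s beta u n (k : nat) : (0 < q)%N -> coprimez p q ->
  let delta := `|q%:R * alpha - p%:~R| in
  0 < delta -> 2 * n%:R * delta <= 1 -> 8 * q%:R * delta < 1 ->
  `|beta - B%:R / q%:R| <= 4 * delta ->
  (s%:Z * p = 1 %[mod q%:Z])%Z \/ (s%:Z * p = -1 %[mod q%:Z])%Z ->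
  (k <= n)%N ->
  (edit_count (subword (fun t => in_arc beta (u + t%:R * alpha)) 0 k)
     (subword (rational_code p q B (Num.floor (q%:R * u))) 0 k) <= 10 + 2 * s)%N.
Proof.
move=> q0 pq /= d0 nd qd bb sp kn.
have kd : 2 * k%:R * `|q%:R * alpha - p%:~R| <= 1.
  by apply: le_trans nd; rewrite ler_pM2r// ler_pM2l// ler_nat.
apply: leq_trans (edit_count_triangle _
  (subword (fun t => in_arc (B%:R / q%:R) (u + t%:R * alpha)) 0 k) _) _.
apply: leq_add.
  apply: leq_trans (edit_count_hamming _ _ _ _) _.
  by rewrite (_ : 10 = 2 * 5)%N// leq_mul2l (@arc_differ_count alpha p q).
apply: rational_window => //; apply: le_trans kd.
by rewrite ler_pM2r// ler_peMl// ler1n.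
Qed.

(** Each word is compared with its rational code for [10 + 2 * s]. The two initial residues differ
    by at most 2 modulo [q], which costs another [4 * s]. *)
Lemma close_words_edit alpha p q B s beta x y n N : (0 < q)%N -> coprimez p q ->
  let delta := `|q%:R * alpha - p%:~R| in
  0 < delta -> (0 < n)%N -> 2 * n%:R * delta <= 1 -> 8 * q%:R * delta < 1 ->
  `|beta - B%:R / q%:R| <= 4 * delta ->
  (s%:Z * p = 1 %[mod q%:Z])%Z \/ (s%:Z * p = -1 %[mod q%:Z])%Z ->
  (exists m, y < x - m%:~R < y + 2 / q%:R) ->
  (edit_count (xi_word alpha beta N x) (xi_word alpha beta N y) <=
    (N %/ n).+1 * (20 + 8 * s))%N.
Proof.
move=> q0 pq /= d0 n0 nd qd bb sp [m xy]; rewrite !xi_word_subword.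
have q0R : 0 < q%:R :> R by rewrite ltr0n.
apply: edit_count_concat => // i k kn.
pose u := x + i%:R * alpha; pose w := y + i%:R * alpha.
have sw z : subword (fun t => in_arc beta (z + t%:R * alpha)) i k =
    subword (fun t => in_arc beta (z + i%:R * alpha + t%:R * alpha)) 0 k.
  by apply: eq_subword => t _; rewrite natrD mulrDl addrA.
rewrite !sw -/u -/w.
have C v := @coding_window alpha p q B s beta v n k q0 pq d0 nd qd bb sp kn.
have [c [c2 E]] : exists c : nat, (c <= 2)%N /\
    Num.floor (q%:R * u) = Num.floor (q%:R * w) + c%:Z + m * q%:Z.
  have h : q%:R * w < q%:R * (u - m%:~R) < q%:R * w + 2.
    rewrite ltr_pM2l// (_ : 2 = q%:R * (2 / q%:R) :> R); last by field; rewrite gt_eqF.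
    by rewrite -mulrDr ltr_pM2l// /u /w; move: xy => /andP[a b]; apply/andP; split; lra.
  have := floor_itv (q%:R * u); have := floor_itv (q%:R * w).
  set a := Num.floor (q%:R * u); set b := Num.floor (q%:R * w).
  rewrite !intrD mulr1z => /andP[b1 b2] /andP[a1 a2].
  have [l1 l2] : (b%:~R - 1 : R) < (a - m * q%:Z)%:~R /\ ((a - m * q%:Z)%:~R : R) < b%:~R + 3.
    rewrite intrB intrM /=; move: h; rewrite mulrBr => /andP[h1 h2].
    by split; lra.
  have l1' : b - 1 < a - m * q%:Z by rewrite -(ltr_int R); apply: le_lt_trans l1; rewrite intrB.
  have l2' : a - m * q%:Z < b + 3%:Z by rewrite -(ltr_int R); apply: lt_le_trans l2 _; rewrite intrD.
  by exists (absz (a - m * q%:Z - b)%R); move: l1' l2'; clear; lia.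
have M : (edit_count (subword (rational_code p q B (Num.floor (q%:R * u))) 0 k)
    (subword (rational_code p q B (Num.floor (q%:R * w))) 0 k) <= 4 * s)%N.
  rewrite E (@eq_subword _ _ (rational_code p q B (Num.floor (q%:R * w) + c%:Z)) 0 0 k); last first.
    by move=> t _; rewrite rational_code_period.
  apply: leq_trans (rational_code_edit _ _ _ _ _ sp) _.
  by move: c2; clear; nia.
have Cw := C w; rewrite edit_countC in Cw.
apply: (@leq_trans ((10 + 2 * s) + (4 * s + (10 + 2 * s)))%N); last by clear; lia.
apply: leq_trans (edit_count_triangle _ _ _) (leq_add (C u) _).
exact: leq_trans (edit_count_triangle _ _ _) (leq_add M Cw).
Qed.

(** Within [q] steps the orbit of [x] comes within [2 / q] of [y]; this shift costs at most [2 * q].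
    The remaining words are compared over windows of length [n], the integer part of
    [1 / (2 * delta)], each costing at most [28 * s]. Halving gives [q] and the factor 14. *)
Lemma diameter_upper alpha p q B s beta N : (0 < q)%N -> coprimez p q -> (0 < s)%N ->
  let delta := `|q%:R * alpha - p%:~R| in
  0 < delta -> 8 * q%:R * delta < 1 ->
  `|beta - B%:R / q%:R| <= 4 * delta ->
  (s%:Z * p = 1 %[mod q%:Z])%Z \/ (s%:Z * p = -1 %[mod q%:Z])%Z ->
  edit_diameter R (words alpha beta N) <= q%:R + 14 * s%:R * (4 * N%:R * delta + 1).
Proof.
move=> q0 pq s0 /= d0 qd bb sp; set delta := `|_| in d0 qd bb *.
have q1R : 1 <= q%:R :> R by rewrite ler1n.
have [|v [w [[x cx <-] [y cy <-] -> _]]] := edit_diameter_max R (words_finite alpha beta N).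
  exists (xi_word alpha beta N 0), 0 => //.
  by rewrite /circle /= in_itv/= lexx ltr01.
rewrite /edit_distance ler_pdivrMr//.
have [|k kq [m am]] := @orbit_hit R alpha p q x y 0 q0 pq; first by rewrite -/delta; lra.
have half0 : 0 <= (2 * delta)^-1 by rewrite invr_ge0; lra.
have [n1 n2] := truncn_bounds half0; set n := Num.truncn _ in n1 n2.
have dn : 2 * n%:R * delta <= 1.
  by have := n1; rewrite -(ler_pM2r (_ : 0 < 2 * delta)) ?mulVf ?gt_eqF//; lra.
have dn' : 1 < 2 * (n%:R + 1) * delta.
  by move: n2; rewrite -[X in X < _]div1r ltr_pdivrMr ?mulr_gt0// mulrCA mulrA.
have n0 : (0 < n)%N by rewrite -(ltr_nat R); nra.
have n1R : 1 <= n%:R :> R by rewrite ler1n.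
have nd4 : 1 <= 4 * n%:R * delta by nra.
have C := @close_words_edit alpha p q B s beta (x + k%:R * alpha) y n N q0 pq d0 n0 dn qd bb sp
  (ex_intro _ m am).
have S : (edit_count (xi_word alpha beta N x) (xi_word alpha beta N (x + k%:R * alpha)) <= 2 * q)%N.
  rewrite !xi_word_subword
    (@eq_subword _ (fun t => in_arc beta (x + k%:R * alpha + t%:R * alpha))
      (fun t => in_arc beta (x + t%:R * alpha)) 0 k N).
    by apply: leq_trans (edit_count_shift _ _ _ _) _; rewrite leq_mul2l ltnW.
  by move=> t _; rewrite add0n natrD mulrDl addrA.
have {C S} : (edit_count (xi_word alpha beta N x) (xi_word alpha beta N y) <=
    2 * q + (N %/ n).+1 * (28 * s))%N.
  apply: leq_trans (edit_count_triangle _ (xi_word alpha beta N (x + k%:R * alpha)) _) _.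
  by apply: leq_add S (leq_trans C _); rewrite leq_mul2l; apply/orP; right; move: s0; clear; lia.
rewrite -(ler_nat R) natrD !natrM -natr1 => /le_trans; apply.
have Nn : (N %/ n)%:R <= 4 * N%:R * delta.
  apply: (@le_trans _ _ (N%:R / n%:R)).
    by rewrite ler_pdivlMr ?ltr0n// -natrM ler_nat leq_trunc_div.
  rewrite ler_pdivrMr ?ltr0n//.
  have : N%:R * 1 <= N%:R * (4 * n%:R * delta) by rewrite ler_wpM2l.
  lra.
have s0R : 0 < s%:R :> R by rewrite ltr0n.
have : (N %/ n)%:R * s%:R <= 4 * N%:R * delta * s%:R by rewrite ler_pM2r.
lra.
Qed.

End UpperBound.

(** * Extremal parameters *)

(** The stage is carried in the state so that stage [n] can be directed against the [n]-th number of
    an enumeration. *)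
Lemma invariant_choice (T : Type) (P : T -> Prop) (Q : nat -> T -> T -> Prop) x0 :
  P x0 -> (forall n x, P x -> exists2 y, P y & Q n x y) ->
  exists f : nat -> T, [/\ f 0%N = x0, forall n, P (f n) & forall n, Q n (f n) (f n.+1)].
Proof.
move=> Px0 PQ.
have step (s : nat * {x | P x}) :
    {t : nat * {x | P x} | t.1 = s.1.+1 /\ Q s.1 (projT1 s.2) (projT1 t.2)}.
  case: s => n [x Px]; apply: cid; have [y Py Qy] := PQ n x Px.
  by exists (n.+1, exist _ y Py).
have [f [f0 fS]] := dependent_choice step (0%N, exist _ x0 Px0).
have f1 n : (f n).1 = n by elim: n => [|n ih]; rewrite ?f0// (fS n).1 ih.
exists (fun n => projT1 (f n).2); split=> [|n|n]; first by rewrite f0.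
  exact: (projT2 (f n).2).
by have := (fS n).2; rewrite f1.
Qed.

Section Construction.
Context {R : realType}.
Implicit Types (alpha beta rho : R).

Lemma diagonal_uncountable (A : set R) :
  (forall c : nat -> R, exists2 a, A a & forall k, a != c k) -> ~ countable A.
Proof.
move=> diag /countable_injP[f finj].
have [a Aa ac] := diag (fun n => xget 0 [set x | A x /\ f x = n]).
have /= [Ax fx] : [set x | A x /\ f x = f a] (xget 0 [set x | A x /\ f x = f a]).
  exact: (xgetI _ (_ : [set x | A x /\ f x = f a] a)).
have /eqP := ac (f a); apply; apply: finj; rewrite ?inE//.
Qed.

(** The intervals of radius [2 * e k] around [u k] are nested. *)
Lemma limit_exists (u e : nat -> R) : (forall k, 0 <= e k) ->
  (forall k, 2 * e k.+1 <= e k) -> (forall k, `|u k.+1 - u k| <= e k) ->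
  exists l, forall k, `|l - u k| <= 2 * e k.
Proof.
move=> e0 e2 ue.
have lo k n : (k <= n)%N -> u k - 2 * e k <= u n - 2 * e n.
  move=> /subnKC <-; elim: (n - k)%N => [|j ih]; first by rewrite addn0.
  rewrite addnS; apply: le_trans ih _.
  by have := ue (k + j)%N; have := e2 (k + j)%N; rewrite ler_norml; lra.
have up k n : (k <= n)%N -> u n + 2 * e n <= u k + 2 * e k.
  move=> /subnKC <-; elim: (n - k)%N => [|j ih]; first by rewrite addn0.
  rewrite addnS; apply: le_trans ih.
  by have := ue (k + j)%N; have := e2 (k + j)%N; rewrite ler_norml; lra.
have lu k n : u k - 2 * e k <= u n + 2 * e n.
  have := lo k (maxn k n) (leq_maxl _ _); have := up n (maxn k n) (leq_maxr _ _).
  by have := e0 (maxn k n); lra.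
exists (sup (range (fun k => u k - 2 * e k))) => k.
have h1 : sup (range (fun k => u k - 2 * e k)) <= u k + 2 * e k.
  by apply: ge_sup; [exists (u 0%N - 2 * e 0%N), 0%N|move=> _ [n _ <-]].
have h2 : u k - 2 * e k <= sup (range (fun k => u k - 2 * e k)).
  apply: ub_le_sup; last by exists k.
  by exists (u 0%N + 2 * e 0%N) => _ [n _ <-].
by rewrite ler_norml; lra.
Qed.

(** Determinant 1 in absolute value makes consecutive fractions Farey neighbours, so the previous
    denominator inverts the numerator modulo the next one up to sign. The start at [256 = 16 ^ 2]
    makes denominators grow at least 16-fold when [rho > 3 / 2], which fixes the later numerical
    constants. *)
Definition fast_approximated rho alpha (p : nat -> int) (q : nat -> nat) : Prop :=
  [/\ (256 <= q 0)%N,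
      forall k, (q k)%:R `^ rho <= (q k.+1)%:R <= 4 * (q k)%:R `^ rho,
      forall k, `|p k.+1 * (q k)%:Z - p k * (q k.+1)%:Z| = 1
    & forall k, `|alpha - (p k)%:~R / (q k)%:R| <= 2 / ((q k)%:R * (q k.+1)%:R)].

Lemma fast_growth rho (q : nat) q' : 3 / 2 < rho -> (256 <= q)%N ->
  q%:R `^ rho <= q'%:R :> R -> (16 * q <= q')%N.
Proof.
move=> r32 q256 qq'; rewrite -(ler_nat R) natrM; apply: le_trans qq'.
have q0 : 256 <= q%:R :> R by rewrite ler_nat.
have -> : rho = 1 + (rho - 1) by ring.
rewrite gt0_powRD; last by lra.
rewrite powRr1 ?ler0n// mulrC ler_wpM2l//.
apply: (@le_trans _ _ (256 `^ (1 / 2))); last first.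
  apply: (@le_trans _ _ (q%:R `^ (1 / 2))); first by apply: le_powR; lra.
  by rewrite ler_powR; lra.
by rewrite div1r powR12_sqrt// (_ : 256 = 16 ^+ 2) ?sqrtr_sqr ?ger0_norm//; lra.
Qed.

(** The new fraction is [a] times the last plus or minus the one before. Both signs keep the
    determinant, and the sign decides on which side of [p / q] the new fraction lies; it is chosen
    away from [c]. *)
Lemma fast_step rho (p p' : int) (q q' : nat) (c : R) : 1 <= rho ->
  (0 < q' <= q)%N -> `|p * q'%:Z - p' * q%:Z| = 1 ->
  exists (p1 : int) (q1 : nat), [/\ q%:R `^ rho <= q1%:R <= 4 * q%:R `^ rho,
    `|p1 * q%:Z - p * q1%:Z| = 1,
    c <= p%:~R / q%:R -> p1%:~R / q1%:R = p%:~R / q%:R + (q%:R * q1%:R)^-1 :> R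
  & p%:~R / q%:R < c -> p1%:~R / q1%:R = p%:~R / q%:R - (q%:R * q1%:R)^-1 :> R].
Proof.
move=> r1 /andP[q'0 q'q] det.
have q0 : 1 <= q%:R :> R by rewrite ler1n (leq_trans q'0).
have q'R : 1 <= q'%:R :> R by rewrite ler1n.
have q'qR : q'%:R <= q%:R :> R by rewrite ler_nat.
pose e : int := if c <= p%:~R / q%:R then 1 else -1.
pose d : int := p' * q%:Z - p * q'%:Z.
have d1 : d * d = 1 by move: det; rewrite /d -opprB normrN; nia.
have e1 : e * e = 1 by rewrite /e; case: ifP.
pose x := q%:R `^ (rho - 1); have x1 : 1 <= x by apply: powR_ge1; lra.
have xE : q%:R `^ rho = q%:R * x.
  by rewrite /x -[X in X * _]powRr1 ?ler0n// -gt0_powRD ?subrKC//; lra.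
have [a1 a2] := truncn_bounds (le_trans ler01 x1).
(* Adding 2 leaves [q1 >= q * x] even when [q'] is subtracted, and [q1 <= (x + 3) * q <= 4 * q * x]
   when it is added. *)
set n := Num.truncn x in a1 a2; pose a := n.+2.
have aR : a%:R = n%:R + 2 :> R by rewrite /a -addn2 natrD.
pose p1 : int := a%:Z * p + e * d * p'.
pose q1 : int := a%:Z * q%:Z + e * d * q'%:Z.
have q1R : q1%:~R = a%:R * q%:R + (e * d)%:~R * q'%:R :> R.
  by rewrite /q1 intrD !intrM.
have ed : e * d = 1 \/ e * d = -1 by nia.
have [b1 b2] : a%:R * q%:R - q'%:R <= q1%:~R :> R /\ q1%:~R <= a%:R * q%:R + q'%:R :> R.
  by rewrite q1R; case: ed => ->; rewrite ?mulrN1z ?mulr1z; split; lra.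
have [c1 c2] : q%:R * x <= q1%:~R :> R /\ q1%:~R <= 4 * (q%:R * x) :> R.
  by rewrite aR in b1 b2; split; nra.
have q10 : 0 < q1%:~R :> R by nra.
have q1E : (absz q1)%:R = q1%:~R :> R.
  by rewrite natr_absz gtr0_norm// -(ltr0z R).
have D : p1 * q%:Z - p * q1 = e.
  by rewrite /p1 /q1 -[RHS]mulr1 -d1 /d; ring.
have DR : p1%:~R * q%:R - p%:~R * q1%:~R = e%:~R :> R.
  by rewrite -D intrB !intrM.
have F : p1%:~R / q1%:~R = p%:~R / q%:R + e%:~R * (q%:R * q1%:~R)^-1 :> R.
  by rewrite -DR; field; rewrite !gt_eqF//; lra.
exists p1, (absz q1); rewrite q1E xE; split.
- by rewrite c1.
- rewrite gez0_abs ?D; last by rewrite ltW// -(ltr0z R).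
  by rewrite /e; case: ifP.
- by move=> h; rewrite F /e h mul1r.
- by move=> h; rewrite F /e leNgt h mulN1r.
Qed.

Lemma fast_approximated_uncountable rho : 3 / 2 < rho ->
  ~ countable [set alpha | exists p q, fast_approximated rho alpha p q].
Proof.
move=> r32; apply: diagonal_uncountable => c.
pose P (s : (int * nat) * (int * nat)) := [/\ (256 <= s.1.2)%N, (0 < s.2.2 <= s.1.2)%N
  & `|s.1.1 * s.2.2%:Z - s.2.1 * s.1.2%:Z| = 1].
pose Q n (s s' : (int * nat) * (int * nat)) := [/\ s'.2 = s.1,
  s.1.2%:R `^ rho <= s'.1.2%:R <= 4 * s.1.2%:R `^ rho,
  c n <= s.1.1%:~R / s.1.2%:R -> s'.1.1%:~R / s'.1.2%:R = s.1.1%:~R / s.1.2%:R + (s.1.2%:R * s'.1.2%:R)^-1 :> R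
  & s.1.1%:~R / s.1.2%:R < c n -> s'.1.1%:~R / s'.1.2%:R = s.1.1%:~R / s.1.2%:R - (s.1.2%:R * s'.1.2%:R)^-1 :> R].
have [||f [f0 fP fQ]] := @invariant_choice _ P Q ((1, 256%N), (0, 1%N)).
- by [].
- move=> n [[p q] [p' q']] [/= q256 qq' det].
  have r1 : 1 <= rho by lra.
  have [p1 [q1 [a1 a2 a3 a4]]] := fast_step (c n) r1 qq' det.
  exists ((p1, q1), (p, q)) => //; split=> //=.
    have /andP[h _] := a1; have := fast_growth r32 q256 h; lia.
  have /andP[h _] := a1; have := fast_growth r32 q256 h; lia.
pose p k := (f k).1.1; pose q k := (f k).1.2.
have fS k : (f k.+1).2 = (f k).1 by have [] := fQ k.
have q256 k : (256 <= q k)%N by have [] := fP k.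
have grow k : (q k)%:R `^ rho <= (q k.+1)%:R <= 4 * (q k)%:R `^ rho by have [] := fQ k.
have det k : `|p k.+1 * (q k)%:Z - p k * (q k.+1)%:Z| = 1.
  by have [_ _] := fP k.+1; rewrite fS.
have q16 k : 16 * (q k)%:R <= (q k.+1)%:R :> R.
  by have /andP[h _] := grow k; rewrite -natrM ler_nat (fast_growth r32 (q256 k) h).
have q0 k : 0 < (q k)%:R :> R by rewrite ltr0n (leq_trans _ (q256 k)).
pose u k : R := (p k)%:~R / (q k)%:R; pose e k : R := ((q k)%:R * (q k.+1)%:R)^-1.
have e0 k : 0 < e k by rewrite invr_gt0 mulr_gt0.
have e16 k : 16 * e k.+1 <= e k.
  have h : 16 * (q k)%:R <= (q k.+2)%:R :> R by have := q16 k; have := q16 k.+1; have := q0 k; lra.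
  rewrite /e [in leRHS]mulrC !invfM mulrCA ler_pM2l ?invr_gt0// ler_pdivrMr// mulrC ler_pdivlMr//.
have ue k : `|u k.+1 - u k| <= e k.
  have [_ _ h1 h2] := fQ k; have [h|h] := leP (c k) (u k).
    have -> : u k.+1 = u k + e k := h1 h.
    by rewrite addrAC subrr add0r gtr0_norm.
  have -> : u k.+1 = u k - e k := h2 h.
  by rewrite addrAC subrr add0r normrN gtr0_norm.
have e2 k : 2 * e k.+1 <= e k.
  by have := e16 k; have := e0 k.+1; lra.
have [alpha al] := limit_exists (fun k => ltW (e0 k)) e2 ue.
exists alpha.
  by exists p, q; split; [exact: (q256 0%N)|exact: grow|exact: det|exact: al].
(* Step [k] moves a distance [e k] away from [c k], and all later steps together move at most
   [2 * e k.+1 <= e k / 8]. *)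
move=> k; have [_ _ h1 h2] := fQ k; have := al k.+1; rewrite ler_norml.
have := e16 k; have := e0 k.+1; have [h|h] := leP (c k) (u k).
  have -> : u k.+1 = u k + e k := h1 h.
  by move=> ? ? ?; apply/eqP; lra.
have -> : u k.+1 = u k - e k := h2 h.
by move=> ? ? ?; apply/eqP; lra.
Qed.

End Construction.

(** * Arithmetic of the extremal numbers *)

Section FastApproximation.
Context {R : realType} {rho alpha : R} {p : nat -> int} {q : nat -> nat}.
Context (r32 : 3 / 2 < rho) (fa : fast_approximated rho alpha p q).
Implicit Types (k N : nat) (beta : R).

Lemma fast_denominator_ge k : (256 <= q k)%N.
Proof.
have [q0 grow _ _] := fa; elim: k => [//|k ih]; have /andP[h _] := grow k.
by apply: leq_trans (fast_growth r32 ih h); apply: leq_trans ih (leq_pmull _ _).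
Qed.

Lemma fast_denominator_growth k : (16 * q k <= q k.+1)%N.
Proof.
have [_ grow _ _] := fa; have /andP[h _] := grow k.
exact: fast_growth r32 (fast_denominator_ge k) h.
Qed.

Lemma fast_denominator_gt k : (k < q k)%N.
Proof.
elim: k => [|k ih]; first exact: leq_trans (fast_denominator_ge 0).
by apply: leq_trans (fast_denominator_growth k); move: ih; clear; lia.
Qed.

Let q0 k : 0 < (q k)%:R :> R.
Proof. by rewrite ltr0n (leq_trans _ (fast_denominator_ge k)). Qed.

Let q1 k : 256 <= (q k)%:R :> R.
Proof. by rewrite ler_nat fast_denominator_ge. Qed.

Let q16 k : 16 * (q k)%:R <= (q k.+1)%:R :> R.
Proof. by rewrite -natrM ler_nat fast_denominator_growth. Qed.

Lemma fast_det k : p k.+1 * (q k)%:Z - p k * (q k.+1)%:Z = 1 \/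
  p k.+1 * (q k)%:Z - p k * (q k.+1)%:Z = -1.
Proof. by have [_ _ /(_ k) det _] := fa; move: det; move: (_ - _) => z; clear; lia. Qed.

Lemma fast_coprime k : coprimez (p k) (q k)%:Z.
Proof.
apply/coprimezP; have [d|d] := fast_det k.
  by exists (- (q k.+1)%:Z, p k.+1) => /=; rewrite -d; ring.
by exists ((q k.+1)%:Z, - p k.+1) => /=; apply: oppr_inj; rewrite -d; ring.
Qed.

Lemma fast_inverse k :
  ((q k)%:Z * p k.+1 = 1 %[mod (q k.+1)%:Z])%Z \/
  ((q k)%:Z * p k.+1 = -1 %[mod (q k.+1)%:Z])%Z.
Proof.
have [d|d] := fast_det k; [left|right].
  have -> : (q k)%:Z * p k.+1 = p k * (q k.+1)%:Z + 1 by rewrite -d; ring.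
  by rewrite modzMDl.
have -> : (q k)%:Z * p k.+1 = p k * (q k.+1)%:Z + -1 by rewrite -d; ring.
by rewrite modzMDl.
Qed.

Let dist_le k : (q k.+1)%:R * `|(q k)%:R * alpha - (p k)%:~R| <= 2.
Proof.
have [_ _ _ /(_ k) h] := fa.
have -> : (q k)%:R * alpha - (p k)%:~R = (q k)%:R * (alpha - (p k)%:~R / (q k)%:R).
  by field; rewrite gt_eqF.
rewrite normrM gtr0_norm// mulrA [_ * (q k)%:R]mulrC.
by rewrite [leLHS]mulrC -ler_pdivlMr ?mulr_gt0//; exact: h.
Qed.

(** The crude bound 2 is sharpened by the determinant identity: the quantities
    [q k.+1 * (q k * alpha - p k)] and [q k * (q k.+1 * alpha - p k.+1)] differ by exactly 1 in
    absolute value, and the second is at most [1 / 8]. *)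
Lemma fast_distance k :
  7 / 8 <= (q k.+1)%:R * `|(q k)%:R * alpha - (p k)%:~R| <= 9 / 8.
Proof.
have D : (q k.+1)%:R * ((q k)%:R * alpha - (p k)%:~R) -
    (q k)%:R * ((q k.+1)%:R * alpha - (p k.+1)%:~R) =
    (p k.+1 * (q k)%:Z - p k * (q k.+1)%:Z)%:~R.
  by rewrite intrB !intrM /=; ring.
have S : (q k)%:R * `|(q k.+1)%:R * alpha - (p k.+1)%:~R| <= 1 / 8.
  have := dist_le k.+1; have := q16 k; have := q16 k.+1.
  have := normr_ge0 ((q k.+1)%:R * alpha - (p k.+1)%:~R); have := q0 k.
  by nra.
rewrite -(gtr0_norm (q0 k)) -normrM in S.
have -> : (q k.+1)%:R * `|(q k)%:R * alpha - (p k)%:~R| =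
    `|(q k.+1)%:R * ((q k)%:R * alpha - (p k)%:~R)| by rewrite normrM gtr0_norm.
move: D S; set a := _ * _; set b := _ * (_ - _).
have [->|->] := fast_det k; rewrite ?mulrN1z ?mulr1z => D S.
  have -> : a = 1 + b by lra.
  have := ler_normD 1 b; have := ler_normB (1 + b) b; rewrite addrK normr1; lra.
have -> : a = b - 1 by lra.
have := ler_normB b 1; have := ler_normB (b - 1) b.
by rewrite addrAC subrr add0r normrN normr1; lra.
Qed.

Let dist_gt0 k : 0 < `|(q k)%:R * alpha - (p k)%:~R|.
Proof. by have := fast_distance k; have := q0 k.+1; nra. Qed.

Lemma fast_irrational : irrational alpha.
Proof.
move=> /rationalP[a [b E]].
(* A zero denominator [b] is possible here and stands for [alpha = 0]. Otherwise the index [b]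
   itself gives the contradiction, since [q b > b]. *)
have [b0|b0] := posnP b.
  have a0 : alpha = 0 by rewrite E b0 invr0 mulr0.
  have := fast_distance 0; rewrite a0 mulr0 sub0r normrN.
  have [->|n0] := eqVneq (p 0%N) 0; first by rewrite normr0; lra.
  have : 1 <= `|(p 0%N)%:~R| :> R by rewrite -intr_norm ler1z -gtz0_ge1 normr_gt0.
  by have := q1 1; nra.
have b0R : 0 < b%:R :> R by rewrite ltr0n.
have := fast_distance b.
have -> : (q b)%:R * alpha - (p b)%:~R = ((q b)%:Z * a - p b * b%:Z)%:~R / b%:R.
  by rewrite intrB !intrM E /=; field; rewrite gt_eqF.
set z := _ - _; have [->|z0] := eqVneq z 0; first by rewrite mul0r normr0; lra.
rewrite normrM (gtr0_norm (_ : 0 < b%:R^-1)) ?invr_gt0//.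
have z1 : 1 <= `|z%:~R| :> R by rewrite -intr_norm ler1z -gtz0_ge1 normr_gt0.
move=> /andP[_]; rewrite mulrA ler_pdivrMr// leNgt => /negP; apply.
have : (2 * b%:R : R) <= (q b.+1)%:R.
  by have := q16 b; have := fast_denominator_gt b; rewrite -(ltr_nat R); lra.
by nra.
Qed.

Lemma fast_denominator_lt i j : (i < j)%N -> (q i < q j)%N.
Proof.
elim: j => [//|j ih]; rewrite ltnS leq_eqVlt => /orP[/eqP ->|/ih ij].
  by have := fast_denominator_growth j; have := fast_denominator_ge j; clear; lia.
by have := fast_denominator_growth j; move: ij; clear; lia.
Qed.

Lemma fast_bracket (x : R) k0 : (q k0)%:R <= x ->
  exists k, [/\ (k0 <= k)%N, (q k)%:R <= x & x < (q k.+1)%:R].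
Proof.
move=> kx; have ex : exists k, x < (q k)%:R.
  exists (Num.truncn x).+1; apply: lt_trans (truncnS_gt x) _.
  by rewrite ltr_nat fast_denominator_gt.
have lt k : (k <= k0)%N -> (q k)%:R <= x.
  rewrite leq_eqVlt => /orP[/eqP->//|/fast_denominator_lt].
  by rewrite -(ltr_nat R) => /ltW /le_trans; exact.
case: (ex_minnP ex) => -[|k] xk kmin; first by have := lt 0%N isT; lra.
have kk : (q k)%:R <= x by rewrite leNgt; apply/negP => /kmin; rewrite ltnn.
exists k; split=> //; rewrite leqNgt; apply/negP => /lt; lra.
Qed.

Lemma fast_exponent_le (mu : R) : infinite_set (approximations alpha mu) -> mu <= 1 + rho.
Proof.
move=> inf; rewrite leNgt; apply/negP => mu1; have [_ grow _ _] := fa.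
have h := r32; have mu2 : 0 < mu - 2 by lra.
have mu3 : 0 < mu - (1 + rho) by lra.
(* The 5 is for fractions equal to [p k / q k], where [b ^ (1 + rho) * X >= 7 / 32] and
   [5 * 7 / 32 > 1]; the 8 is for all others, where [4 * b ^ 2 * X + 9 / 32 >= 1]. *)
have [B0 HB0] := powR_large 5 mu3; have [B1 HB1] := powR_large 8 mu2.
apply: inf; apply: (@approximations_bounded R _ _
  (Num.truncn (Num.max (q 0)%:R (Num.max B0 B1))).+1).
move=> a b [/= b0 /andP[_ ab]]; rewrite ltnNge; apply/negP => bK.
have : Num.max (q 0)%:R (Num.max B0 B1) < b%:R.
  by apply: lt_le_trans (truncnS_gt _) _; rewrite ler_nat.
rewrite !gt_max => /and3P[bq /ltW/HB0 bB0 /ltW/HB1 bB1].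
have b0R : 0 < b%:R :> R by rewrite ltr0n.
(* The factor 4 makes [b * |D|] at most [9 / 32], so that a nonzero determinant [z] must be
   accounted for by the distance [X] from [alpha] to [a / b]. *)
have [k [_ k1 k2]] : exists k, [/\ (0 <= k)%N, (q k)%:R <= 4 * b%:R :> R & 4 * b%:R < (q k.+1)%:R :> R].
  by apply: fast_bracket; lra.
have := fast_distance k; set D := (q k)%:R * alpha - _ => /andP[D1 D2].
set X := `|_| in ab.
have E : (q k)%:R * b%:R * X = `|b%:R * D - (a * (q k)%:Z - p k * b%:Z)%:~R|.
  rewrite -{1}(gtr0_norm (q0 k)) -{1}(gtr0_norm b0R) /X -!normrM; congr `|_|.
  by rewrite intrB !intrM /= /D; field; rewrite gt_eqF.
have {}ab : b%:R `^ mu * X < 1.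
  move: ab; rewrite powRN -div1r ltr_pdivlMr ?powR_gt0// mulrC; exact.
have X0 : 0 <= X := normr_ge0 _.
set z := (X in _ - X%:~R) in E; have [z0|z0] := eqVneq z 0.
  have qb : (q k <= b)%N.
    apply: dvdn_leq => //; rewrite -[(_ %| _)%N]/((q k)%:Z %| b%:Z)%Z.
    have : ((q k)%:Z %| p k * b%:Z)%Z.
      apply/dvdzP; exists a; apply/eqP; rewrite eq_sym -subr_eq0; exact/eqP.
    by rewrite Gauss_dvdzr// coprimez_sym fast_coprime.
  have qbR : (q k)%:R <= b%:R :> R by rewrite ler_nat.
  have qr : (q k)%:R `^ rho <= b%:R `^ rho by apply: le_powR => //; lra.
  have /andP[_ g] := grow k.
  have muE : b%:R `^ mu = b%:R * b%:R `^ rho * b%:R `^ (mu - (1 + rho)).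
    rewrite -[X in X * _ * _]powRr1 ?ler0n// -!gt0_powRD//; congr (_ `^ _); ring.
  have XE : (q k)%:R * X = `|D|.
    apply: (mulfI (_ : b%:R != 0)); rewrite ?gt_eqF// mulrCA mulrA E z0 subr0.
    by rewrite normrM gtr0_norm.
  have Xr : 7 / 32 <= (b%:R * b%:R `^ rho) * X.
    have h1 : (q k.+1)%:R * `|D| <= 4 * b%:R `^ rho * `|D|.
      by rewrite ler_wpM2r// (le_trans g)// ler_wpM2l.
    have h2 : (q k)%:R * (b%:R `^ rho * X) <= b%:R * (b%:R `^ rho * X).
      by rewrite ler_wpM2r// mulr_ge0// powR_ge0.
    by move: h1 h2 D1; rewrite -XE; lra.
  have : 5 * (b%:R * b%:R `^ rho * X) <= b%:R `^ mu * X.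
    by rewrite muE mulrA ler_wpM2r// mulrC ler_wpM2l// mulr_ge0// powR_ge0.
  by lra.
have z1 : 1 <= `|z%:~R| :> R by rewrite -intr_norm ler1z -gtz0_ge1 normr_gt0.
have muE : b%:R `^ mu = b%:R ^+ 2 * b%:R `^ (mu - 2).
  by rewrite -powR_mulrn ?ler0n// -gt0_powRD//; congr (_ `^ _); lra.
have bD : b%:R * `|D| <= 9 / 32.
  have := normr_ge0 D; nra.
have : `|z%:~R| <= (q k)%:R * b%:R * X + b%:R * `|D|.
  by rewrite E -{2}(gtr0_norm b0R) -normrM distrC addrC -lerBlDl lerB_dist.
have h1 : 8 * b%:R ^+ 2 * X <= b%:R `^ mu * X.
  by rewrite muE ler_wpM2r// mulrC ler_wpM2l// exprn_ge0.
have h2 : (q k)%:R * b%:R * X <= 4 * b%:R * b%:R * X.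
  by rewrite ler_wpM2r// ler_pM2r.
by rewrite expr2 in h1; lra.
Qed.

Lemma fast_exponent_ge (mu : R) : 0 < mu -> mu < 1 + rho ->
  infinite_set (approximations alpha mu).
Proof.
move=> mu0 mur; have [_ grow _ _] := fa.
have mu1 : 0 < 1 + rho - mu by lra.
have [K HK] : exists K, forall k, (K <= k)%N -> 2 <= (q k)%:R `^ (1 + rho - mu).
  have [B HB] := powR_large 2 mu1; exists (Num.truncn B).+1 => k Bk.
  apply: HB; apply: le_trans (ltW (truncnS_gt B)) _.
  by rewrite ler_nat ltnW// (leq_ltn_trans Bk (fast_denominator_gt k)).
pose f k : int * nat := (p (k + K)%N, q (k + K)%N).
have inj : {in f @^-1` approximations alpha mu &, injective f}.
  move=> i j _ _ fij; have qE : q (i + K)%N = q (j + K)%N := congr1 snd fij.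
  have lt a b : q (a + K)%N = q (b + K)%N -> ~ (a < b)%N.
    move=> qab ab; have := @fast_denominator_lt (a + K)%N (b + K)%N.
    by rewrite ltn_add2r qab ltnn => /(_ ab).
  by case: (ltngtP i j) => [/(lt _ _ qE)|/(lt _ _ (esym qE))|].
move=> fin; have {}fin := finite_preimage inj fin.
apply: infinite_nat.
apply: sub_finite_set fin => k _.
rewrite /preimage /mkset /f; move: (k + K)%N (leq_addl k K) => {}k Kk.
split; first by rewrite /= -(ltr0n R).
change (0 < `|alpha - (p k)%:~R / (q k)%:R| < (q k)%:R `^ (- mu)).
have := fast_distance k; have d0 := dist_gt0 k.
have -> : alpha - (p k)%:~R / (q k)%:R = ((q k)%:R * alpha - (p k)%:~R) / (q k)%:R.
  by field; rewrite gt_eqF.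
rewrite normrM [`|_^-1|]gtr0_norm ?invr_gt0// divr_gt0//=.
move: d0; move: `|_| => d d0 /andP[_ d1].
have Bq := HK k Kk.
have /andP[g _] := grow k.
rewrite ltr_pdivrMr// powRN mulrC ltr_pdivlMr ?powR_gt0//.
have qE : (q k)%:R * (q k)%:R `^ rho = (q k)%:R `^ (1 + rho - mu) * (q k)%:R `^ mu.
  by rewrite -gt0_powRD// subrK gt0_powRD// powRr1.
have m0 : 0 < (q k)%:R `^ mu by rewrite powR_gt0.
have h1 : 2 * (q k)%:R `^ mu <= (q k)%:R * (q k)%:R `^ rho by rewrite qE ler_pM2r.
have h2 : (q k)%:R * (q k)%:R `^ rho <= (q k)%:R * (q k.+1)%:R by rewrite ler_pM2l.
have : 2 * (q k)%:R `^ mu * d <= (q k)%:R * (q k.+1)%:R * d.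
  by rewrite ler_pM2r//; lra.
have := q0 k.
have : (q k)%:R * ((q k.+1)%:R * d) <= (q k)%:R * (9 / 8) by rewrite ler_pM2l.
by nra.
Qed.

Lemma fast_exponent : irrationality_exponent alpha = (1 + rho)%:E.
Proof.
apply/eqP; rewrite eq_le; apply/andP; split.
  by apply: ge_ereal_sup => _ [mu inf <-]; rewrite lee_fin; exact: fast_exponent_le.
apply: ereal_ge_approx => [|mu mu0 mur]; first by have h := r32; lra.
by apply: ereal_sup_ubound; exists mu => //; exact: fast_exponent_ge.
Qed.

End FastApproximation.

(** * Upper bounds for the extremal parameters *)

Section Sharpness.
Context {R : realType}.
Implicit Types (alpha beta rho : R) (q B : nat -> nat) (k N : nat).

(** The constant 3 stays below the tolerance [4 * delta] of [diameter_upper], because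
    [fast_distance] gives [4 * delta >= 7 / (2 * q k.+1)]. *)
Definition fast_coded beta q B : Prop :=
  forall k, `|beta - (B k)%:R / (q k)%:R| <= 3 / (q k.+1)%:R.

(** [f / q'] is [B / q] rounded down to the finer grid; [f + 2] and [f - 1] then lie between one and
    two cells away from [B / q], above and below. *)
Lemma coded_step (q q' B : nat) (c : R) : (0 < q)%N -> (16 * q <= q')%N -> (2 <= B)%N ->
  exists2 B' : nat, (2 <= B')%N & [/\ `|B'%:R / q'%:R - B%:R / q%:R| <= 2 / q'%:R :> R,
    c <= B%:R / q%:R -> B%:R / q%:R + q'%:R^-1 <= B'%:R / q'%:R :> R
  & B%:R / q%:R < c -> B'%:R / q'%:R <= B%:R / q%:R - q'%:R^-1 :> R].
Proof.
move=> q0 qq' B2; pose f := (q' * B %/ q)%N.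
have q'0 : (0 < q')%N by move: q0 qq'; clear; lia.
have [q0R q'0R] : 0 < q%:R :> R /\ 0 < q'%:R :> R by rewrite !ltr0n.
have f1 : (f * q <= q' * B)%N by rewrite leq_trunc_div.
have f2 : (q' * B < f.+1 * q)%N by rewrite ltn_ceil.
have f3 : (3 <= f)%N by move: f2 qq' B2 q0; clear; nia.
have F1 : f%:R / q'%:R <= B%:R / q%:R :> R.
  by rewrite ler_pdivrMr// mulrAC ler_pdivlMr// -!natrM ler_nat (mulnC B).
have F2 : B%:R / q%:R < f%:R / q'%:R + q'%:R^-1 :> R.
  rewrite -[X in _ + X]mul1r -mulrDl natr1 ltr_pdivlMr// mulrAC ltr_pdivrMr// -!natrM.
  by rewrite ltr_nat (mulnC B).
have q'V : 0 < q'%:R^-1 :> R by rewrite invr_gt0.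
have [h|h] := leP c (B%:R / q%:R).
  have E : (f + 2)%:R / q'%:R = f%:R / q'%:R + 2 / q'%:R :> R by rewrite natrD mulrDl.
  exists (f + 2)%N; first by rewrite addn2.
  by split; rewrite E ?ler_norml; lra.
have E : (f - 1)%:R / q'%:R = f%:R / q'%:R - 1 / q'%:R :> R.
  by rewrite natrB ?mulrBl// (leq_trans _ f3).
exists (f - 1)%N; first by move: f3; clear; lia.
by split; rewrite E ?ler_norml; lra.
Qed.

Lemma coded_uncountable q : (256 <= q 0)%N -> (forall k, 16 * q k <= q k.+1)%N ->
  ~ countable [set beta : R | 0 < beta < 1 /\ exists B, fast_coded beta q B].
Proof.
move=> q256 q16; apply: diagonal_uncountable => c.
have q0 k : (0 < q k)%N.
  by elim: k => [|k ih]; [move: q256|move: ih (q16 k)]; clear; lia.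
have q0R k : 0 < (q k)%:R :> R by rewrite ltr0n.
have q16R k : 16 * (q k)%:R <= (q k.+1)%:R :> R by rewrite -natrM ler_nat.
pose Q (n : nat) (b b' : nat) := [/\ `|b'%:R / (q n.+1)%:R - b%:R / (q n)%:R| <= 2 / (q n.+1)%:R :> R,
    c n <= b%:R / (q n)%:R -> b%:R / (q n)%:R + (q n.+1)%:R^-1 <= b'%:R / (q n.+1)%:R :> R
  & b%:R / (q n)%:R < c n -> b'%:R / (q n.+1)%:R <= b%:R / (q n)%:R - (q n.+1)%:R^-1 :> R].
(* Starting near [1 / 2] keeps [beta] inside the open unit interval. *)
have b02 : (2 <= q 0 %/ 2)%N by move: q256; clear; lia.
have [B [B0 _ BQ]] := @invariant_choice _ (fun b => (2 <= b)%N) Q _ b02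
  (fun n b b2 => coded_step (c n) (q0 n) (q16 n) b2).
pose u k : R := (B k)%:R / (q k)%:R; pose e k : R := 2 / (q k.+1)%:R.
have e0 k : 0 < e k by rewrite divr_gt0.
have e16 k : 16 * e k.+1 <= e k.
  by rewrite /e mulrCA ler_pM2l// ler_pdivrMr// mulrC ler_pdivlMr//.
have e2 k : 2 * e k.+1 <= e k by have := e16 k; have := e0 k.+1; lra.
have ue k : `|u k.+1 - u k| <= e k by have [] := BQ k.
have [beta bl] := limit_exists (fun k => ltW (e0 k)) e2 ue.
have b3 k : `|beta - u k| <= 3 / (q k.+1)%:R.
  have eE : e k = 2 / (q k.+1)%:R by [].
  have -> : beta - u k = (beta - u k.+1) + (u k.+1 - u k) by ring.
  apply: le_trans (ler_normD _ _) _; have := bl k.+1; have := ue k; have := e16 k.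
  by have := e0 k; lra.
exists beta; last first.
  move=> k; have [_ h1 h2] := BQ k; have := bl k.+1; rewrite ler_norml.
  have := e16 k; have := e0 k.+1; have eE : e k = 2 * (q k.+1)%:R^-1 by [].
  have [h|h] := leP (c k) (u k); [have := h1 h|have := h2 h];
    rewrite -/(u k) -/(u k.+1) => ? ? ? ?; apply/eqP; lra.
split; last by exists B.
have q1R : 16 * 256 <= (q 1)%:R :> R.
  by apply: le_trans (q16R 0%N); rewrite ler_pM2l// ler_nat.
have q256R : 256 <= (q 0)%:R :> R by rewrite ler_nat.
have h1 : 3 / (q 1)%:R <= 1 / 256 :> R by rewrite ler_pdivrMr//; lra.
have B1 : 2 * (B 0)%:R <= (q 0)%:R :> R.
  by rewrite -natrM ler_nat B0 mulnC leq_trunc_div.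
have B2 : (q 0)%:R <= 4 * (B 0)%:R :> R.
  have h : (q 0 <= 4 * (q 0 %/ 2))%N by move: q256; clear; lia.
  by rewrite -natrM ler_nat B0.
have u1 : u 0%N <= 1 / 2 by rewrite ler_pdivrMr//; lra.
have u2 : 1 / 4 <= u 0%N by rewrite ler_pdivlMr//; lra.
by have := b3 0%N; rewrite ler_norml; lra.
Qed.

Lemma Gamma_sup_le alpha beta (C g : R) :
  (exists N0, forall N, (N0 <= N)%N -> edit_diameter R (words alpha beta N) <= C * N%:R `^ g) ->
  (Gamma_sup alpha beta <= g%:E)%E.
Proof.
move=> [N0 H]; apply/lee_addgt0Pr => e e0; rewrite -EFinD.
have [x0 Hx] := powR_large C e0.
apply: limn_esup_le_near; exists (maxn (maxn 2 N0) (Num.truncn x0).+1) => N.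
rewrite !geq_max => /andP[/andP[N2 NN0] Nx]; apply: log_ratio_le => //.
apply: le_trans (H N NN0) _; rewrite addrC gt0_powRD ?ltr0n ?(ltn_trans _ N2)//.
rewrite ler_wpM2r ?powR_ge0// Hx//; apply: le_trans (ltW (truncnS_gt x0)) _.
by rewrite ler_nat.
Qed.

Lemma Gamma_inf_le alpha beta (C g : R) :
  (forall N0, exists2 N, (N0 <= N)%N & edit_diameter R (words alpha beta N) <= C * N%:R `^ g) ->
  (Gamma_inf alpha beta <= g%:E)%E.
Proof.
move=> H; apply/lee_addgt0Pr => e e0; rewrite -EFinD.
have [x0 Hx] := powR_large C e0.
apply: limn_einf_le_often => N0.
have [N + NC] := H (maxn (maxn 2 N0) (Num.truncn x0).+1).
rewrite !geq_max => /andP[/andP[N2 NN0] Nx]; exists N => //; apply: log_ratio_le => //.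
apply: le_trans NC _; rewrite addrC gt0_powRD ?ltr0n ?(ltn_trans _ N2)//.
rewrite ler_wpM2r ?powR_ge0// Hx//; apply: le_trans (ltW (truncnS_gt x0)) _.
by rewrite ler_nat.
Qed.

(** [diameter_upper] with [s = q k], at most [q k.+1 ^ (1 / rho)], and
    [delta <= (9 / 8) * q k.+1 ^ (- rho)]; the constant is [63 = 14 * 4 * 9 / 8]. *)
Lemma fast_diameter rho alpha beta p q B k N : 3 / 2 < rho ->
  fast_approximated rho alpha p q -> fast_coded beta q B ->
  edit_diameter R (words alpha beta N) <=
    2 * (q k.+1)%:R + 63 * N%:R * (q k.+1)%:R `^ (rho^-1 - rho).
Proof.
move=> r32 fa cb; have [_ grow _ _] := fa.
have q0 i : (0 < q i)%N by rewrite (leq_trans _ (fast_denominator_ge r32 fa i)).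
have q0R i : 0 < (q i)%:R :> R by rewrite ltr0n.
have q16 i : 16 * (q i)%:R <= (q i.+1)%:R :> R.
  by rewrite -natrM ler_nat (fast_denominator_growth r32 fa).
have /andP[d1 d2] := fast_distance r32 fa k.+1.
set d := `|_| in d1 d2.
have d0 : 0 < d by have := q0R k.+2; nra.
have qd : 8 * (q k.+1)%:R * d < 1.
  have : 16 * (q k.+1)%:R * d <= (q k.+2)%:R * d by rewrite ler_pM2r.
  by lra.
have bd : `|beta - (B k.+1)%:R / (q k.+1)%:R| <= 4 * d.
  apply: le_trans (cb k.+1) _; rewrite ler_pdivrMr//; lra.
have D := @diameter_upper R alpha (p k.+1) (q k.+1) (B k.+1) (q k) beta N
  (q0 k.+1) (fast_coprime fa k.+1) (q0 k) d0 qd bd (fast_inverse fa k).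
apply: le_trans D _.
rewrite -/d.
have /andP[g1 _] := grow k; have /andP[g2 _] := grow k.+1.
have r0 : 0 < rho by lra.
have qr : (q k)%:R <= (q k.+1)%:R `^ rho^-1 :> R.
  rewrite -[leLHS]powRr1 ?ler0n// -[X in _ `^ X <= _](divff (lt0r_neq0 r0)) powRrM.
  by apply: le_powR => //; rewrite invr_ge0 ltW.
have rV : (q k.+1)%:R `^ rho * (q k.+1)%:R `^ (rho^-1 - rho) = (q k.+1)%:R `^ rho^-1 :> R.
  by rewrite -gt0_powRD// subrKC.
set x := _ `^ rho in g2 rV; set y := _ `^ (_ - _) in rV *.
have x0 : 0 < x by rewrite powR_gt0.
have xd : x * d <= 9 / 8 by apply: le_trans d2; rewrite ler_pM2r.
have sd : (q k)%:R * d <= 9 / 8 * y.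
  rewrite -(ler_pM2l x0) [x * (_ * y)]mulrCA rV mulrCA.
  apply: (@le_trans _ _ ((q k)%:R * (9 / 8))); first by rewrite ler_pM2l.
  by rewrite mulrC ler_pM2l.
have : N%:R * ((q k)%:R * d) <= N%:R * (9 / 8 * y) by rewrite ler_wpM2l.
by have := q16 k; have := q0R k; lra.
Qed.

(** The index is chosen by [q k.+1 <= N ^ s < q k.+2], which bounds the first term. Since
    [1 - s = s * (1 - 1 / rho ^ 2)], the upper inequality bounds [N ^ (1 - s)] by
    [4 * q k.+1 ^ (rho - 1 / rho)], so the second term is also of order [N ^ s];
    [254 = 2 + 63 * 4]. *)
Lemma fast_Gamma_sup rho alpha beta p q B : 3 / 2 < rho ->
  fast_approximated rho alpha p q -> fast_coded beta q B ->
  (Gamma_sup alpha beta <= (rho ^+ 2 / (2 * rho ^+ 2 - 1))%:E)%E.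
Proof.
move=> r32 fa cb; have [_ grow _ _] := fa.
set s := _ / _; have r0 : 0 < rho by lra.
have rr : 9 / 4 < rho ^+ 2 by rewrite expr2; nra.
have s0 : 0 < s by rewrite divr_gt0; lra.
have [x0 Hx] := powR_large (q 1)%:R s0.
apply: (@Gamma_sup_le _ _ 254); exists (Num.truncn x0).+1 => N Nx.
have xN : x0 <= N%:R by apply: le_trans (ltW (truncnS_gt x0)) _; rewrite ler_nat.
have N0 : 0 < N%:R :> R by rewrite ltr0n; apply: leq_trans Nx.
have [[|k] [//= _ k1 k2]] := fast_bracket r32 fa (Hx _ xN).
have q0 : 0 < (q k.+1)%:R :> R.
  by rewrite ltr0n (leq_trans _ (fast_denominator_ge r32 fa k.+1)).
apply: le_trans (fast_diameter k N r32 fa cb) _.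
have /andP[_ g] := grow k.+1.
have c1 : rho * (1 - (rho ^+ 2)^-1) = rho - rho^-1 by field; rewrite gt_eqF.
have c0 : 0 <= 1 - (rho ^+ 2)^-1 by rewrite subr_ge0 invf_le1; lra.
have h1 : N%:R `^ (s * (1 - (rho ^+ 2)^-1)) <= 4 * (q k.+1)%:R `^ (rho - rho^-1).
  rewrite powRrM -c1 powRrM.
  apply: (@le_trans _ _ ((4 * (q k.+1)%:R `^ rho) `^ (1 - (rho ^+ 2)^-1))).
    by apply: le_powR; rewrite ?powR_ge0//; lra.
  rewrite powRM ?powR_ge0// ler_wpM2r ?powR_ge0//.
  rewrite -[leRHS]powRr1// ler_powR ?ler1n// gerBl invr_ge0; lra.
have h2 : N%:R = N%:R `^ s * N%:R `^ (s * (1 - (rho ^+ 2)^-1)).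
  rewrite -gt0_powRD// -[LHS]powRr1 ?ltW//; congr (_ `^ _).
  by rewrite /s; field; rewrite !gt_eqF//; lra.
have h3 : (q k.+1)%:R `^ (rho - rho^-1) * (q k.+1)%:R `^ (rho^-1 - rho) = 1 :> R.
  by rewrite -gt0_powRD// addrA subrK subrr powRr0.
have h4 : N%:R * (q k.+1)%:R `^ (rho^-1 - rho) <= 4 * N%:R `^ s.
  rewrite {1}h2 -mulrA mulrC ler_wpM2r ?powR_ge0//.
  apply: le_trans (ler_wpM2r (powR_ge0 _ _) h1) _.
  by rewrite -mulrA h3 mulr1.
lra.
Qed.

(** The length [N], about [x ^ w], balances the two terms of [fast_diameter], both then at most a
    multiple of [x], and [w * g = 1] turns [x] into [N ^ g]; [130 = 2 * (2 + 63)]. *)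
Lemma fast_Gamma_inf rho alpha beta p q B : 3 / 2 < rho ->
  fast_approximated rho alpha p q -> fast_coded beta q B ->
  (Gamma_inf alpha beta <= (rho / (rho ^+ 2 + rho - 1))%:E)%E.
Proof.
move=> r32 fa cb; have r0 : 0 < rho by lra.
have rr : 9 / 4 < rho ^+ 2 by rewrite expr2; nra.
set g := _ / _; pose w := 1 + rho - rho^-1.
have rV : rho^-1 < 1 by rewrite invf_lt1//; lra.
have wg : w * g = 1 by rewrite /w /g; field; rewrite !gt_eqF//; lra.
have g0 : 0 < g by rewrite divr_gt0//; lra.
have g1 : g <= 1 by rewrite ler_pdivrMr; lra.
apply: (@Gamma_inf_le _ _ 130) => N0.
have q1 : 1 <= (q N0.+1)%:R :> R.
  by rewrite ler1n (leq_trans _ (fast_denominator_ge r32 fa N0.+1)).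
set x := (q N0.+1)%:R in q1.
have x0 : 0 < x by lra.
have xw : x <= x `^ w by rewrite -[leLHS]powRr1 ?(ltW x0)// ler_powR// /w; lra.
have [n1 n2] := truncn_bounds (powR_ge0 x w); set N := Num.truncn _ in n1 n2.
have Nq : (q N0.+1 <= N)%N by rewrite -ltnS -(ltr_nat R) -natr1; apply: le_lt_trans xw n2.
have N1 : (N0 < N)%N.
  by apply: leq_trans Nq; apply: ltnW; exact: fast_denominator_gt r32 fa N0.+1.
have N1R : 1 <= N%:R :> R by rewrite ler1n (leq_trans _ N1).
exists N; first exact: ltnW.
apply: le_trans (fast_diameter N0 N r32 fa cb) _; rewrite -/x.
have h1 : N%:R * x `^ (rho^-1 - rho) <= x.
  apply: (@le_trans _ _ (x `^ w * x `^ (rho^-1 - rho))); first by rewrite ler_wpM2r ?powR_ge0.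
  by rewrite -gt0_powRD// (_ : w + _ = 1) ?powRr1 ?(ltW x0)// /w; lra.
have h2 : x <= 2 * N%:R `^ g.
  rewrite -[leLHS](powRr1 (ltW x0)) -[X in _ `^ X <= _]wg powRrM.
  apply: (@le_trans _ _ ((2 * N%:R) `^ g)); first by apply: le_powR; rewrite ?powR_ge0//; lra.
  rewrite powRM// ler_wpM2r ?powR_ge0//.
  by rewrite -[leRHS]powRr1// ler_powR// ler1n.
lra.
Qed.

Theorem typical_exponents_sharp rho : golden_ratio < rho ->
  exists A : set R, ~ countable A /\
    forall alpha, A alpha ->
      [/\ irrational alpha,
          irrationality_exponent alpha = (1 + rho)%:E
        & ~ countable [set beta : R | 0 < beta < 1 /\
            [/\ Gamma_sup alpha beta = GammaL_sup alpha beta,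
                GammaL_sup alpha beta = (rho ^+ 2 / (2 * rho ^+ 2 - 1))%:E,
                Gamma_inf alpha beta = GammaL_inf alpha beta
              & GammaL_inf alpha beta = (rho / (rho ^+ 2 + rho - 1))%:E]]].
Proof.
move=> rg; have [r32 _] := golden_ratio_lt rg.
exists [set alpha | exists p q, fast_approximated rho alpha p q].
split; first exact: fast_approximated_uncountable.
move=> alpha [p [q fa]]; have ia := fast_irrational r32 fa; have ie := fast_exponent r32 fa.
split=> // cnt.
have [q256 _ _ _] := fa.
apply: (coded_uncountable q256 (fast_denominator_growth r32 fa)).
apply: sub_countable cnt; apply: subset_card_le => beta [b01 [B cb]]; split=> //.
have := typical_exponents_ge ia; rewrite ie /= -EFinB addrAC subrr add0r lte_fin.
move=> /(_ rg _ b01)[h1 h2 h3 h4].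
have s := fast_Gamma_sup r32 fa cb; have i := fast_Gamma_inf r32 fa cb.
split; apply/eqP; rewrite eq_le.
- by rewrite h1 andbT; apply: le_trans s h2.
- by rewrite h2 andbT; apply: le_trans h1 s.
- by rewrite h3 andbT; apply: le_trans i h4.
- by rewrite h4 andbT; apply: le_trans h3 i.
Qed.

End Sharpness.

Theorem theorem4 (R : realType) :
  (forall alpha : R, irrational alpha ->
     let rho : \bar R := (irrationality_exponent alpha - 1)%E in
     (golden_ratio%:E < rho)%E ->
     forall beta : R, 0 < beta < 1 ->
       [/\ (GammaL_sup alpha beta <= Gamma_sup alpha beta)%E,
           (sup_bound rho <= GammaL_sup alpha beta)%E,
           (GammaL_inf alpha beta <= Gamma_inf alpha beta)%E
         & (inf_bound rho <= GammaL_inf alpha beta)%E])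
  /\
  (forall rho : R, golden_ratio < rho ->
     exists A : set R, ~ countable A /\
       forall alpha : R, A alpha ->
         [/\ irrational alpha,
             irrationality_exponent alpha = (1 + rho)%:E
           & ~ countable [set beta : R | 0 < beta < 1 /\
               [/\ Gamma_sup alpha beta = GammaL_sup alpha beta,
                   GammaL_sup alpha beta = (rho ^+ 2 / (2 * rho ^+ 2 - 1))%:E,
                   Gamma_inf alpha beta = GammaL_inf alpha beta
                 & GammaL_inf alpha beta = (rho / (rho ^+ 2 + rho - 1))%:E]]]).
Proof.
by split; [exact: typical_exponents_ge|exact: typical_exponents_sharp].
Qed.
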